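(* Let $t_0<t_1$ with $t_1>0$, $0<a<b<1$, $a_0\in\mathbb{R}$, and let $\alpha:\mathbb{R}\to[a,b]$ be continuously differentiable with bounded derivative. Let $\Pi$ be a Poisson point process on $(t_0,t_1)\times\mathbb{R}$ with plane Lebesgue measure $\mathcal{L}^2$ as mean measure, and let $Z$ be the process whose sample paths are almost surely in $D[t_0,t_1)$ and satisfy $$Z(t)=a_0+\sum_{(X,Y)\in\Pi}1_{(t_0,t]}(X)\,Y^{\langle-1/\alpha(Z(X_-))\rangle}\qquad(t_0\le t<t_1).$$ Then $Z$ is strongly right-localizable at each $t\in[t_0,t_1)$, in the sense that, conditionally on $\mathcal{F}_t$, $$\frac{Z(t+ru)-Z(t)}{r^{1/\alpha(Z(t))}}\bigg|\,\mathcal{F}_t\ \stackrel{\mathrm{dist}}{\longrightarrow}\ L^0_{\alpha(Z(t))}(u)$$ as $r\searrow0$, where both sides are regarded as random functions of $u$ and the convergence is in distribution with respect to $(D[0,t_1),\rho_S)$, where $\rho_S$ is the Skorohod metric; and so there is also convergence in finite dimensional distributions.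
   Context: For $c<d$, $D[c,d)$ denotes the càdlàg functions $f:[c,d)\to\mathbb{R}$: $f$ is right continuous at every $u\in[c,d)$, and the left limit $f(u_-):=\lim_{t\nearrow u}f(t)$ exists (and is finite) for every $u\in(c,d]$, including at $u=d$. The Skorohod metric on $D[c,d)$ is $\rho_S(f,g)=\inf_{w\in\mathcal{W}}\max\{\|w-i\|_\infty,\|f-g\circ w\|_\infty\}$, where $\mathcal{W}$ is the class of strictly increasing homeomorphisms of $[c,d)$, $i$ is the identity, and $\|\cdot\|_\infty$ is the supremum norm. For real $r,s$ write $r^{\langle s\rangle}=\mathrm{sign}(r)|r|^s$. A Poisson point process with mean measure $\mu$ is a random countable set $\Pi$ such that the number of points in each Borel set $A$ has Poisson distribution with mean $\mu(A)$, independently for disjoint Borel sets. Almost surely there is exactly one function $Z\in D[t_0,t_1)$ satisfying the displayed identity for $Z$, so $Z$ is well defined. $\mathcal{F}_t$ is the $\sigma$-field underlying (generated by) the restricted point process $\Pi\cap((t_0,t]\times\mathbb{R})$. For constant $\beta\in(0,1)$, $L^0_\beta$ is the non-normalized symmetric $\beta$-stable Lévy motion, represented by the almost surely absolutely convergent sum $L^0_\beta(t)=\sum_{(X,Y)\in\Pi'}1_{(0,t]}(X)\,Y^{\langle-1/\beta\rangle}$ ($t\ge0$), with $\Pi'$ a Poisson point process on $\mathbb{R}^+\times\mathbb{R}$ with mean measure $\mathcal{L}^2$. The convergence statement means: conditionally on $\mathcal{F}_t$ (so that $Z(t)$ is fixed), the conditional law of $u\mapsto r^{-1/\alpha(Z(t))}(Z(t+ru)-Z(t))$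 on $[0,t_1)$, which is defined for all sufficiently small $r>0$, converges weakly as $r\searrow0$ to the law of $L^0_\beta$ with the constant index $\beta=\alpha(Z(t))$. *)

(* Defs.v *)
From HB Require Import structures.
From mathcomp Require Import all_boot all_order all_algebra.
From mathcomp Require Import all_classical all_reals all_analysis.
From mathcomp Require Import measurable_realfun.

Set Implicit Arguments.
Unset Strict Implicit.
Unset Printing Implicit Defensive.

Import Order.TTheory GRing.Theory Num.Theory.
Import numFieldNormedType.Exports.

Local Open Scope classical_set_scope.
Local Open Scope ring_scope.

Definition spow (R : realType) (r s : R) : R := Num.sg r * `|r| `^ s.

(* The value of an absolutely convergent sum over an arbitrary index set;
   meaningful when [summable S (EFin \o f)]. *)
Definition sum_over (R : realType) (T : choiceType) (S : set T) (f : T -> R) : R :=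
  fine (\esum_(x in S) (Num.max (f x) 0)%:E)
  - fine (\esum_(x in S) (Num.max (- f x) 0)%:E).

Section skorohod.
Context {R : realType}.
Implicit Types (c d : R) (f g w : R -> R).

(* A function on [c, d) is represented by a function on R whose values outside
   [c, d) play no role: every notion below only looks at it on [c, d), so the
   Skorohod metric becomes a pseudometric on representatives. *)
Definition is_cadlag c d f : Prop :=
  (forall u, c <= u < d -> f x @[x --> u^'+] --> f u) /\
  (forall u, c < u <= d -> cvg (f x @[x --> u^'-])).

Record cadlag c d := Cadlag {
  cadlag_path :> R -> R;
  cadlagP : is_cadlag c d cadlag_path }.

Lemma is_cadlag0 c d : is_cadlag c d (fun=> 0).
Proof.
split=> u _; first exact: cvg_cst.
by apply/cvg_ex; exists 0; exact: cvg_cst.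
Qed.

(* Total, so that a process with almost surely cadlag paths, possibly with bad
   paths on a null set, still gives a map into [cadlag c d]. *)
Definition to_cadlag c d f : cadlag c d :=
  if pselect (is_cadlag c d f) is left fD then Cadlag fD
  else Cadlag (is_cadlag0 c d).

Definition time_change c d : set (R -> R) := [set w |
  {in `[c, d[ &, {homo w : x y / x < y}} /\
  exists v, [/\ {homo w : x / x \in `[c, d[} /\ {homo v : x / x \in `[c, d[},
    {in `[c, d[, cancel w v}, {in `[c, d[, cancel v w},
    {within `[c, d[, continuous w} & {within `[c, d[, continuous v}]].

Definition sup_norm c d g : \bar R :=
  ereal_sup [set `|g u|%:E | u in `[c, d[].

Definition skorohod c d f g : \bar R :=
  ereal_inf [set maxe (sup_norm c d (w \- id)) (sup_norm c d (f \- (g \o w)))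
            | w in time_change c d].

Definition skorohod_ball c d (f : cadlag c d) (e : R) (g : cadlag c d) : Prop :=
  (skorohod c d f g < e%:E)%E.

Lemma skorohod_ballP c d (f : cadlag c d) e (g : cadlag c d) :
  skorohod_ball f e g <->
  exists2 w, time_change c d w & exists2 e', e' < e &
    forall u, u \in `[c, d[ -> `|w u - u| <= e' /\ `|f u - g (w u)| <= e'.
Proof.
split.
  move=> /ereal_inf_lt[_ [w wW <-]].
  set m := maxe _ _ => me; exists w => //.
  have [e' e'e me'] : exists2 e', e' < e & (m <= e'%:E)%E.
    move: me; case: m => [r re| //|_]; first by exists r.
    by exists (e - 1); [rewrite ltrBlDr ltrDl|exact: leNye].
  exists e' => // u uI; move: me'; rewrite ge_max => /andP[h1 h2].
  split; rewrite -lee_fin.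
    by apply: le_trans h1; apply: ereal_sup_ubound; exists u.
  by apply: le_trans h2; apply: ereal_sup_ubound; exists u.
move=> [w wW [e' e'e h]]; rewrite /skorohod_ball.
apply: (@le_lt_trans _ _ e'%:E); last by rewrite lte_fin.
apply: ereal_inf_le; exists (maxe (sup_norm c d (w \- id))
  (sup_norm c d (f \- (g \o w)))); first by exists w.
by rewrite ge_max; apply/andP; split; apply: ge_ereal_sup => _ [u /= uI <-];
  rewrite lee_fin; have [] := h u uI.
Qed.

Lemma time_change_id c d : time_change c d id.
Proof.
have cid : {within `[c, d[, continuous (id : R -> R)}.
  by apply: continuous_subspaceT => x; exact: cvg_id.
by split=> //; exists id; split=> //; split.
Qed.

Lemma within_comp c d f g : {homo f : x / x \in `[c, d[} ->
  {within `[c, d[, continuous f} -> {within `[c, d[, continuous g} ->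
  {within `[c, d[, continuous (g \o f)}.
Proof.
move=> fI /subspace_continuousP cf /subspace_continuousP cg.
apply/subspace_continuousP => x xI.
apply: cvg_comp (cg (f x) (fI x xI)) => A /=.
rewrite /within/= => fA.
have /= := cf x xI _ fA; rewrite /nbhs/= /within/=.
by apply: filterS => y h yI; apply: h yI (fI _ yI).
Qed.

Lemma skorohod_ball_center c d (f : cadlag c d) e : 0 < e -> skorohod_ball f e f.
Proof.
move=> e0; apply/skorohod_ballP; exists id; first exact: time_change_id.
by exists 0 => // u _; rewrite !subrr normr0.
Qed.

Lemma skorohod_ball_sym c d (f g : cadlag c d) e :
  skorohod_ball f e g -> skorohod_ball g e f.
Proof.
move=> /skorohod_ballP[w [wlt [v [[wI vI] wv vw cw cv]]] [e' e'e h]].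
apply/skorohod_ballP; exists v.
  split; last by exists w; split.
  move=> x y xI yI xy; rewrite ltNge; apply/negP; rewrite le_eqVlt => /orP[/eqP vxy|vyx].
    by move: xy; rewrite -(vw x xI) -vxy vw// ltxx.
  by have := wlt _ _ (vI _ yI) (vI _ xI) vyx; rewrite !vw// => /(lt_trans xy); rewrite ltxx.
exists e' => // u uI; have [] := h _ (vI _ uI).
by rewrite vw// => h1 h2; rewrite distrC; split => //; rewrite distrC.
Qed.

Lemma skorohod_ball_triangle c d (f g h : cadlag c d) e1 e2 :
  skorohod_ball f e1 g -> skorohod_ball g e2 h -> skorohod_ball f (e1 + e2) h.
Proof.
move=> /skorohod_ballP[w [wlt [v [[wI vI] wv vw cw cv]]] [e1' le1 h1]].
move=> /skorohod_ballP[w' [w'lt [v' [[w'I v'I] wv' vw' cw' cv']]] [e2' le2 h2]].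
apply/skorohod_ballP; exists (w' \o w).
  split; first by move=> x y xI yI xy /=; apply: w'lt; [exact: wI..|exact: wlt].
  exists (v \o v'); split.
  - by split=> x xI /=; [apply: w'I; exact: wI|apply: vI; exact: v'I].
  - by move=> x xI /=; rewrite wv' ?wv//; exact: wI.
  - by move=> x xI /=; rewrite vw ?vw'//; exact: v'I.
  - exact: within_comp.
  - exact: within_comp.
exists (e1' + e2'); first exact: ltrD.
move=> u uI /=; have [a1 b1] := h1 u uI; have [a2 b2] := h2 _ (wI _ uI); split.
  by rewrite [leRHS]addrC (le_trans (ler_distD (w u) _ _))// lerD.
by rewrite (le_trans (ler_distD (g (w u)) _ _))// lerD.
Qed.

HB.instance Definition _ c d := gen_eqMixin (cadlag c d).
HB.instance Definition _ c d := gen_choiceMixin (cadlag c d).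
HB.instance Definition _ c d :=
  isPointed.Build (cadlag c d) (Cadlag (is_cadlag0 c d)).
HB.instance Definition _ c d := hasNbhs.Build (cadlag c d)
  (nbhs_ (entourage_ (@skorohod_ball c d))).
HB.instance Definition _ c d := @Nbhs_isPseudoMetric.Build R (cadlag c d)
  (entourage_ (@skorohod_ball c d)) erefl (@skorohod_ball c d)
  (@skorohod_ball_center c d) (@skorohod_ball_sym c d)
  (@skorohod_ball_triangle c d) erefl.

End skorohod.

Definition borel (T : ptopologicalType) := g_sigma_algebraType (@open T).

Section point_process.
Context {R : realType} d {Omega : measurableType d}.
Implicit Types (P : probability Omega R) (Pi : Omega -> set (R * R)).

Definition count Pi (A : set (R * R)) (w : Omega) : \bar R :=
  counting (Pi w `&` A).

(* A Poisson variable of mean +oo is almost surely +oo.  The second argument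
   of [poisson_prob] is a dummy. *)
Definition poisson_point_process P (S : set (R * R))
    (mu : set (R * R) -> \bar R) Pi : Prop :=
  [/\ forall w, countable (Pi w) /\ Pi w `<=` S,
      forall A, measurable A -> A `<=` S -> measurable_fun setT (count Pi A),
      forall A, measurable A -> A `<=` S ->
        (forall r : R, mu A = r%:E -> forall k : nat,
           P [set w | count Pi A w = k%:R%:E] = poisson_prob r 0 [set k]) /\
        (mu A = +oo%E -> P [set w | count Pi A w = +oo%E] = 1%E) &
      forall (n : nat) (A : 'I_n -> set (R * R)) (B : 'I_n -> set (\bar R)),
        (forall i, measurable (A i) /\ A i `<=` S) -> trivIset setT A ->
        (forall i, measurable (B i)) ->
        P [set w | forall i, B i (count Pi (A i) w)] =
        (\prod_(i < n) P [set w | B i (count Pi (A i) w)])%E].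

Definition point_process_sigma Pi : set (set Omega) :=
  <<s [set E | exists2 A, measurable A &
        exists2 B, measurable B & E = count Pi A @^-1` B] >>.

(* kappa is a regular version of the conditional law of X given the
   sigma-algebra G, i.e. E[1_B(X) 1_F] = E[kappa(B) 1_F] for F in G.
   When X is only almost surely equal to a measurable map, {X \in B} may fail
   to be an event by a null set, which the integral ignores. *)
Definition conditional_law P (G : set (set Omega)) (T : ptopologicalType)
    (X : Omega -> T) (kappa : Omega -> probability (borel T) R) : Prop :=
  forall B : set (borel T), measurable B ->
    (forall V : set (\bar R), measurable V -> G ((kappa ^~ B) @^-1` V)) /\
    (forall F, G F ->
       (\int[P]_(w in F) (\1_B (X w))%:E = \int[P]_(w in F) kappa w B)%E).

End point_process.

Definition cvg_in_distribution (R : realType) d (T : measurableType d)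
    (P : probability T R) d' (T' : measurableType d') (P' : probability T' R)
    (S : topologicalType) (I : Type) (F : set_system I)
    (X : I -> T -> S) (Y : T' -> S) : Prop :=
  forall phi : S -> R, continuous phi -> (exists M, forall x, `|phi x| <= M) ->
    ('E_P[phi \o X i] @[i --> F] --> 'E_P'[phi \o Y])%E.

(* L^0_beta(u) built on the point set Pi' of R^+ x R *)
Definition stable_motion (R : realType) (beta : R) (Pi' : set (R * R)) (u : R) : R :=
  sum_over (Pi' `&` (`]0, u] `*` setT)) (fun p => spow p.2 (- beta^-1)).

Definition rescale (R : realType) (alpha : R -> R) (t : R) (f : R -> R) (r u : R) : R :=
  r `^ (- (alpha (f t))^-1) * (f (t + r * u) - f t).

(* Main.v *)
Require Import Defs.
From HB Require Import structures.
From mathcomp Require Import all_boot all_order all_algebra.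
From mathcomp Require Import all_classical all_reals all_analysis.
From mathcomp Require Import measurable_realfun.
From mathcomp Require Import lra.

Set Implicit Arguments.
Unset Strict Implicit.
Unset Printing Implicit Defensive.
Import Order.TTheory GRing.Theory Num.Theory.
Import numFieldNormedType.Exports.
Local Open Scope classical_set_scope.
Local Open Scope ring_scope.

(** Every jump of [Z] is caused by a point [(X, Y)] and has size about
    [|Y| ^ (- 1 / alpha)], so that far points cause small jumps, and [alpha < 1]
    makes the jumps summable. For almost every configuration the equation for
    [Z] can therefore be read path by path: its right-hand side is a
    contraction for a norm weighted by the growth of the sum of the Lipschitz
    constants of the jumps ([contraction]), so it has exactly one solution,
    and the solution up to time [s] depends on the points up to time [s] only
    ([sol_unique], [sol_causal]). Moreover the solution is a measurable function
    of the configuration ([measurable_sol_path]).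

    Write the configuration as its part before [t] and its part after [t].
    The two are independent ([restr_indep]), so a version of the conditional law
    of [Z] given the past is the law of the solution for the configuration
    that keeps the past and draws a new future
    ([stitched_conditional_law]). Borel sets of the path space are generated by
    countably many events that form a pi-system, so any other version agrees
    with this one almost surely ([conditional_law_unique]). It remains to prove,
    for a fixed past, an unconditional limit theorem.

    Fix the past, let [z] be the value at time [t] and [beta = alpha z]. On the
    window [(t, t + r t1)] and outside an event of small probability, all points
    satisfy [|Y| > c / r], the path stays within [r] of [z], and the
    sums that control the error are as small as their means suggest
    ([far_points]). Replacing [alpha (Z (X -))] by [beta] in the exponents then
    changes the path by [o (r ^ (1 / beta))] uniformly on the window
    ([frozen_coefficient]). With the index frozen, the increments after time [t]
    multiplied by [r ^ (- 1 / beta)] are exactly the [beta]-stable motion built on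
    the points [((X - t) / r, r Y)] ([stable_motion_zoom]); this map preserves the
    area, so these points have the law of the Poisson process that defines
    the stable motion ([zoom_area], [transported_law]).

    Thus the rescaled path is uniformly close, in probability, to a process with
    the limit law, which gives weak convergence ([weak_convergence]). The
    argument is run for an arbitrary functional of the path that is measurable
    and continuous for uniform closeness ([kernel_convergence]); the two parts
    of the theorem are the cases of the path itself, with the Skorohod
    distance, and of the vector of its values at finitely many times. *)


(** * Sums over arbitrary index sets *)

Section sums.
Context {R : realType} {T : choiceType}.
Implicit Types (S : set T) (f g h : T -> R).

Definition psum S h : R := fine (\esum_(x in S) (h x)%:E).

Lemma esum_subset S S' (a : T -> \bar R) : (forall x, S x -> (0 <= a x)%E) ->
  S' `<=` S -> (\esum_(x in S') a x <= \esum_(x in S) a x)%E.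
Proof.
move=> a0 S'S; rewrite (esumID S' S)//.
rewrite (_ : S `&` S' = S'); last by apply/setIidr.
by rewrite leeDl// esum_ge0// => x [/a0].
Qed.

Lemma summable_fin S h : (forall x, S x -> 0 <= h x) ->
  summable S (EFin \o h) -> \esum_(x in S) (h x)%:E \is a fin_num.
Proof.
move=> h0; rewrite summableE; congr (_ \is a fin_num).
by apply: eq_esum => x Sx /=; rewrite ger0_norm ?h0.
Qed.

Lemma summable_lt S h : (forall x, S x -> 0 <= h x) ->
  (\esum_(x in S) (h x)%:E < +oo)%E -> summable S (EFin \o h).
Proof.
move=> h0; congr (_ < _)%E.
by apply: eq_esum => x Sx /=; rewrite ger0_norm ?h0.
Qed.

Lemma le_summable S f h : (forall x, S x -> `|f x| <= h x) ->
  summable S (EFin \o h) -> summable S (EFin \o f).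
Proof.
move=> fh; apply: le_lt_trans; apply: le_esum => x Sx.
by rewrite /= lee_fin (le_trans (fh _ Sx))// ler_norm.
Qed.

Lemma sub_summable S S' f : S' `<=` S ->
  summable S (EFin \o f) -> summable S' (EFin \o f).
Proof. by move=> S'S; apply: le_lt_trans; apply: esum_subset. Qed.

Lemma psum_ge0 S h : (forall x, S x -> 0 <= h x) -> 0 <= psum S h.
Proof. by move=> h0; apply/fine_ge0/esum_ge0 => x /h0; rewrite lee_fin. Qed.

Lemma psum_le S f h : (forall x, S x -> 0 <= f x <= h x) ->
  summable S (EFin \o h) -> psum S f <= psum S h.
Proof.
move=> fh sh.
have h0 x : S x -> 0 <= h x by move=> /fh /andP[]; exact: le_trans.
have f0 x : S x -> 0 <= f x by move=> /fh /andP[].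
apply: fine_le.
- apply: summable_fin => //; apply: le_summable sh => x Sx.
  by rewrite ger0_norm ?f0//; case/andP: (fh x Sx).
- exact: summable_fin.
- by apply: le_esum => x /fh/andP[_]; rewrite lee_fin.
Qed.

Lemma psum_subset S S' h : (forall x, S x -> 0 <= h x) -> S' `<=` S ->
  summable S (EFin \o h) -> psum S' h <= psum S h.
Proof.
move=> h0 S'S sh; apply: fine_le; last 1 first.
- exact: esum_subset.
- by apply: summable_fin; [move=> x /S'S/h0|exact: sub_summable sh].
- exact: summable_fin.
Qed.

Lemma psumD S f h : (forall x, S x -> 0 <= f x) -> (forall x, S x -> 0 <= h x) ->
  summable S (EFin \o f) -> summable S (EFin \o h) ->
  psum S (fun x => f x + h x) = psum S f + psum S h.
Proof.
move=> f0 h0 sf sh; rewrite /psum.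
under eq_esum do rewrite EFinD.
by rewrite esumD// fineD// summable_fin.
Qed.

Lemma psumID S' S h : (forall x, S x -> 0 <= h x) -> summable S (EFin \o h) ->
  psum S h = psum (S `&` S') h + psum (S `&` ~` S') h.
Proof.
move=> h0 sh; rewrite /psum (esumID S' S)// fineD//.
all: apply: summable_fin; [by move=> x [/h0]|exact: sub_summable sh].
Qed.

Lemma esumZ S h (c : R) : 0 <= c -> (forall x, S x -> 0 <= h x) ->
  \esum_(x in S) (c * h x)%:E = (c%:E * \esum_(x in S) (h x)%:E)%E.
Proof.
move=> + h0; rewrite le_eqVlt => /predU1P[<-|c0].
  by rewrite mul0e esum1// => x _; rewrite mul0r.
have key (e : R) (u : T -> R) : 0 < e -> (forall x, S x -> 0 <= u x) ->
    (\esum_(x in S) (e * u x)%:E <= e%:E * \esum_(x in S) (u x)%:E)%E.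
  move=> e0 u0; apply: ge_ereal_sup => /= _ [X [finX XS]] <-.
  rewrite -lee_pdivrMl//; apply: esum_ge; exists X => //.
  rewrite !fsbig_finite//= !sumEFin -EFinM lee_fin ler_pdivrMl//.
  by rewrite mulr_sumr.
apply/eqP; rewrite eq_le key//=.
rewrite -lee_pdivlMl//.
have := key c^-1 (fun x => c * h x); rewrite invr_gt0 => /(_ c0).
under eq_esum do rewrite mulKf ?gt_eqF//.
by apply=> x Sx; rewrite mulr_ge0 ?h0// ltW.
Qed.

Lemma psumZ S h (c : R) : 0 <= c -> (forall x, S x -> 0 <= h x) ->
  summable S (EFin \o h) -> psum S (fun x => c * h x) = c * psum S h.
Proof. by move=> c0 h0 sh; rewrite /psum esumZ// fineM// summable_fin. Qed.

Lemma sum_overZ S f (c : R) : 0 < c -> sum_over S (fun x => c * f x) = c * sum_over S f.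
Proof.
move=> c0; have c0' := ltW c0.
have E (u : T -> R) : fine (\esum_(x in S) (Num.max (c * u x) 0)%:E) =
    c * fine (\esum_(x in S) (Num.max (u x) 0)%:E).
  have -> : \esum_(x in S) (Num.max (c * u x) 0)%:E =
      (c%:E * \esum_(x in S) (Num.max (u x) 0)%:E)%E.
    rewrite -esumZ//; last by move=> x _; rewrite le_max lexx orbT.
    by apply: eq_esum => x _; rewrite maxr_pMr// mulr0.
  have : (0 <= \esum_(x in S) (Num.max (u x) 0)%:E)%E.
    by apply: esum_ge0 => x _; rewrite lee_fin le_max lexx orbT.
  case: (\esum_(x in S) _) => [r _//| |//].
  by rewrite gt0_muley ?lte_fin//= mulr0.
rewrite /sum_over E mulrBr -(E (fun x => - f x)); congr (_ - fine _).
by apply: eq_esum => x _; rewrite mulrN.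
Qed.

Lemma summableZ S h (c : R) : summable S (EFin \o h) ->
  summable S (EFin \o (fun x => c * h x)).
Proof.
move=> sh.
have key : (\esum_(x in S) (`|c| * `|h x|)%:E <= `|c|%:E * \esum_(x in S) (`|h x|)%:E)%E.
  apply: ge_ereal_sup => /= _ [X [finX XS]] <-.
  have : (`|c|%:E * \sum_(x \in X) `|h x|%:E <= `|c|%:E * \esum_(x in S) (`|h x|)%:E)%E.
    by apply: lee_wpmul2l => //; apply: esum_ge; exists X.
  apply: le_trans; rewrite !fsbig_finite//= !sumEFin -EFinM lee_fin.
  by rewrite mulr_sumr.
apply: le_lt_trans (le_lt_trans key _); last first.
  by apply: lte_mul_pinfty.
by apply: le_esum => x _ /=; rewrite normrM.
Qed.

Lemma summable_addr S f g : summable S (EFin \o f) -> summable S (EFin \o g) ->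
  summable S (EFin \o (fun x => f x + g x)).
Proof.
move=> sf sg; rewrite (_ : EFin \o _ = (EFin \o f) \+ (EFin \o g)); last first.
  by apply/funext => x /=; rewrite EFinD.
exact: summableD.
Qed.

Lemma le_sum_over_psum S f h : (forall x, S x -> `|f x| <= h x) ->
  summable S (EFin \o h) -> `|sum_over S f| <= psum S h.
Proof.
move=> fh sh.
have h0 x : S x -> 0 <= h x by move=> /fh; apply: le_trans.
rewrite /sum_over -/(psum S _) -/(psum S _).
have p0 : 0 <= psum S (fun x => Num.max (f x) 0).
  by apply: psum_ge0 => x _; rewrite le_max lexx orbT.
have n0 : 0 <= psum S (fun x => Num.max (- f x) 0).
  by apply: psum_ge0 => x _; rewrite le_max lexx orbT.
have pl : psum S (fun x => Num.max (f x) 0) <= psum S h.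
  apply: psum_le => // x Sx; rewrite le_max lexx orbT/= ge_max h0// andbT.
  exact: le_trans (ler_norm _) (fh _ Sx).
have nl : psum S (fun x => Num.max (- f x) 0) <= psum S h.
  apply: psum_le => // x Sx; rewrite le_max lexx orbT/= ge_max h0// andbT.
  by apply: le_trans (ler_norm _) _; rewrite normrN; exact: fh.
by rewrite ler_norml; apply/andP; split; lra.
Qed.

Lemma eq_sum_over S f g : (forall x, S x -> f x = g x) ->
  sum_over S f = sum_over S g.
Proof.
by move=> fg; rewrite /sum_over; congr (fine _ - fine _); apply: eq_esum => x Sx;
  rewrite fg.
Qed.

(** The value does not depend on how [f] is split into a difference of two
    summable nonnegative functions; this is what makes the sum additive. *)
Lemma sum_over_posneg S f h1 h2 :
  (forall x, S x -> 0 <= h1 x) -> (forall x, S x -> 0 <= h2 x) ->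
  summable S (EFin \o h1) -> summable S (EFin \o h2) ->
  (forall x, S x -> f x = h1 x - h2 x) ->
  sum_over S f = psum S h1 - psum S h2.
Proof.
move=> h10 h20 s1 s2 fE.
have sf : summable S (EFin \o f).
  apply: (@le_summable S f (fun x => h1 x + h2 x)); last exact: summable_addr.
  move=> x Sx; rewrite fE// (le_trans (ler_normB _ _))//.
  by rewrite !ger0_norm ?h10 ?h20.
have sp : summable S (EFin \o (fun x => Num.max (f x) 0)).
  apply: (@le_summable S _ (fun x => `|f x|)); last first.
    by rewrite /summable; under eq_esum do rewrite /= normr_id.
  move=> x Sx; rewrite ger0_norm ?le_max ?lexx ?orbT// ge_max normr_ge0 andbT.
  exact: ler_norm.
have sn : summable S (EFin \o (fun x => Num.max (- f x) 0)).
  apply: (@le_summable S _ (fun x => `|f x|)); last first.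
    by rewrite /summable; under eq_esum do rewrite /= normr_id.
  move=> x Sx; rewrite ger0_norm ?le_max ?lexx ?orbT// ge_max normr_ge0 andbT.
  by rewrite -normrN ler_norm.
apply/eqP; rewrite /sum_over -/(psum S _) -/(psum S _) subr_eq addrAC eq_sym subr_eq.
rewrite -!psumD//; try by move=> x _; rewrite le_max lexx orbT.
apply/eqP; congr fine; apply: eq_esum => x Sx; congr EFin.
rewrite fE//; rewrite /Num.max; case: ifPn => ?; case: ifPn => ?; lra.
Qed.

Let posneg (u : R) : u = Num.max u 0 - Num.max (- u) 0.
Proof. by rewrite /Num.max; case: ifPn => ?; case: ifPn => ?; lra. Qed.

Lemma summable_pos S f : summable S (EFin \o f) ->
  summable S (EFin \o (fun x => Num.max (f x) 0)).
Proof.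
move=> sf; apply: (@le_summable S _ (fun x => `|f x|)).
  move=> x Sx; rewrite ger0_norm ?le_max ?lexx ?orbT// ge_max normr_ge0 andbT.
  exact: ler_norm.
by rewrite /summable; under eq_esum do rewrite /= normr_id.
Qed.

Lemma summable_neg S f : summable S (EFin \o f) ->
  summable S (EFin \o (fun x => Num.max (- f x) 0)).
Proof.
by move=> sf; apply: summable_pos; rewrite /summable; under eq_esum do rewrite /= normrN.
Qed.

Lemma sum_overB S f g : summable S (EFin \o f) -> summable S (EFin \o g) ->
  sum_over S (fun x => f x - g x) = sum_over S f - sum_over S g.
Proof.
move=> sf sg.
rewrite (@sum_over_posneg S _ (fun x => Num.max (f x) 0 + Num.max (- g x) 0)
  (fun x => Num.max (- f x) 0 + Num.max (g x) 0)).
- have sf1 := summable_pos sf; have sf2 := summable_neg sf.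
  have sg1 := summable_pos sg; have sg2 := summable_neg sg.
  rewrite !psumD//; [|by move=> *; rewrite le_max lexx orbT..].
  by rewrite /sum_over /psum; lra.
- by move=> x _; rewrite addr_ge0// le_max lexx orbT.
- by move=> x _; rewrite addr_ge0// le_max lexx orbT.
- by apply: summable_addr; [exact: summable_pos|exact: summable_neg].
- by apply: summable_addr; [exact: summable_neg|exact: summable_pos].
- by move=> x _; have := posneg (f x); have := posneg (g x); lra.
Qed.

Lemma sum_overID S' S f : summable S (EFin \o f) ->
  sum_over S f = sum_over (S `&` S') f + sum_over (S `&` ~` S') f.
Proof.
move=> sf; rewrite /sum_over -!/(psum _ _).
have p0 g x : S x -> 0 <= Num.max (g x) 0 by rewrite le_max lexx orbT.
rewrite (psumID S' (p0 f) (summable_pos sf)).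
rewrite (psumID S' (p0 (fun x => - f x)) (summable_neg sf)).
by lra.
Qed.

(** All but [e] of a convergent sum is carried by finitely many terms, since the
    sum is a supremum over finite sets. *)
Lemma summable_tail S h (e : R) : (forall x, S x -> 0 <= h x) ->
  summable S (EFin \o h) -> 0 < e ->
  exists2 F : set T, finite_set F & forall S', S' `<=` S -> S' `&` F = set0 ->
    psum S' h <= e.
Proof.
move=> h0 sh e0.
have fS := summable_fin h0 sh.
have : (\esum_(x in S) (h x)%:E - e%:E < \esum_(x in S) (h x)%:E)%E.
  by rewrite lteBlDr// -(fineK fS) -EFinD lte_fin ltrDl.
rewrite {2}/esum => /ereal_sup_gt[_ [F [finF FS] <-]].
rewrite -esum_fset//; last by move=> i; rewrite inE => /FS/h0; rewrite lee_fin.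
move=> lt; exists F => // S' S'S S'F.
have le1 : psum S' h <= psum (S `&` ~` F) h.
  apply: psum_subset; [by move=> x [/h0]| |exact: sub_summable sh].
  move=> x S'x; split; first exact: S'S.
  by move=> Fx; have : (S' `&` F) x by []; rewrite S'F.
apply: (le_trans le1).
have := psumID F h0 sh; rewrite (_ : S `&` F = F); last exact/setIidr.
have fF : \esum_(x in F) (h x)%:E \is a fin_num.
  by apply: summable_fin; [move=> x /FS/h0|exact: sub_summable sh].
move: lt; rewrite -(fineK fS) -(fineK fF) -/(psum S h) -/(psum F h) -EFinB lte_fin.
by lra.
Qed.

End sums.

Lemma sum_over_image {R : realType} {T T' : choiceType} (S : set T)
    (e : T -> T') (f : T' -> R) : set_inj S e ->
  sum_over (e @` S) f = sum_over S (f \o e).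
Proof. by move=> ie; rewrite /sum_over !esum_image. Qed.

(** * The equation driven by the jumps of a point configuration *)

Lemma near_seq (U : Type) (eT : eqType) (F : set_system U) {FF : Filter F}
    (P : eT -> U -> Prop) (s : seq eT) :
  (forall q, q \in s -> \forall x \near F, P q x) ->
  \forall x \near F, forall q, q \in s -> P q x.
Proof.
elim: s => [|q s ih] h; first by apply: nearW => x q; rewrite in_nil.
have h1 := h q (mem_head _ _).
have /ih h2 : forall q', q' \in s -> \forall x \near F, P q' x.
  by move=> q' q's; apply: h; rewrite inE q's orbT.
near=> x => q'; rewrite inE => /predU1P[->|]; first by near: x.
by move: q'; near: x.
Unshelve. all: by end_near. Qed.

Section configurations.
Context {R : realType}.
Implicit Types (pi : set (R * R)) (f : R * R -> R).

(** [past] leaves out the points at time [s] itself: the jump at a point uses the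
    state just before it. *)
Definition past pi (s : R) := pi `&` [set q | q.1 < s].
Definition upto pi (s : R) := pi `&` [set q | q.1 <= s].

Lemma past_sub pi s : past pi s `<=` pi. Proof. exact: subIsetl. Qed.
Lemma upto_sub pi s : upto pi s `<=` pi. Proof. exact: subIsetl. Qed.
Lemma sum_over_diff pi f S S' (F : set (R * R)) e :
  summable pi (EFin \o f) -> S' `<=` S -> S `<=` pi ->
  (forall B, B `<=` pi -> B `&` F = set0 -> psum B (fun q => `|f q|) <= e) ->
  (forall q, F q -> S q -> S' q) ->
  `|sum_over S f - sum_over S' f| <= e.
Proof.
move=> sf S'S Spi Fe FS.
rewrite (@sum_overID _ _ S' S f); last exact: sub_summable sf.
rewrite (_ : S `&` S' = S'); last exact/setIidr.
rewrite [X in X - _]addrC addrK.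
have sub : S `&` ~` S' `<=` pi by move=> q [/Spi].
apply: (le_trans (@le_sum_over_psum _ _ _ f (fun q => `|f q|) _ _)) => //.
  apply: sub_summable sub _; rewrite /summable.
  by under eq_esum do rewrite /= normr_id.
apply: Fe => //; rewrite -subset0 => q [[Sq S'q] Fq]; apply: S'q; exact: FS.
Qed.

Lemma tail_finite pi f (e : R) : summable pi (EFin \o f) -> 0 < e ->
  exists2 s : seq (R * R), (forall q, q \in s -> pi q) &
  (forall B, B `<=` pi -> B `&` [set` s] = set0 -> psum B (fun q => `|f q|) <= e).
Proof.
move=> sf e0.
have sf' : summable pi (EFin \o (fun q => `|f q|)).
  by rewrite /summable; under eq_esum do rewrite /= normr_id.
have [F /finite_seqP[s ->] h] := summable_tail (fun q _ => normr_ge0 (f q)) sf' e0.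
exists [seq q <- s | q \in pi] => [q|B Bpi Bs].
  by rewrite mem_filter => /andP[/set_mem].
apply: h => //; rewrite -subset0 => q [Bq /= qs].
suff : (B `&` [set` [seq q <- s | q \in pi]]) q by rewrite Bs.
split; [exact: Bq|]; rewrite /= mem_filter qs andbT; by apply/mem_set/Bpi.
Qed.

(** Right continuity: the finitely many points carrying all but [e] of the sum
    do not lie in a small enough interval to the right of [u]. *)
Lemma upto_cvg_right pi f u : summable pi (EFin \o f) ->
  sum_over (upto pi s) f @[s --> u^'+] --> sum_over (upto pi u) f.
Proof.
move=> sf; apply/cvgrPdist_le => e e0.
have [F Fpi hF] := tail_finite sf e0.
have : \forall s \near u^'+, forall q, q \in F -> q.1 <= s -> q.1 <= u.
  apply: near_seq => // q _; have [qu|uq] := leP q.1 u.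
    by apply: nearW => s.
  by apply: filterS (nbhs_right_lt uq) => s sq; rewrite leNgt sq.
move=> H; near=> s; rewrite distrC.
apply: (sum_over_diff sf _ _ hF).
- move=> q [piq /= qu]; split => //=; apply: le_trans qu _; apply: ltW.
  by near: s; exact: nbhs_right_gt.
- exact: upto_sub.
- move=> q qF [piq qs]; split => //; move: q qF {piq} qs; near: s.
  exact: H.
Unshelve. all: by end_near. Qed.

Lemma upto_cvg_left pi f u : summable pi (EFin \o f) ->
  sum_over (upto pi s) f @[s --> u^'-] --> sum_over (past pi u) f.
Proof.
move=> sf; apply/cvgrPdist_le => e e0.
have [F Fpi hF] := tail_finite sf e0.
have : \forall s \near u^'-, forall q, q \in F -> q.1 < u -> q.1 <= s.
  apply: near_seq => // q _; have [uq|qu] := leP u q.1.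
    by apply: nearW => s.
  by apply: filterS (nbhs_left_gt qu) => s /ltW.
move=> H; near=> s.
apply: (sum_over_diff sf _ _ hF).
- move=> q [piq /= qs]; split => //=; apply: le_lt_trans qs _.
  by near: s; exact: nbhs_left_lt.
- exact: past_sub.
- move=> q qF [piq qs]; split => //; move: q qF {piq} qs; near: s.
  exact: H.
Unshelve. all: by end_near. Qed.

Lemma is_cadlag_upto pi f c d a0 : summable pi (EFin \o f) ->
  is_cadlag c d (fun s => a0 + sum_over (upto pi s) f).
Proof.
move=> sf; split=> u _.
  by apply: cvgD; [exact: cvg_cst|exact: upto_cvg_right].
apply/cvg_ex; exists (a0 + sum_over (past pi u) f).
by apply: cvgD; [exact: cvg_cst|exact: upto_cvg_left].
Qed.

End configurations.

Section picard.
Context {R : realType} (J : R -> R * R -> R) (g : R * R -> R).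
Hypothesis g0 : forall q, 0 <= g q.
Hypothesis Jg : forall x q, `|J x q| <= g q.
Hypothesis Jlip : forall x x' q, `|J x q - J x' q| <= g q * `|x - x'|.
Variable a0 : R.
Implicit Types (pi : set (R * R)).

(** The weight of the contraction. With [A s] the total of the Lipschitz constants
    before [s], the exponential of [2 A] absorbs the factor [2] needed for
    a contraction ratio of [1 / 2], over any time span. *)
Definition growth pi s : R := expR (2 * psum (past pi s) g).

Fixpoint iterate pi (n : nat) (s : R) : R :=
  if n is n'.+1 then a0 + sum_over (past pi s) (fun q => J (iterate pi n' q.1) q)
  else a0.

(** The left limit of the solution. The fixed point is sought among left limits
    because they, and not the right-continuous values, enter the jumps. *)
Definition presol pi (s : R) : R := lim (iterate pi n s @[n --> \oo]).

Definition sol pi (s : R) : R :=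
  a0 + sum_over (upto pi s) (fun q => J (presol pi q.1) q).

Lemma iterate_causal pi pi' n s :
  past pi s = past pi' s -> iterate pi n s = iterate pi' n s.
Proof.
elim: n s => //= n ih s ps; rewrite ps; congr (_ + _).
apply: eq_sum_over => q [piq qs]; rewrite ih//.
have sub x y : q.1 <= s -> past x s = past y s -> past x q.1 `<=` past y q.1.
  move=> qs' h p [xp pq]; split => //.
  by have [] : past y s p by rewrite -h; split => //=; exact: lt_le_trans pq qs'.
by apply/seteqP; split; apply: sub => //; exact: ltW.
Qed.

Lemma presol_causal pi pi' s :
  past pi s = past pi' s -> presol pi s = presol pi' s.
Proof.
move=> h; rewrite /presol.
rewrite (_ : iterate pi ^~ s = iterate pi' ^~ s)//.
by apply/funext => n; exact: iterate_causal.
Qed.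

Lemma past_le pi pi' s s' : past pi s = past pi' s -> s' <= s ->
  past pi s' = past pi' s'.
Proof.
move=> h s's.
have sub x y : past x s = past y s -> past x s' `<=` past y s'.
  move=> h' p [xp ps']; split => //.
  by have [] : past y s p by rewrite -h'; split => //=; exact: lt_le_trans ps' s's.
by apply/seteqP; split; exact: sub.
Qed.

(** The iterates up to time [s] only read points up to time [s]. *)
Lemma sol_causal pi pi' s : upto pi s = upto pi' s -> sol pi s = sol pi' s.
Proof.
move=> h; rewrite /sol h; congr (_ + _); apply: eq_sum_over => q [piq /= qs].
congr (J _ _); apply: presol_causal; apply: (@past_le _ _ s) => //.
have sub x y : upto x s = upto y s -> past x s `<=` past y s.
  move=> h' p [xp ps']; split => //.
  by have [] : upto y s p by rewrite -h'; split => //=; exact: ltW.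
by apply/seteqP; split; exact: sub.
Qed.

Variable pi : set (R * R).
Hypothesis spi : summable pi (EFin \o g).

Lemma growth_ge1 s : 1 <= growth pi s.
Proof.
rewrite -expR0 ler_expR mulr_ge0//; apply: psum_ge0 => q _; exact: g0.
Qed.

Let spast s : summable (past pi s) (EFin \o g).
Proof. by apply: sub_summable spi; exact: past_sub. Qed.

(** The finite form of [d(e^{2A}) >= 2 e^{2A} dA] for the pure jump function
    [A s = psum (past pi s) g]; the points with the largest first coordinate
    are split off. *)
Lemma growth_jumps_seq (n : nat) (Q : seq (R * R)) s : (size Q <= n)%N ->
  uniq Q -> (forall q, q \in Q -> past pi s q) ->
  \sum_(q <- Q) (2 * g q * growth pi q.1) <= growth pi s.
Proof.
elim: n Q s => [|n ih] Q s.
  rewrite leqn0 size_eq0 => /eqP -> _ _; rewrite big_nil.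
  exact: le_trans (growth_ge1 _).
move=> sQ uQ Qs.
have [Q0|] := eqVneq Q [::].
  by rewrite Q0 big_nil; exact: le_trans (growth_ge1 _).
move=> Q0.
(* Split off the last jump time before [s]. *)
have [p pQ pmax] : exists2 p, p \in Q & forall q, q \in Q -> q.1 <= p.1.
  clear -Q0; elim: Q Q0 => // p [|p' Q] ih _.
    by exists p; rewrite ?mem_head// => q; rewrite inE => /eqP->.
  have [//|m mQ mm] := ih.
  have [pm|mp] := leP p.1 m.1.
    exists m; first by rewrite inE mQ orbT.
    by move=> q; rewrite inE => /predU1P[->//|]; exact: mm.
  exists p; first by rewrite mem_head.
  move=> q; rewrite inE => /predU1P[->//|/mm qm]; exact: le_trans qm (ltW mp).
set x := p.1.
rewrite (bigID (fun q => q.1 == x))/=.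
have ps : x < s by case: (Qs p pQ).
set G := \sum_(q <- Q | q.1 == x) g q.
have -> : \sum_(q <- Q | q.1 == x) (2 * g q * growth pi q.1) = 2 * G * growth pi x.
  by rewrite mulr_sumr mulr_suml; apply: eq_bigr => q /eqP ->.
have le2 : \sum_(q <- Q | q.1 != x) (2 * g q * growth pi q.1) <= growth pi x.
  rewrite -big_filter; apply: ih.
  - rewrite size_filter -ltnS; apply: leq_trans sQ.
    rewrite -(count_predC (fun q => q.1 == x) Q) -[X in (X < _)%N]add0n.
    rewrite ltn_add2r -has_count; apply/hasP; exists p => //=; exact: eqxx.
  - exact: filter_uniq.
  - move=> q; rewrite mem_filter => /andP[qx qQ].
    by have [piq _] := Qs q qQ; split => //=; rewrite lt_neqAle qx pmax.
apply: (le_trans (lerD (lexx _) le2)).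
rewrite -[X in _ + X]mul1r -mulrDl.
have A : psum (past pi x) g + G <= psum (past pi s) g.
  have -> : G = psum [set` [seq q <- Q | q.1 == x]] g.
    rewrite /G /psum esum_fset; [|exact: finite_seq|by move=> i _; rewrite lee_fin].
    have finQ : finite_set [set` [seq q <- Q | q.1 == x]] by exact: finite_seq.
    rewrite (fsbig_finite _ _ finQ)/= sumEFin/= -big_filter; apply: perm_big.
    apply: uniq_perm; [exact: filter_uniq|exact: finmap.fset_uniq|].
    move=> q; rewrite (in_fset_set finQ).
    by apply/idP/idP => [/mem_set|/set_mem].
  rewrite (psumID [set q | q.1 < x] (fun q _ => g0 q) (spast s)).
  apply: lerD.
    apply: psum_subset; [by move=> *; exact: g0| |].
      move=> q [piq /= qx]; split => //; split => //=; exact: lt_trans qx ps.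
    by apply: sub_summable (spast s); exact: subIsetl.
  apply: psum_subset; [by move=> *; exact: g0| |].
    move=> q /=; rewrite mem_filter => /andP[/eqP qx /Qs qQ]; split => //=.
    by rewrite qx ltxx.
  by apply: sub_summable (spast s); exact: subIsetl.
(* All the jumps at time [x] together multiply the weight by [exp (2 G)]. *)
have : 2 * G + 1 <= expR (2 * G) by rewrite addrC expR_ge1Dx.
move/(ler_wpM2r (le_trans ler01 (growth_ge1 x))) => /le_trans; apply.
by rewrite /growth -expRD ler_expR; lra.
Qed.

Lemma growth_jumps s : summable (past pi s) (EFin \o (fun q => g q * growth pi q.1)) /\
  psum (past pi s) (fun q => g q * growth pi q.1) <= growth pi s / 2.
Proof.
have ge0 q : 0 <= g q * growth pi q.1.
  by rewrite mulr_ge0// (le_trans ler01 (growth_ge1 _)).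
have key : (\esum_(q in past pi s) (g q * growth pi q.1)%:E
    <= (growth pi s / 2)%:E)%E.
  apply: ge_ereal_sup => /= _ [X [finX XS]] <-.
  rewrite fsbig_finite//= sumEFin lee_fin ler_pdivlMr// mulr_suml.
  under eq_bigr do rewrite mulrC mulrA.
  apply: (@growth_jumps_seq (size (finmap.enum_fset (fset_set X)))) => //.
    exact: finmap.fset_uniq.
  by move=> q; rewrite in_fset_set// inE => /XS.
split.
  by apply: summable_lt; [move=> *; exact: ge0|exact: le_lt_trans key (ltry _)].
rewrite -lee_fin /psum fineK//.
rewrite ge0_fin_numE; first exact: le_lt_trans key (ltry _).
by apply: esum_ge0 => q _; rewrite lee_fin.
Qed.

Lemma summable_J (u : R * R -> R) : summable pi (EFin \o (fun q => J (u q) q)).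
Proof. by apply: le_summable spi => q _. Qed.

(** The jumps at the points before [s] differ by at most [c * g q * growth q.1], and
    the sum of [g * growth] is at most half of [growth] by [growth_jumps]. *)
Lemma contraction (u v : R -> R) (c s : R) : 0 <= c ->
  (forall q, pi q -> `|u q.1 - v q.1| <= c * growth pi q.1) ->
  `|sum_over (past pi s) (fun q => J (u q.1) q) -
    sum_over (past pi s) (fun q => J (v q.1) q)| <= c * (growth pi s / 2).
Proof.
move=> c0 uv; have [sE leE] := growth_jumps s.
have sJ w : summable (past pi s) (EFin \o (fun q => J (w q.1) q)).
  by apply: sub_summable (summable_J _); exact: past_sub.
rewrite -sum_overB//.
apply: (le_trans (@le_sum_over_psum _ _ _ _ (fun q => c * (g q * growth pi q.1)) _ _)).
- move=> q [piq _]; rewrite (le_trans (Jlip _ _ _))// mulrCA.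
  by rewrite ler_wpM2l// uv.
- exact: summableZ.
rewrite psumZ//; first by rewrite ler_wpM2l.
by move=> q _; rewrite mulr_ge0// (le_trans ler01 (growth_ge1 _)).
Qed.

Lemma iterate_dist n m s :
  `|iterate pi (n + m) s - iterate pi n s| <= 2^-1 ^+ n * growth pi s.
Proof.
elim: n s => [|n ih] s.
  rewrite expr0 mul1r add0n; case: m => [|m] /=.
    by rewrite subrr normr0 (le_trans ler01 (growth_ge1 _)).
  rewrite addrC addKr.
  apply: (le_trans (@le_sum_over_psum _ _ _ _ g _ (spast s))) => //.
  apply: le_trans (expR_ge1Dx _).
  have : 0 <= psum (past pi s) g by apply: psum_ge0 => *; exact: g0.
  by lra.
rewrite addSn /= [X in `|X|](_ : _ =
  sum_over (past pi s) (fun q => J (iterate pi (n + m) q.1) q) -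
  sum_over (past pi s) (fun q => J (iterate pi n q.1) q)); last by lra.
apply: le_trans (@contraction _ _ (2^-1 ^+ n) s _ _) _; rewrite ?exprn_ge0//.
by rewrite exprS [in leLHS]mulrCA mulrC -mulrA mulrCA mulrA.
Qed.

Lemma half_small (C e : R) : 0 <= C -> 0 < e ->
  \forall n \near \oo, 2^-1 ^+ n * C <= e.
Proof.
move=> C0 e0.
have /cvgrPdist_le/(_ e e0) : geometric C (2^-1 : R) n @[n --> \oo] --> (0 : R).
  by apply: cvg_geometric; rewrite ger0_norm// invf_lt1// ltr1n.
apply: filterS => n /=; rewrite sub0r normrN ger0_norm.
  by rewrite mulrC.
by rewrite mulr_ge0// exprn_ge0.
Qed.

Lemma iterate_cvg s : iterate pi n s @[n --> \oo] --> presol pi s.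
Proof.
apply/cauchy_cvgP/cauchy_exP => e e0.
have [N _ /(_ N (leqnn _)) /= hN] :=
  half_small (le_trans ler01 (growth_ge1 s)) (divr_gt0 e0 (ltr0Sn _ 1)).
exists (iterate pi N s); exists N => // n /= Nn.
rewrite -ball_normE /= distrC -(subnKC Nn).
apply: le_lt_trans (iterate_dist _ _ _) (le_lt_trans hN _).
by rewrite ltr_pdivrMr// ltr_pMr// ltr1n.
Qed.

Lemma presol_dist n s : `|presol pi s - iterate pi n s| <= 2^-1 ^+ n * growth pi s.
Proof.
apply/ler_addgt0Pr => e e0.
have /cvgrPdist_le/(_ e e0)[N _ hN] := @iterate_cvg s.
rewrite (le_trans (ler_distD (iterate pi (n + N) s) _ _))// addrC lerD//.
  exact: iterate_dist.
by apply: hN => /=; rewrite leq_addl.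
Qed.

(** Passing to the limit in the iteration: both sides are within
    [2 ^ (- n) * growth] of an iterate. *)
Lemma presolE s :
  presol pi s = a0 + sum_over (past pi s) (fun q => J (presol pi q.1) q).
Proof.
apply/eqP; rewrite -subr_eq0 -normr_le0; apply/ler_addgt0Pr => e e0.
have [N _ /(_ N (leqnn _)) /= hN] := half_small (le_trans ler01 (growth_ge1 s)) e0.
rewrite add0r; apply: le_trans hN.
have h1 := presol_dist N.+1 s.
have := @contraction (iterate pi N) (presol pi) (2^-1 ^+ N) s (exprn_ge0 _ _).
rewrite invr_ge0 => /(_ (ler0n _ _)).
move=> /(_ _)/wrap[q _|h2]; first by rewrite distrC presol_dist.
move: h1 => /=; rewrite exprS; move: h2.
set A := sum_over _ _; set B := sum_over _ _; set E := growth _ _.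
set k := 2^-1 ^+ N => h2 h1.
rewrite (le_trans (ler_distD (a0 + A) _ _))//.
rewrite [X in _ + `|X|](_ : _ = A - B); last by lra.
by apply: (le_trans (lerD h1 h2)); lra.
Qed.

Lemma is_cadlag_sol c d : is_cadlag c d (sol pi).
Proof. exact/is_cadlag_upto/summable_J. Qed.

Lemma sol_cvg_left u : sol pi s @[s --> u^'-] --> presol pi u.
Proof.
rewrite presolE; apply: cvgD; first exact: cvg_cst.
exact: (upto_cvg_left (summable_J _)).
Qed.

(** Two solutions on [[c, d)] differ, before time [s], by at most the sum of
    their differences at the earlier points weighted by [g]; iterating the
    contraction estimate makes this arbitrarily small. *)
Lemma sol_unique c d (z : R -> R) : (forall q, pi q -> c < q.1 < d) ->
  (forall s, c <= s < d -> z s = a0 +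
     sum_over (upto pi s) (fun q => J (lim (z x @[x --> q.1^'-])) q)) ->
  forall s, c <= s < d -> z s = sol pi s.
Proof.
move=> picd zE.
pose y (u : R) : R := lim (z x @[x --> u^'-]).
have yE u : c < u < d -> y u = a0 + sum_over (past pi u) (fun q => J (y q.1) q).
  move=> /andP[cu ud]; apply/cvg_lim => //.
  have h : (fun s => a0 + sum_over (upto pi s) (fun q => J (y q.1) q)) x
      @[x --> u^'-] --> a0 + sum_over (past pi u) (fun q => J (y q.1) q).
    by apply: cvgD; [exact: cvg_cst|exact: (upto_cvg_left (summable_J _))].
  apply: cvg_trans h; apply: near_eq_cvg; near=> x.
  rewrite zE//; apply/andP; split; last first.
    by apply: lt_trans ud; near: x; exact: nbhs_left_lt.
  by apply: ltW; near: x; exact: nbhs_left_gt.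
have key n q : pi q -> `|y q.1 - presol pi q.1| <=
    2^-1 ^+ n * (2 * psum pi g) * growth pi q.1.
  have p0 : 0 <= psum pi g by apply: psum_ge0 => *; exact: g0.
  elim: n q => [|n ih] q piq; rewrite (yE _ (picd _ piq)) presolE.
    rewrite expr0 mul1r.
    have sJ (v : R -> R) : `|sum_over (past pi q.1) (fun q => J (v q.1) q)| <= psum pi g.
      apply: (le_trans (@le_sum_over_psum _ _ _ _ g _ (spast _))) => //.
      by apply: psum_subset => //; exact: past_sub.
    have := sJ y; have := sJ (presol pi).
    set A := sum_over _ _; set B := sum_over _ _ => hA hB.
    apply: (@le_trans _ _ (2 * psum pi g)).
      rewrite [X in `|X|](_ : _ = B - A); last by lra.
      by apply: (le_trans (ler_normB _ _)); lra.
    by rewrite ler_peMr ?growth_ge1// mulr_ge0.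
  set A := sum_over _ _; set B := sum_over _ _.
  rewrite [X in `|X|](_ : _ = A - B); last by lra.
  apply: le_trans (contraction _ _ ih) _.
    by rewrite mulr_ge0// ?exprn_ge0// mulr_ge0.
  by rewrite exprS; lra.
(* Letting [n] tend to infinity, the left limits of [z] at the points agree with
   those of the solution. *)
have yp q : pi q -> y q.1 = presol pi q.1.
  move=> piq; apply/eqP; rewrite -subr_eq0 -normr_le0; apply/ler_addgt0Pr => e e0.
  have p0 : 0 <= (2 * psum pi g) * growth pi q.1.
    rewrite mulr_ge0 ?(le_trans ler01 (growth_ge1 _))// mulr_ge0//.
    by apply: psum_ge0 => *; exact: g0.
  have [N _ /(_ N (leqnn _)) /= hN] := half_small p0 e0.
  by rewrite add0r; apply: le_trans hN; rewrite mulrA key.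
move=> s sI; rewrite zE// /sol; congr (_ + _).
by apply: eq_sum_over => q [piq _]; rewrite -yp.
Unshelve. all: by end_near. Qed.

End picard.

(** * Time changes and the modulus of a cadlag path *)

Section time_changes.
Context {R : realType}.
Implicit Types (c d : R) (h : R -> R).

Lemma lip_continuous h (k : R) : 0 < k ->
  (forall x y, `|h x - h y| <= k * `|x - y|) -> continuous h.
Proof.
move=> k0 hl x; apply/cvgrPdist_lt => e e0; near=> y.
apply: le_lt_trans (hl x y) _; rewrite -ltr_pdivlMl//.
near: y; apply/nbhs_ballP; exists (e / k) => /=; first exact: divr_gt0.
by move=> z /=; rewrite mulrC.
Unshelve. all: by end_near. Qed.

(** A perturbation with Lipschitz constant [1 / 2] keeps the slope of the
    identity between [1 / 2] and [3 / 2], hence is a bi-Lipschitz bijection; it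
    preserves the interval because it fixes the endpoints. *)
Lemma time_change_perturb c d h : (forall x y, `|h x - h y| <= `|x - y| / 2) ->
  h c = 0 -> h d = 0 -> time_change c d (fun x => x + h x).
Proof.
move=> hl hc hd; set w := fun x => _.
have wlt x y : x <= y -> (y - x) / 2 <= w y - w x.
  move=> xy; have := hl y x; rewrite [`|y - x|]ger0_norm ?subr_ge0// ler_norml /w.
  by move=> /andP[]; lra.
have wc : continuous w.
  apply: (@lip_continuous _ 2) => // x y.
  rewrite /w [X in `|X|](_ : _ = (x - y) + (h x - h y)); last by lra.
  by rewrite (le_trans (ler_normD _ _))//; have := hl x y; have := normr_ge0 (x - y); lra.
have wmono x y : x < y -> w x < w y.
  by move=> xy; have := wlt _ _ (ltW xy); lra.
have /choice[v vw] y : exists x, w x = y.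
  pose M := 2 * `|y - w y|.
  have M0 : 0 <= M by rewrite mulr_ge0.
  have [||x _ xy] := @IVT R w (y - M) (y + M) y _ (continuous_subspaceT wc).
  - by lra.
  - have h1 : w (y - M) <= y.
      have := @wlt (y - M) y; have := ler_norm (w y - y); rewrite distrC /M in M0 *; lra.
    have h2 : y <= w (y + M).
      have := @wlt y (y + M); have := ler_norm (y - w y); rewrite /M in M0 *; lra.
    by rewrite ge_min h1/= le_max h2 orbT.
  - by exists x.
have wv x : v (w x) = x.
  apply: contrapT => /eqP; rewrite neq_lt => /orP[] /wmono; rewrite vw ltxx//.
have vlip x y : `|v x - v y| <= 2 * `|x - y|.
  wlog xy : x y / v x <= v y.
    move=> H; have [|/ltW] := leP (v x) (v y); first exact: H.
    by move=> /H; rewrite (distrC (v y)) (distrC y).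
  have := wlt _ _ xy; rewrite !vw distrC [`|v y - v x|]ger0_norm ?subr_ge0//.
  have := ler_norm (y - x); rewrite (distrC y x); lra.
have vmono x y : x < y -> v x < v y.
  by move=> xy; rewrite ltNge; apply/negP; rewrite le_eqVlt => /predU1P[/(congr1 w)|/wmono];
    rewrite !vw => ?; lra.
have wcc : w c = c by rewrite /w hc addr0.
have wdd : w d = d by rewrite /w hd addr0.
have vcc : v c = c by rewrite -{1}wcc wv.
have vdd : v d = d by rewrite -{1}wdd wv.
have itv (f : R -> R) : (forall x y, x < y -> f x < f y) -> f c = c -> f d = d ->
    {homo f : x / x \in `[c, d[}.
  move=> fm fc fd x; rewrite !in_itv/= => /andP[cx xd]; rewrite -fd fm// andbT.
  by move: cx; rewrite le_eqVlt => /predU1P[<-|/fm]; [rewrite fc|rewrite fc => /ltW].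
split; first by move=> x y _ _; exact: wmono.
exists v; split.
- by split; exact: itv.
- by move=> x _; exact: wv.
- by move=> x _; exact: vw.
- exact: continuous_subspaceT.
- by apply: continuous_subspaceT; apply: (lip_continuous _ vlip).
Qed.

Lemma seq_lower_bound (T : eqType) (s : seq T) (f : T -> R) :
  (forall x, x \in s -> 0 < f x) ->
  exists2 r, 0 < r & forall x, x \in s -> r <= f x.
Proof.
elim: s => [|x s ih] h; first by exists 1.
have [|r r0 rs] := ih; first by move=> y ys; apply: h; rewrite inE ys orbT.
exists (Num.min r (f x)); first by rewrite lt_min r0 h// mem_head.
by move=> y; rewrite inE => /predU1P[->|/rs ry]; rewrite ge_min ?lexx ?orbT ?ry.
Qed.

(** A shift [delta] of finitely many points extends to the whole line with the
    same Lipschitz constant and bound (McShane's formula, clipped at [-m]). *)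
Lemma lipschitz_extension (K : seq R) (delta : R -> R) (m : R) :
  (forall k, k \in K -> `|delta k| <= m) ->
  (forall k l, k \in K -> l \in K -> `|delta k - delta l| <= `|k - l| / 2) ->
  0 <= m ->
  exists h : R -> R, [/\ forall x y, `|h x - h y| <= `|x - y| / 2,
    forall x, `|h x| <= m & forall k, k \in K -> h k = delta k].
Proof.
move=> dm dl m0.
(* The greatest function with constant [1 / 2] below the prescribed values and [m]. *)
pose H (L : seq R) x := foldr (fun k r => Num.min (delta k + `|x - k| / 2) r) m L.
have Hlip L x y : `|H L x - H L y| <= `|x - y| / 2.
  elim: L => [|k L ih] /=; first by rewrite subrr normr0 divr_ge0.
  have := ih; have := ler_dist_dist (x - k) (y - k).
  rewrite (_ : x - k - (y - k) = x - y); last by lra.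
  rewrite !ler_norml /Num.min; move=> /andP[a1 a2] /andP[b1 b2].
  by case: ifPn => c1; case: ifPn => c2; rewrite -?leNgt in c1 c2; apply/andP; split; lra.
have Hle L x : H L x <= m.
  by elim: L => //= k L ih; rewrite ge_min ih orbT.
have HL L k : k \in L -> H L k <= delta k.
  elim: L => //= l L ih; rewrite inE => /predU1P[->|/ih h].
    by rewrite subrr normr0 mul0r addr0 ge_min lexx.
  by rewrite ge_min h orbT.
have HG L x : (forall k, k \in L -> k \in K) -> x \in K -> delta x <= H L x.
  move=> + xK; elim: L => [_|l L ih LK] /=.
    by apply: le_trans (ler_norm _) _; exact: dm.
  rewrite le_min ih ?andbT; last by move=> k kL; apply: LK; rewrite inE kL orbT.
  by have := dl x l xK (LK _ (mem_head _ _)); rewrite ler_norml => /andP[]; lra.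
exists (fun x => Num.max (- m) (H K x)); split.
- move=> x y; have := Hlip K x y; rewrite !ler_norml /Num.max => /andP[a1 a2].
  by case: ifPn => c1; case: ifPn => c2; rewrite -?leNgt in c1 c2; apply/andP; split; lra.
- move=> x; rewrite ler_norml le_max lexx/= ge_max Hle andbT; lra.
- move=> k kK; have -> : H K k = delta k.
    by apply/eqP; rewrite eq_le HL// HG.
  by apply/max_idPr; have := dm k kK; rewrite ler_norml => /andP[].
Qed.

(** One-sided limits give, around every time [u], a neighbourhood in which [f] varies
    little on either side of [u]; finitely many of them cover the compact interval,
    and their centres are the knots. *)
Lemma cadlag_modulus c d f (e : R) : c < d -> is_cadlag c d f -> 0 < e ->
  exists (K : seq R) (rho : R), [/\ 0 < rho, forall k, k \in K -> c <= k <= d &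
   forall x y, c <= x -> x <= y -> y < d -> y - x < rho ->
     (forall k, k \in K -> ~ (x < k <= y)) -> `|f x - f y| <= e].
Proof.
move=> cd [fr fl] e0.
have loc u : exists eta, 0 < eta /\ (c <= u <= d -> forall x y, c <= x < d -> c <= y < d ->
    `|x - u| < eta -> `|y - u| < eta -> (x < u) = (y < u) -> `|f x - f y| <= e).
  have [uI|/negP uI] := boolP (c <= u <= d); last first.
    by exists 1; split.
  move/andP: uI => [cu ud].
  have [e1 [e10 H1]] : exists e1, 0 < e1 /\ forall x y, c <= x < d -> c <= y < d ->
      `|x - u| < e1 -> `|y - u| < e1 -> u <= x -> u <= y -> `|f x - f y| <= e.
    move: ud; rewrite le_eqVlt => /predU1P[->|ud].
      by exists 1; split => // x y /andP[_ xd] _ _ _ /le_lt_trans => /(_ _ xd); rewrite ltxx.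
    have /cvgrPdist_le/(_ (e/2)) : f x @[x --> u^'+] --> f u by apply: fr; rewrite cu.
    rewrite divr_gt0// => /(_ isT).
    move=> [r /= r0 hr]; exists r; split => // x y xI yI xu yu ux uy.
    have half z : `|z - u| < r -> u <= z -> `|f u - f z| <= e / 2.
      move=> zu; rewrite le_eqVlt => /predU1P[->|uz]; first by rewrite subrr normr0 divr_ge0 ?ltW.
      by apply: hr => //=; rewrite distrC.
    rewrite (le_trans (ler_distD (f u) _ _))//.
    by have := half x xu ux; have := half y yu uy; rewrite (distrC (f x)); lra.
  have [e2 [e20 H2]] : exists e2, 0 < e2 /\ forall x y, c <= x < d -> c <= y < d ->
      `|x - u| < e2 -> `|y - u| < e2 -> x < u -> y < u -> `|f x - f y| <= e.
    move: cu; rewrite le_eqVlt => /predU1P[<-|cu].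
      by exists 1; split => // x y /andP[cx _] _ _ _; rewrite ltNge cx.
    have /cvg_ex[l] : cvg (f x @[x --> u^'-]) by apply: fl; rewrite cu.
    move=> /cvgrPdist_le/(_ (e/2)); rewrite divr_gt0// => /(_ isT).
    move=> [r /= r0 hr]; exists r; split => // x y xI yI xu yu ux uy.
    have half z : `|z - u| < r -> z < u -> `|l - f z| <= e / 2.
      by move=> zu uz; apply: hr => //=; rewrite distrC.
    rewrite (le_trans (ler_distD l _ _))//.
    by have := half x xu ux; have := half y yu uy; rewrite (distrC (f x)); lra.
  exists (Num.min e1 e2); split; first by rewrite lt_min e10.
  move=> _ x y xI yI; rewrite !lt_min => /andP[x1 x2] /andP[y1 y2].
  by have [xu /esym yu|ux /esym/negbT] := ltP x u; [exact: H2|rewrite -leNgt; exact: H1].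
have {loc}[eta loc] := choice loc.
have : @compact R^o `[c, d] by exact: segment_compact.
rewrite compact_cover => /(_ R [set u | c <= u <= d] (fun u => ball u (eta u / 2))).
move=> /(_ _)/wrap[u _|]; first exact: ball_open.
move=> /(_ _)/wrap[u /= uI|].
  exists u; first by move: uI; rewrite in_itv.
  by apply: ballxx; rewrite divr_gt0//; case: (loc u).
move=> [D' D'sub Dcov].
have [r r0 hr] := @seq_lower_bound _ (finmap.enum_fset D') (fun u => eta u / 2)
  (fun u _ => divr_gt0 (proj1 (loc u)) (ltr0Sn _ 1)).
exists (finmap.enum_fset D'), r; split => //.
  by move=> k /D'sub; rewrite inE.
move=> x y cx xy yd yx Kxy.
have [|u uD] := Dcov x; first by rewrite /= in_itv/= cx (le_trans xy (ltW yd)).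
rewrite -ball_normE /= distrC => xu.
have ru := hr u uD; have eu := proj1 (loc u).
have uI : c <= u <= d by have := D'sub _ uD; rewrite inE.
have yu : `|y - u| < eta u.
  rewrite (_ : y - u = (y - x) + (x - u)); last by lra.
  rewrite (le_lt_trans (ler_normD _ _))// [`|y - x|]ger0_norm ?subr_ge0//; lra.
apply: (proj2 (loc u) uI) => //; [by rewrite cx (le_lt_trans xy yd)| |lra|].
  by rewrite (le_trans cx xy) yd.
apply/idP/idP => [xu'|/(le_lt_trans xy)//]; rewrite ltNge; apply/negP => uy.
by apply: (Kxy u); rewrite ?xu' ?uy.
Qed.

End time_changes.

(** * Approximation of cadlag paths by step functions *)

Section sampling.
Context {R : realType}.
Variables (c d : R).
Hypothesis cd : c < d.

Definition mesh (n : nat) : R := (d - c) / 2 ^+ n.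

Definition index (n : nat) (x : R) : nat := Num.truncn ((x - c) / mesh n).

Definition grid (n k : nat) : R := c + mesh n * k%:R.

Lemma mesh_gt0 n : 0 < mesh n.
Proof. by rewrite divr_gt0 ?subr_gt0// exprn_gt0. Qed.

Lemma mesh_cvg (e : R) : 0 < e -> \forall n \near \oo, mesh n <= e.
Proof.
have cd0 : 0 <= d - c by rewrite subr_ge0 ltW.
move=> /(half_small cd0); apply: filterS => n.
by rewrite /mesh exprVn mulrC.
Qed.

Lemma grid_last n : grid n (2 ^ n) = d.
Proof. by rewrite /grid natrX divfK ?gt_eqF ?exprn_gt0//; lra. Qed.

Lemma grid_le n k l : (grid n k <= grid n l) = (k <= l)%N.
Proof. by rewrite lerD2l ler_pM2l ?mesh_gt0// ler_nat. Qed.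

Lemma grid_lt n k l : (grid n k < grid n l) = (k < l)%N.
Proof. by rewrite ltNge grid_le -ltnNge. Qed.

Lemma gridS n k : grid n k.+1 = grid n k + mesh n.
Proof. by rewrite /grid -addn1 natrD; lra. Qed.

Lemma grid_in n k : (k < 2 ^ n)%N -> c <= grid n k < d.
Proof.
move=> kn; rewrite -[X in _ < X](grid_last n) grid_lt kn andbT.
by rewrite lerDl mulr_ge0// ltW// mesh_gt0.
Qed.

Lemma index_itv n x : c <= x -> grid n (index n x) <= x < grid n (index n x) + mesh n.
Proof.
move=> cx; have m0 := mesh_gt0 n.
have := @truncn_itv R ((x - c) / mesh n); rewrite -/(index n x).
rewrite divr_ge0 ?subr_ge0// ?(ltW m0)// => /(_ isT)/andP[].
rewrite ler_pdivlMr// ltr_pdivrMr// -addn1 natrD => h1 h2.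
by rewrite /grid; apply/andP; split; lra.
Qed.

Lemma index_eq n x k : grid n k <= x < grid n k.+1 -> index n x = k.
Proof.
have m0 := mesh_gt0 n.
move=> /andP[h1 h2]; apply: truncn_def.
rewrite ler_pdivlMr// ltr_pdivrMr//; move: h1 h2; rewrite /grid => h1 h2.
by apply/andP; split; lra.
Qed.

Lemma index_lt n x : c <= x < d -> (index n x < 2 ^ n)%N.
Proof.
move=> /andP[cx xd]; rewrite -(grid_lt n) grid_last.
by apply: le_lt_trans xd; case/andP: (index_itv n cx).
Qed.

Lemma ceil_ex (y : R) : 0 <= y -> exists m : nat, y <= m%:R < y + 1.
Proof.
move=> y0; have /andP[h1 h2] := truncn_itv y0.
have [/eqP <-|ne] := boolP ((Num.truncn y)%:R == y).
  by exists (Num.truncn y); rewrite lexx ltrDl ltr01.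
exists (Num.truncn y).+1; by rewrite (ltW h2)/= -addn1 natrD ltrD2r lt_neqAle ne.
Qed.

Lemma grid_ceil n x : c <= x -> exists m, x <= grid n m < x + mesh n.
Proof.
move=> cx; have m0 := mesh_gt0 n.
have [|m /andP[]] := @ceil_ex ((x - c) / mesh n).
  by rewrite divr_ge0 ?subr_ge0// ltW.
rewrite ler_pdivrMr// -ltrBlDr ltr_pdivlMr// => h1 h2; exists m.
by rewrite /grid; apply/andP; split; lra.
Qed.

Definition stepf n (v : nat -> R) (x : R) : R := v (index n x).

Lemma is_cadlag_stepf n v : is_cadlag c d (stepf n v).
Proof.
split=> u /andP[].
  move=> cu ud; apply: cvg_near_cst.
  have := index_itv n cu; rewrite -gridS => /andP[g1 g2].
  near=> x; rewrite /stepf (@index_eq n x (index n u))//; apply/andP; split.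
    by apply: le_trans g1 (ltW _); near: x; exact: nbhs_right_gt.
  by near: x; exact: nbhs_right_lt.
move=> cu ud; apply/cvg_ex.
have [[|m]] := grid_ceil n (ltW cu).
  by rewrite {1}/grid mulr0 addr0 leNgt cu.
rewrite gridS => /andP[g1 g2].
exists (v m); apply: cvg_near_cst; near=> x; rewrite /stepf (@index_eq n x m)//.
apply/andP; split.
  apply: ltW; near: x; apply: nbhs_left_gt; lra.
by rewrite gridS (lt_le_trans _ g1)//; near: x; exact: nbhs_left_lt.
Unshelve. all: by end_near. Qed.

Definition step n v : cadlag c d := Cadlag (is_cadlag_stepf n v).

(** The time change sends each knot of [f] to the grid point just above it;
    then [u] and the grid point used by the step function at the image of [u]
    are close and are not separated by a knot. *)
Lemma sample_near (f : cadlag c d) (e : R) : 0 < e -> \forall n \near \oo,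
  forall v, (forall k, (k < 2 ^ n)%N -> `|f (grid n k) - v k| <= e / 4) ->
  skorohod_ball f e (step n v).
Proof.
move=> e0; have e4 : 0 < e / 4 by rewrite divr_gt0.
have [K0 [rho [rho0 K0cd mod]]] := cadlag_modulus cd (cadlagP f) e4.
(* The endpoints are knots too: the time change must fix them. *)
pose K := c :: d :: K0.
have Kcd k : k \in K -> c <= k <= d.
  by rewrite !inE => /or3P[/eqP->|/eqP->|/K0cd//]; rewrite lexx (ltW cd).
have [gap gap0 gapK] := @seq_lower_bound _ _ [seq p <- [seq (k, l) | k <- K, l <- K] |
  p.1 != p.2] (fun p => `|p.1 - p.2|)
  (fun p => ltac:(by rewrite mem_filter normr_gt0 subr_eq0 => /andP[])).
near=> n => v vf.
have m0 := mesh_gt0 n.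
have me : mesh n <= e / 4 by near: n; exact: mesh_cvg.
have mrho : mesh n <= rho / 4 by near: n; apply: mesh_cvg; exact: divr_gt0.
have mgap : mesh n <= gap / 2 by near: n; apply: mesh_cvg; exact: divr_gt0.
have /choice[up upP] x : exists m, c <= x -> x <= grid n m < x + mesh n.
  have [/(grid_ceil n)[m h]|h] := leP c x; first by exists m.
  by exists 0%N.
pose delta k := grid n (up k) - k.
have dlt k : k \in K -> 0 <= delta k < mesh n.
  by move=> /Kcd/andP[/upP/andP[h1 h2] _]; rewrite /delta; apply/andP; split; lra.
have deltac : delta c = 0.
  have /andP[] := dlt c (mem_head _ _); rewrite /delta /grid.
  case: (up c) => [|k]; first by rewrite mulr0 addr0 subrr.
  move=> _ lt1; have k1 : (1 : R) <= k.+1%:R by rewrite ler1n.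
  by have := ler_wpM2l (ltW m0) k1; lra.
have deltad : delta d = 0.
  have /andP[d1 d2] := upP d (ltW cd).
  have : grid n (2 ^ n) <= grid n (up d) by rewrite grid_last.
  have : grid n (up d) < grid n (2 ^ n).+1 by rewrite gridS grid_last.
  rewrite grid_le grid_lt ltnS => h1 h2; rewrite /delta.
  have -> : up d = (2 ^ n)%N by apply/eqP; rewrite eqn_leq h1 h2.
  by rewrite grid_last subrr.
have [h [hlip hm hK]] : exists h : R -> R, [/\ forall x y, `|h x - h y| <= `|x - y| / 2,
    forall x, `|h x| <= mesh n & forall k, k \in K -> h k = delta k].
  apply: lipschitz_extension; last exact: ltW.
    by move=> k /dlt/andP[d1 d2]; rewrite ger0_norm// ltW.
  move=> k l kK lK; have [->|kl] := eqVneq k l; first by rewrite !subrr normr0 mul0r.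
  have /gapK/= : (k, l) \in [seq p <- [seq (k, l) | k <- K, l <- K] | p.1 != p.2].
    by rewrite mem_filter kl andTb; apply: (allpairs_f pair).
  have /andP[k1 k2] := dlt k kK; have /andP[l1 l2] := dlt l lK => kl'.
  by rewrite ler_norml; apply/andP; split; lra.
have wT : time_change c d (fun x => x + h x).
  apply: time_change_perturb => //; rewrite hK ?deltac ?deltad// !inE eqxx ?orbT//.
apply/skorohod_ballP; exists (fun x => x + h x) => //.
exists (e / 2); first by lra.
move=> u uI; split.
  by rewrite addrAC subrr add0r (le_trans (hm u))//; lra.
have [_ [_ [[+ _] _ _ _ _]]] := wT; move=> /(_ u uI).
move: (uI); rewrite !in_itv/= => /andP[cu ud] /andP[cw wd].
set w := u + h u in cw wd *; pose s := grid n (index n w).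
have := index_itv n cw; rewrite -/s => /andP[sw ws].
have cs : c <= s by rewrite /s /grid lerDl mulr_ge0// ltW.
have hu := hm u; rewrite ler_norml in hu; case/andP: hu => hu1 hu2.
have wmono x y : x <= y -> x + h x <= y + h y.
  by move=> xy; have := hlip y x; rewrite [`|y - x|]ger0_norm ?subr_ge0// ler_norml => /andP[]; lra.
(* As [s] is the last grid point up to [w], an increasing map cannot send a knot
   that separates [u] from [s] to a grid point just above it. *)
have fus : `|f u - f s| <= e / 4.
  have kP k : k \in K0 -> [/\ k + h k = grid n (up k), k <= grid n (up k) &
      grid n (up k) < k + mesh n].
    move=> kK; have kK' : k \in K by rewrite !inE kK !orbT.
    have /andP[g1 g2] : k <= grid n (up k) < k + mesh n.
      by apply: upP; case/andP: (Kcd k kK').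
    by split => //; rewrite hK// /delta; lra.
  have [us|su] := leP u s.
    apply: mod => //; [exact: le_lt_trans wd|rewrite /w in sw ws; lra|].
    move=> k kK /andP[uk ks]; have [wk g1 g2] := kP k kK.
    have : grid n (up k) < grid n (index n w).+1 by rewrite gridS -/s; lra.
    rewrite grid_lt ltnS -(grid_le n) -/s => gs.
    have := hlip k u; rewrite [`|k - u|]gtr0_norm ?subr_gt0// ler_norml => /andP[hku _].
    by rewrite /w in sw; lra.
  rewrite distrC; apply: mod => //; [exact: ltW|rewrite /w in sw ws; lra|].
  move=> k kK /andP[sk ku]; have [wk g1 g2] := kP k kK.
  have : grid n (up k) < grid n (index n w).+1.
    by rewrite gridS -/s -wk; have := wmono _ _ ku; rewrite -/w; lra.
  by rewrite grid_lt ltnS -(grid_le n) -/s => gs; lra.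
have := vf (index n w); rewrite index_lt ?cw// -/s => /(_ isT) fsv.
rewrite (le_trans (ler_distD (f s) _ _))//.
by rewrite /= /stepf; lra.
Unshelve. all: by end_near. Qed.

End sampling.

(** * Borel sets of a space with countable codes *)

Section coded_spaces.
Context {R : realType} {S : pseudoPMetricType R}.
Variables (C : nat -> countType) (code : forall n, S -> C n)
  (disc : forall n, C n -> S) (coarsen : forall n, C n.+1 -> C n).
Hypothesis disc_near : forall x (e : R), 0 < e ->
  \forall n \near \oo, ball x e (disc (code n x)).
Hypothesis coarsenE : forall n x, code n x = coarsen (code n.+1 x).
Hypothesis code_measurable : forall n v,
  measurable ([set x | code n x = v] : set (borel S)).

(** Finer codes refine coarser ones, so these sets form a pi-system. *)
Definition code_sets : set (set S) :=
  [set A | [\/ A = set0, A = setT | exists n v, A = [set x | code n x = v]]].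

Lemma code_setsI : setI_closed code_sets.
Proof.
have coarse m n (x y : S) : (n <= m)%N -> code m x = code m y -> code n x = code n y.
  by move=> /subnK <-; elim: (m - n)%N => // k ih h; apply: ih; rewrite coarsenE [RHS]coarsenE; congr coarsen; exact: h.
have key n m v w : (n <= m)%N ->
    code_sets ([set x | code n x = v] `&` [set x | code m x = w]).
  move=> nm; have [[x [xv xw]]|] :=
      pselect (exists x, code n x = v /\ code m x = w).
    apply: Or33; exists m, w; apply/seteqP; split=> [y [_ //]|y /= yw].
    by split => //=; rewrite -xv; apply: coarse nm _; rewrite yw.
  by move=> h; apply: Or31; rewrite -subset0 => x [xv xw]; apply: h; exists x.
move=> A B [->|->|[n [v ->]]] [->|->|[m [w ->]]];
  rewrite ?set0I ?setI0 ?setTI ?setIT;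
  try by [apply: Or31|apply: Or32|apply: Or33; eexists; eexists].
have [nm|/ltnW mn] := leqP n m; first exact: key.
by rewrite setIC; exact: key.
Qed.

Lemma code_preimage_measurable d (T : measurableType d) (X : T -> S) n (A : set (C n)) :
  (forall v, measurable (X @^-1` [set x | code n x = v])) ->
  measurable (X @^-1` [set x | A (code n x)]).
Proof.
move=> h; rewrite (_ : _ @^-1` _ = \bigcup_v
    if pselect (A v) is left _ then X @^-1` [set x | code n x = v] else set0).
  apply: countable_bigcupT_measurable; first exact: countableP.
  by move=> v; case: pselect.
apply/seteqP; split=> [t /= At|t [v _]].
  by exists (code n (X t)) => //; case: pselect.
by case: pselect => //= Av ->.
Qed.

(** A closed set [F] is recovered from the codes: [x] lies in [F] as soon as
    its discretizations get arbitrarily close to [F]. *)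
Lemma measurable_coded d (T : measurableType d) (X : T -> S) :
  (forall n v, measurable (X @^-1` [set x | code n x = v])) ->
  measurable_fun setT (X : T -> borel S).
Proof.
move=> h; apply: (@measurability _ _ T (borel S) setT X (@open S)) => // _ [U oU <-].
set F := ~` U.
suff mF : measurable (X @^-1` F).
  rewrite setTI (_ : X @^-1` U = ~` (X @^-1` F)); first exact: measurableC.
  by rewrite preimage_setC setCK.
have cF : closed F by exact: open_closedC.
(* The points within [1 / (k + 1)] of [F]. *)
pose near_F k := [set y : S | exists2 z, F z & ball z (k.+1%:R^-1 : R) y].
rewrite (_ : X @^-1` F = \bigcap_k \bigcup_N \bigcap_n
   (X @^-1` [set x | near_F k (disc (code (N + n) x))])).
  apply: bigcapT_measurable => k; apply: bigcupT_measurable => N.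
  apply: bigcapT_measurable => n.
  exact: (@code_preimage_measurable _ _ X _ [set v | near_F k (disc v)]).
apply/seteqP; split=> t.
  move=> FX k _; have [N _ hN] := @disc_near (X t) (k.+1%:R^-1) (ltac:(by [])).
  by exists N => // n _ /=; exists (X t) => //; apply: hN => /=; exact: leq_addr.
move=> h'; apply: cF => B /nbhs_ballP[e /= e0 eB].
have e2 : 0 < e / 2 by rewrite divr_gt0.
have [k _ hk] := near_infty_natSinv_lt (PosNum e2).
have [N _ hN] := h' k Logic.I.
have [M _ hM] := @disc_near (X t) (e / 2) e2.
have [z Fz zd] := hN M Logic.I.
exists z; split => //; apply: eB; rewrite (splitr e).
apply: (ball_triangle (hM _ (leq_addl N M))).
apply: ball_sym; apply: le_ball zd; apply: ltW; apply: hk => /=; exact: leqnn.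
Qed.

Lemma borel_coded : measurable = <<s code_sets>> :> set (set (borel S)).
Proof.
apply/seteqP; split; last first.
  apply: smallest_sub; first exact: sigma_algebra_measurable.
  by move=> A [->|->|[n [v ->]]].
have m : measurable_fun setT (id : g_sigma_algebraType code_sets -> borel S).
  apply: measurable_coded => n v; apply: sub_sigma_algebra.
  by apply: Or33; exists n, v.
by move=> A mA; have := m measurableT A mA; rewrite setTI preimage_id.
Qed.

(** The code sets form a countable generating pi-system. This is how separability is
    used: almost sure statements about countably many events extend to all of them. *)
Lemma borel_unique (m1 m2 : probability (borel S) R) :
  (forall n v, m1 [set x | code n x = v] = m2 [set x | code n x = v]) ->
  forall A, measurable A -> m1 A = m2 A.
Proof.
move=> h; apply: (@measure_unique _ R (borel S) code_sets (fun=> setT)).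
- exact: borel_coded.
- exact: code_setsI.
- by move=> _; apply: Or32.
- by rewrite bigcup_const.
- by move=> A [->|->|[n [v ->]]]; [rewrite !measure0|exact: etrans (probability_setT m1) (esym (probability_setT m2))|exact: h].
- by move=> _; apply: (@le_lt_trans _ _ 1%E); [exact: probability_le1|exact: ltry].
Qed.

End coded_spaces.

Lemma continuous_borel (R : realType) (S : pseudoPMetricType R) (phi : S -> R) :
  continuous phi -> measurable_fun setT (phi : borel S -> R).
Proof.
move=> cphi; apply: (measurability (@RGenOInfty.G R)).
  exact: RGenOInfty.measurableE.
move=> _ [_ [x ->] <-]; rewrite setTI; apply: sub_sigma_algebra.
by move/continuousP: cphi; apply; exact: interval_open.
Qed.

(** * Codes for vectors and for cadlag paths *)

Definition image_law d d' (T : measurableType d) (T' : measurableType d')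
    (R : realType) (P : probability T R) (X : T -> T')
    (mX : measurable_fun setT X) : probability T' R :=
  distribution P (mfun_Sub (mem_set mX)).

Lemma image_lawE d d' (T : measurableType d) (T' : measurableType d')
    (R : realType) (P : probability T R) (X : T -> T')
    (mX : measurable_fun setT X) A : image_law P mX A = P (X @^-1` A).
Proof. by []. Qed.

Lemma measurable_forall d (T : measurableType d) (I : finType) (A : I -> set T) :
  (forall i, measurable (A i)) -> measurable [set x | forall i, A i x].
Proof.
move=> mA; rewrite (_ : [set x | _] = \bigcap_(i in setT) A i); last first.
  by apply/seteqP; split=> x h // i; exact: h.
by apply: fin_bigcap_measurable => //; exact: finite_finset.
Qed.

Section quantization.
Context {R : realType}.

(** This makes dyadic roundings compatible: a rounding at scale [n] is a function of
    the rounding at scale [n + 1]. *)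
Lemma floor_half (x : R) : Num.floor x = (Num.floor (2 * x) %/ 2)%Z.
Proof.
set F := Num.floor (2 * x); apply: floor_def.
have /andP[F1 F2] := floor_itv (2 * x); rewrite -/F in F1 F2.
have FE := divz_eq F 2; set q := (F %/ 2)%Z in FE *.
have r0 : (0 <= F %% 2)%Z by exact: modz_ge0.
have r1 : ((F %% 2)%Z <= 1)%R by rewrite -ltzD1; exact: (@ltz_pmod F 2).
have FR : F%:~R = 2 * q%:~R + ((F %% 2)%Z)%:~R :> R by rewrite {1}FE intrD intrM mulrC.
have r0' : (0 : R) <= ((F %% 2)%Z)%:~R by rewrite ler0z.
have r1' : ((F %% 2)%Z)%:~R <= (1 : R) by rewrite (_ : 1 = 1%:~R)// ler_int.
by rewrite intrD; move: F2; rewrite intrD => F2; apply/andP; split; lra.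
Qed.

Lemma quantize_near (x : R) n : `|x - (Num.floor (2 ^+ n * x))%:~R / 2 ^+ n| <= 2^-1 ^+ n.
Proof.
have p0 : 0 < (2 : R) ^+ n by rewrite exprn_gt0.
have /andP[] := floor_itv (2 ^+ n * x); rewrite intrD.
set F := _%:~R => F1 F2.
have le1 : F / 2 ^+ n <= x by rewrite ler_pdivrMr// mulrC.
rewrite ger0_norm ?subr_ge0// exprVn lerBlDr -[X in X + _]mul1r -mulrDl.
by rewrite ler_pdivlMr// mulrC addrC ltW.
Qed.

Lemma quantize_cvg (e : R) : 0 < e -> \forall n \near \oo, (2^-1 : R) ^+ n <= e.
Proof. by move=> /(half_small ler01); apply: filterS => n; rewrite mulr1. Qed.

Lemma measurable_floor d (T : measurableType d) (X : T -> R) (a : R) (k : int) :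
  measurable_fun setT X -> measurable [set t | Num.floor (a * X t) = k].
Proof.
move=> mX; rewrite (_ : [set t | _] =
    setT `&` (fun t => a * X t) @^-1` `[k%:~R, (k + 1)%:~R[%classic).
  by apply: measurable_funM => //; exact: measurable_itv.
apply/seteqP; split=> t /=.
  by move=> /eqP; rewrite floor_eq => h; split => //=; rewrite in_itv.
by move=> [_]; rewrite in_itv/= => h; apply/eqP; rewrite floor_eq.
Qed.

End quantization.

HB.saturate matrix.

Section row_space.
Context {R : realType} (m : nat).

Definition row_code n (x : 'rV[R]_m) : {ffun 'I_m -> int} :=
  [ffun i => Num.floor (2 ^+ n * x ord0 i)].
Definition row_disc n (v : {ffun 'I_m -> int}) : 'rV[R]_m :=
  \row_i ((v i)%:~R / 2 ^+ n).
Lemma row_disc_near (x : 'rV[R]_m) (e : R) : 0 < e ->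
  \forall n \near \oo, ball x e (row_disc n (row_code n x)).
Proof.
move=> e0; have e2 : 0 < e / 2 by rewrite divr_gt0.
apply: filterS (quantize_cvg e2) => n ne; split=> // i j.
rewrite -ball_normE /= mxE ffunE (ord1 i).
by apply: le_lt_trans (quantize_near _ _) _; lra.
Qed.

Lemma row_codeE d (T : measurableType d) (X : T -> 'rV[R]_m) n v :
  X @^-1` [set x | row_code n x = v] =
  [set t | forall i, Num.floor (2 ^+ n * X t ord0 i) = v i].
Proof.
apply/seteqP; split=> t /=; first by move=> <- i; rewrite ffunE.
by move=> h; apply/ffunP => i; rewrite ffunE.
Qed.

Lemma measurable_row d (T : measurableType d) (X : T -> 'rV[R]_m) :
  (forall i, measurable_fun setT (fun t => X t ord0 i)) ->
  measurable_fun setT (X : T -> borel 'rV[R]_m).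
Proof.
move=> h; apply: (measurable_coded row_disc_near) => n v.
by rewrite row_codeE; apply: measurable_forall => i; exact: measurable_floor.
Qed.

End row_space.

Section cadlag_space.
Context {R : realType} (c d : R).
Hypothesis cd : c < d.

(** The set [f <= q on ]s, s + e[] is closed, and the value [f s] is read off
    these sets by right continuity. *)
Lemma measurable_eval s : c <= s < d ->
  measurable_fun setT (fun f : borel (cadlag c d) => (f : cadlag c d) s).
Proof.
move=> /andP[cs sd]; apply: (measurability (@RGenInftyO.G R)).
  exact: RGenInftyO.measurableE.
move=> _ [_ [q ->] <-]; rewrite setTI.
(* The paths that exceed [q'] somewhere in [(s, s + e)]; a small time change does
   not leave an open interval, so this set is open. *)
pose A (q' e : R) := [set f : cadlag c d | exists u, [/\ s < u, u < s + e, u < d & q' < f u]].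
have oA q' e : open (A q' e).
  rewrite openE => f [u [su ue ud qu]]; apply/nbhs_ballP.
  pose r := Num.min (Num.min (u - s) (s + e - u)) (f u - q').
  have r0 : 0 < r by rewrite !lt_min !subr_gt0 su ue qu.
  exists r => //= g /skorohod_ballP[w [_ [_ [[wI _] _ _ _ _]]] [e' e'r h]].
  have uI : u \in `[c, d[ by rewrite in_itv/= ud andbT; apply: le_trans cs (ltW su).
  have [h1 h2] := h u uI; have := wI _ uI; rewrite in_itv/= => /andP[_ wd].
  move: e'r; rewrite !lt_min => /andP[/andP[r1 r2] r3].
  move: h1 h2; rewrite !ler_norml => /andP[a1 a2] /andP[b1 b2].
  by exists (w u); split => //; lra.
rewrite (_ : _ @^-1` _ = \bigcup_k \bigcup_n ~` A (q - k.+1%:R^-1) n.+1%:R^-1).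
  apply: bigcupT_measurable => k; apply: bigcupT_measurable => n.
  by apply: measurableC; apply: sub_sigma_algebra; exact: oA.
apply/seteqP; split=> f /=.
  rewrite in_itv/= => fq.
  have q2 : 0 < (q - f s) / 2 by rewrite divr_gt0 ?subr_gt0.
  have [k _ hk] := near_infty_natSinv_lt (PosNum q2).
  have [fr _] := cadlagP f.
  have /cvgrPdist_le/(_ _ q2)[r /= r0 hr] : f x @[x --> s^'+] --> f s.
    by apply: fr; rewrite cs.
  have [n _ hn] := near_infty_natSinv_lt (PosNum r0).
  exists k => //; exists n => // -[u [su un ud qu]].
  have h1 : n.+1%:R^-1 < r := hn n (leqnn _).
  have h2 : k.+1%:R^-1 < (q - f s) / 2 := hk k (leqnn _).
  have : `|f s - f u| <= (q - f s) / 2.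
    apply: hr => //=; rewrite distrC gtr0_norm ?subr_gt0// ltrBlDl.
    by rewrite (lt_trans un)// ltrD2l.
  have : q - (q - f s) / 2 < f u by apply: lt_trans qu; rewrite ltrD2l ltrN2.
  by rewrite ler_norml => ? /andP[]; lra.
move=> [k _ [n _ /= h]]; rewrite in_itv/=.
have k0 : (0 : R) < k.+1%:R^-1 by [].
apply: (@le_lt_trans _ _ (q - k.+1%:R^-1)); last by rewrite ltrBlDr ltrDl.
rewrite leNgt; apply/negP => qs; apply: h.
have [fr _] := cadlagP f.
have /cvgrPdist_lt/(_ (f s - (q - k.+1%:R^-1))) : f x @[x --> s^'+] --> f s.
  by apply: fr; rewrite cs.
rewrite subr_gt0 => /(_ qs) hr.
have : \forall u \near s^'+, [/\ s < u, u < s + n.+1%:R^-1, u < d &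
    `|f s - f u| < f s - (q - k.+1%:R^-1)].
  near=> u; split; near: u; [exact: nbhs_right_gt| |exact: nbhs_right_lt|exact: hr].
  by apply: nbhs_right_lt; rewrite ltrDl.
move=> /filter_ex[u [su un ud]]; rewrite ltr_norml => /andP[_ fu].
by exists u; split => //; move: fu; rewrite ltrD2l ltrN2.
Unshelve. all: by end_near. Qed.

(** Both the grid and the rounding are dyadic, so that each code is a function of the
    next one. *)
Definition path_code n (f : cadlag c d) : {ffun 'I_(2 ^ n) -> int} :=
  [ffun k : 'I_(2 ^ n) => Num.floor (2 ^+ n * f (grid c d n k))].
Definition path_disc n (v : {ffun 'I_(2 ^ n) -> int}) : cadlag c d :=
  step cd n (fun k => if insub k is Some i then (v i)%:~R / 2 ^+ n else 0).

Lemma double_lt n (k : 'I_(2 ^ n)) : (2 * k < 2 ^ n.+1)%N.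
Proof. by rewrite expnS ltn_pmul2l. Qed.

Definition path_coarsen n (v : {ffun 'I_(2 ^ n.+1) -> int}) : {ffun 'I_(2 ^ n) -> int} :=
  [ffun k => (v (Ordinal (double_lt k)) %/ 2)%Z].

Lemma path_disc_near (f : cadlag c d) (e : R) : 0 < e ->
  \forall n \near \oo, ball f e (path_disc (path_code n f)).
Proof.
move=> e0; have e4 : 0 < e / 4 by rewrite divr_gt0.
near=> n; have h : forall v, (forall k, (k < 2 ^ n)%N ->
    `|f (grid c d n k) - v k| <= e / 4) -> skorohod_ball f e (step cd n v).
  by near: n; exact: sample_near.
apply: h => k kn; rewrite insubT ffunE/=.
apply: le_trans (quantize_near _ _) _; near: n; exact: quantize_cvg.
Unshelve. all: by end_near. Qed.

Lemma path_coarsenE n f : path_code n f = path_coarsen (path_code n.+1 f).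
Proof.
apply/ffunP => k; rewrite !ffunE floor_half exprS mulrA; congr (Num.floor (_ * f _) %/ 2)%Z.
by rewrite /= /grid /mesh natrM exprS; lra.
Qed.

Lemma path_codeE d' (T : measurableType d') (X : T -> cadlag c d) n v :
  X @^-1` [set f | path_code n f = v] =
  [set t | forall k : 'I_(2 ^ n), Num.floor (2 ^+ n * X t (grid c d n k)) = v k].
Proof.
apply/seteqP; split=> t /=; first by move=> <- i; rewrite ffunE.
by move=> h; apply/ffunP => i; rewrite ffunE.
Qed.

Lemma path_code_measurable n v :
  measurable ([set f | path_code n f = v] : set (borel (cadlag c d))).
Proof.
have := @path_codeE _ (borel (cadlag c d)) id n v; rewrite preimage_id => ->.
apply: measurable_forall => k; apply: (@measurable_floor _ _ (borel (cadlag c d))).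
by apply: measurable_eval; exact: grid_in.
Qed.

(** The Borel sets of the Skorohod topology are generated by the evaluations. *)
Lemma measurable_path d' (T : measurableType d') (X : T -> cadlag c d) :
  (forall s, c <= s < d -> measurable_fun setT (fun t => X t s)) ->
  measurable_fun setT (X : T -> borel (cadlag c d)).
Proof.
move=> h; apply: (measurable_coded path_disc_near) => n v.
rewrite path_codeE; apply: measurable_forall => i.
by apply: measurable_floor; apply: h; exact: grid_in.
Qed.

End cadlag_space.

(** * The space of point configurations *)

Section counting_sums.
Context {R : realType} {T : choiceType}.

Lemma counting_esum (X : set T) : counting X = \esum_(q in X) (1%:E : \bar R).
Proof.
rewrite /counting; case: asboolP => [finX|infX].
  rewrite esum_fset// fsbig_finite//= sumEFin; congr EFin.
  by rewrite big_const_seq count_predT iter_addr addr0 -[RHS]mulr_natr mul1r.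
apply/esym/eqyP => A A0; apply: esum_ge.
have [B BX sB] := @infinite_set_fset _ X (Num.truncn A).+1 infX.
eexists; first by split; [exact: (finite_fset B)|exact: BX].
rewrite fsbig_finite//= set_fsetK sumEFin lee_fin.
rewrite big_const_seq count_predT iter_addr addr0 -mulr_natr mul1r.
have := truncnS_gt A => /ltW/le_trans; apply; by rewrite ler_nat.
Qed.

Lemma counting_ge0 (X : set T) : (0 <= counting X :> \bar R)%E.
Proof. by rewrite counting_esum esum_ge0. Qed.

Lemma counting_bigcup (F : (set T)^nat) : trivIset setT F ->
  counting (\bigcup_n F n) = (\sum_(0 <= i <oo) counting (F i) : \bar R)%E.
Proof.
move=> tF; rewrite counting_esum nneseries_sum_bigcup//.
by apply: eq_eseriesr => i _; rewrite counting_esum.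
Qed.

Lemma esum_fine_scale (S : set T) (r : R) : 0 <= r ->
  \esum_(q in S) r%:E = (r%:E * counting S)%E.
Proof.
move=> r0; rewrite counting_esum -(esumZ (h := fun=> 1)) //.
by under [RHS]eq_esum do rewrite mulr1.
Qed.

Lemma esum_nondecreasing_cvg (S : set T) (h : nat -> T -> R) (f : T -> R) :
  (forall n q, 0 <= h n q) -> (forall q, nondecreasing_seq (h ^~ q)) ->
  (forall q, h n q @[n --> \oo] --> f q) ->
  \esum_(q in S) (h n q)%:E @[n --> \oo] --> \esum_(q in S) (f q)%:E.
Proof.
move=> h0 nd hf.
have hle n q : h n q <= f q.
  rewrite -(cvg_lim _ (hf q))//; apply: nondecreasing_cvgn_le; first exact: nd.
  by apply/cvg_ex; exists (f q); exact: hf.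
have nde : nondecreasing_seq (fun n => \esum_(q in S) (h n q)%:E).
  by move=> m n mn; apply: le_esum => q _; rewrite lee_fin; exact: nd.
suff <- : ereal_sup (range (fun n => \esum_(q in S) (h n q)%:E)) =
    \esum_(q in S) (f q)%:E by exact: ereal_nondecreasing_cvgn.
apply/eqP; rewrite eq_le; apply/andP; split.
  by apply: ge_ereal_sup => _ [n _ <-]; apply: le_esum => q _; rewrite lee_fin.
apply: ge_ereal_sup => /= _ [X [finX XS]] <-.
rewrite fsbig_finite//=.
have c : \sum_(q <- finmap.enum_fset (fset_set X)) (h n q)%:E @[n --> \oo] -->
    (\sum_(q <- finmap.enum_fset (fset_set X)) (f q)%:E)%E.
  apply: cvg_nnesum => q _; first by apply: nearW => n; rewrite lee_fin.
  by apply: cvg_EFin; [exact: nearW|exact: hf].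
apply: (cvge_le _ c); apply: nearW => n.
apply: (@le_trans _ _ (\esum_(q in S) (h n q)%:E)).
  by apply: esum_ge; exists X => //; rewrite fsbig_finite.
by apply: ereal_sup_ubound; exists n.
Qed.

End counting_sums.

Section configuration_space.
Context {R : realType}.

(** Configurations carry the sigma-algebra generated by the counts. It is put on all
    subsets of the plane; sums whose terms depend on the configuration itself are
    treated on the locally finite ones. *)
Definition conf_gen : set (set (set (R * R))) :=
  [set E | exists2 A : set (R * R), measurable A &
           exists2 B : set (\bar R), measurable B &
           E = [set N | B (counting (N `&` A))]].

Definition conf := g_sigma_algebraType conf_gen.

Lemma measurable_count (A : set (R * R)) : measurable A ->
  measurable_fun setT (fun N : conf => counting ((N : set _) `&` A) : \bar R).
Proof.
move=> mA _ B mB; rewrite setTI; apply: sub_sigma_algebra.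
by exists A => //; exists B.
Qed.

Lemma measurable_conf d (T : measurableType d) (N : T -> set (R * R)) :
  (forall A, measurable A ->
    measurable_fun setT (fun x => counting (N x `&` A) : \bar R)) ->
  measurable_fun setT (N : T -> conf).
Proof.
move=> h; apply: (@measurability _ _ T conf setT N conf_gen) => //.
move=> _ [_ [A mA [B mB ->]] <-].
by have := h A mA measurableT B mB.
Qed.

Definition point_measure (N : set (R * R)) (A : set (R * R)) : \bar R :=
  counting (N `&` A).

Section point_measure.
Variable N : set (R * R).

Let pm0 : point_measure N set0 = 0%E.
Proof. by rewrite /point_measure setI0 counting_esum esum_set0. Qed.

Let pm_ge0 A : (0 <= point_measure N A)%E.
Proof. exact: counting_ge0. Qed.

Let pm_additive : semi_sigma_additive (point_measure N).
Proof.
move=> F mF tF mUF; rewrite /point_measure setI_bigcupr counting_bigcup.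
  by apply: is_cvg_nneseries => n _ _; exact: counting_ge0.
by apply: trivIset_setIl.
Qed.

HB.instance Definition _ :=
  isMeasure.Build _ _ _ (point_measure N) pm0 pm_ge0 pm_additive.
End point_measure.

Section parametrized_sums.
Context d (T : measurableType d) (N : T -> conf).
Hypothesis mN : measurable_fun setT N.
Variable L : nat -> set (R * R).
Hypothesis mL : forall m, measurable (L m).
Hypothesis Lfin : forall m x, (counting ((N x : set _) `&` L m) < +oo :> \bar R)%E.
Hypothesis Lcover : \bigcup_m L m = setT.

Let k (x : T) : {measure set (R * R) -> \bar R} := point_measure (N x).

Let mk U : measurable U -> measurable_fun [set: T] (k ^~ U).
Proof. by move=> mU; exact: (measurableT_comp (measurable_count mU) mN). Qed.

HB.instance Definition _ := isKernel.Build _ _ T (R * R)%type R k mk.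

Let D := seqDU L.

(** For a locally finite configuration the counting measure is a kernel, so that
    sections may be counted piece by piece on the sets [L m]. *)
Lemma measurable_count_section (E : set (T * (R * R))) : measurable E ->
  measurable_fun setT (fun x => counting ((N x : set _) `&` xsection E x) : \bar R).
Proof.
move=> mE.
have mD m : measurable (D m) by apply: measurableD => //; exact: bigsetU_measurable.
have key m : measurable_fun setT
    (fun x => counting ((N x : set _) `&` (xsection E x `&` D m)) : \bar R).
  have := @measurable_prod_subset_xsection_kernel _ _ T (R * R)%type R k (D m) (mD m).
  move=> /(_ _)/wrap[x|/(_ _ mE)[_ //]].
  have := Lfin m x; rewrite -ge0_fin_numE ?counting_ge0// => fL.
  exists (fine (counting ((N x : set _) `&` L m)) + 1) => X mX.
  rewrite EFinD fineK//; apply: (@le_lt_trans _ _ (counting ((N x : set _) `&` L m))).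
    rewrite /mrestr /= /k /point_measure !counting_esum; apply: esum_subset => //.
    by move=> q [Nq [_ [Lq _]]].
  by rewrite lteDl// lte01.
rewrite (_ : (fun x => _) = (fun x => \sum_(0 <= m <oo)
    counting ((N x : set _) `&` (xsection E x `&` D m)) : \bar R)%E).
  apply: ge0_emeasurable_sum => [m x _ _|m _]; first exact: counting_ge0.
  exact: key.
apply/funext => x; rewrite -counting_bigcup.
  by rewrite -setI_bigcupr -setI_bigcupr -seqDU_bigcup_eq Lcover setIT.
by apply: trivIset_setIl; apply: trivIset_setIl; exact: trivIset_seqDU.
Qed.

Import HBNNSimple.

(** Simple functions reduce the sum to counts of sections; monotone convergence
    does the rest. *)
Lemma measurable_esum_param (h : T * (R * R) -> R) :
  measurable_fun setT h -> (forall z, 0 <= h z) ->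
  measurable_fun setT (fun x => \esum_(q in (N x : set _)) (h (x, q))%:E).
Proof.
move=> mh h0.
have mh' : measurable_fun setT (EFin \o h) by exact/measurable_EFinP.
pose k_ := nnsfun_approx measurableT mh'.
have hk z : k_ n z @[n --> \oo] --> h z.
  have := @cvg_nnsfun_approx _ _ _ _ measurableT _ mh' (fun z _ => h0 z) z Logic.I.
  by move=> /fine_cvgP[_].
apply: (emeasurable_fun_cvg (fun n x => \esum_(q in (N x : set _)) (k_ n (x, q))%:E)); last first.
  move=> x _; apply: esum_nondecreasing_cvg => // q.
  by move=> m n mn; exact/lefP/nd_nnsfun_approx.
move=> n.
rewrite [X in measurable_fun _ X](_ : _ = (fun x => \sum_(r \in range (k_ n))
   (r%:E * counting ((N x : set _) `&` xsection (k_ n @^-1` [set r]) x)))%E); last first.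
  apply/funext => x; rewrite fsbig_finite//=.
  under eq_esum do rewrite fimfunE fsbig_finite//= -sumEFin.
  rewrite esum_sum; last by move=> q r _ _; rewrite nnfun_muleindic_ge0.
  rewrite big_seq [RHS]big_seq; apply: eq_bigr => r.
  rewrite in_fset_set// => /set_mem[z _ zr].
  have r0 : 0 <= r by rewrite -zr.
  rewrite -esum_fine_scale// esum_mkcondr; apply: eq_esum => q _.
  rewrite indicE; have [e|e] := pselect (k_ n (x, q) = r).
    have e' : ((k_ n) @^-1` [set r]) (x, q) by [].
    by rewrite !mem_set ?mulr1//; exact/xsectionP.
  have e' : ~ ((k_ n) @^-1` [set r]) (x, q) by [].
  by rewrite !memNset ?mulr0// => /xsectionP.
apply: emeasurable_fsum => // r; apply: measurable_funeM.
apply: measurable_count_section; exact: measurable_sfunP.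
Qed.

Lemma measurable_sum_over (h : T * (R * R) -> R) :
  measurable_fun setT h ->
  measurable_fun setT (fun x => sum_over (N x : set _) (fun q => h (x, q))).
Proof.
move=> mh; apply: measurable_funB; apply: (measurableT_comp (@fine_measurable R setT measurableT)) => //.
  apply: (@measurable_esum_param (fun z => Num.max (h z) 0)).
    exact: measurable_maxr.
  by move=> z; rewrite le_max lexx orbT.
apply: (@measurable_esum_param (fun z => Num.max (- h z) 0)).
  by apply: measurable_maxr => //; exact: measurableT_comp.
by move=> z; rewrite le_max lexx orbT.
Qed.

End parametrized_sums.

Import HBNNSimple.

Lemma measurable_esum_conf (f : R * R -> R) : measurable_fun setT f ->
  (forall q, 0 <= f q) ->
  measurable_fun setT (fun N : conf => \esum_(q in (N : set _)) (f q)%:E).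
Proof.
move=> mf f0.
have mf' : measurable_fun setT (EFin \o f) by exact/measurable_EFinP.
pose k_ := nnsfun_approx measurableT mf'.
have hk z : k_ n z @[n --> \oo] --> f z.
  have := @cvg_nnsfun_approx _ _ _ _ measurableT _ mf' (fun z _ => f0 z) z Logic.I.
  by move=> /fine_cvgP[_].
apply: (emeasurable_fun_cvg (fun n (N : conf) => \esum_(q in (N : set _)) (k_ n q)%:E)); last first.
  move=> x _; apply: esum_nondecreasing_cvg => // q.
  by move=> m n mn; exact/lefP/nd_nnsfun_approx.
move=> n.
rewrite [X in measurable_fun _ X](_ : _ = (fun N : conf => \sum_(r \in range (k_ n))
   (r%:E * counting ((N : set _) `&` (k_ n @^-1` [set r]))))%E); last first.
  apply/funext => x; rewrite fsbig_finite//=.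
  under eq_esum do rewrite fimfunE fsbig_finite//= -sumEFin.
  rewrite esum_sum; last by move=> q r _ _; rewrite nnfun_muleindic_ge0.
  rewrite big_seq [RHS]big_seq; apply: eq_bigr => r.
  rewrite in_fset_set// => /set_mem[z _ zr].
  have r0 : 0 <= r by rewrite -zr.
  rewrite -esum_fine_scale// esum_mkcondr; apply: eq_esum => q _.
  rewrite indicE; have [e|e] := pselect (((k_ n) @^-1` [set r]) q).
    by rewrite !mem_set ?mulr1.
  by rewrite !memNset ?mulr0.
apply: emeasurable_fsum => // r; apply: measurable_funeM.
by apply: measurable_count; exact: measurable_sfunP.
Qed.

End configuration_space.

(** * Counts of a Poisson process on finitely many sets *)

Section countable_laws.
Context {R : realType} d1 d2 (T1 : measurableType d1) (T2 : measurableType d2).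
Variables (P1 : {measure set T1 -> \bar R}) (P2 : {measure set T2 -> \bar R}).

Lemma nat_law (c1 : T1 -> nat) (c2 : T2 -> nat) (U : set nat) :
  (forall k, measurable (c1 @^-1` [set k])) ->
  (forall k, measurable (c2 @^-1` [set k])) ->
  (forall k, U k -> P1 (c1 @^-1` [set k]) = P2 (c2 @^-1` [set k])) ->
  P1 (c1 @^-1` U) = P2 (c2 @^-1` U).
Proof.
have E (T : Type) (c : T -> nat) : c @^-1` U = \bigcup_(k in U) c @^-1` [set k].
  apply/seteqP; split=> [t Ut|t [k Uk /= ck]]; first by exists (c t).
  by rewrite /preimage/= ck.
move=> m1 m2 h; rewrite (E _ c1) (E _ c2).
rewrite !measure_bigcup//; last 2 first.
- by move=> i j _ _ [t [/= <- <-]].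
- by move=> i j _ _ [t [/= <- <-]].
by apply: eq_eseriesr => k /set_mem /h.
Qed.

(** An encoding by natural numbers turns any subset of [C] into a countable disjoint
    union of points. *)
Lemma countable_law (C : countType) (c1 : T1 -> C) (c2 : T2 -> C) (U : set C) :
  (forall k, measurable (c1 @^-1` [set k])) ->
  (forall k, measurable (c2 @^-1` [set k])) ->
  (forall k, P1 (c1 @^-1` [set k]) = P2 (c2 @^-1` [set k])) ->
  P1 (c1 @^-1` U) = P2 (c2 @^-1` U).
Proof.
move=> m1 m2 h.
have E (T : Type) (c : T -> C) k : (choice.pickle \o c) @^-1` [set k] =
    if pickle_inv k is Some v then c @^-1` [set v] else set0.
  case E : (pickle_inv _) => [v|].
    have kv : choice.pickle v = k by have := @pickle_invK C k; rewrite /ocancel/oapp E.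
    apply/seteqP; split=> t /=; last by move=> ->.
    by rewrite -kv; exact: (pcan_inj choice.pickleK).
  by rewrite -subset0 => t /= ck; move: E; rewrite -ck pickleK_inv.
have F (T : Type) (c : T -> C) : c @^-1` U = (choice.pickle \o c) @^-1` (choice.pickle @` U).
  apply/seteqP; split=> t /=; first by move=> Ut; exists (c t).
  by move=> [v Uv /(pcan_inj choice.pickleK) <-].
rewrite (F _ c1) (F _ c2); apply: nat_law => k; rewrite !E.
- by case: pickle_inv.
- by case: pickle_inv.
- by case: pickle_inv => [v|]; rewrite ?measure0.
Qed.

End countable_laws.

Section atoms.
Context {R : realType} {T : choiceType} (n : nat).
Implicit Types (A : 'I_n -> set T).

Definition natoms := #|{set 'I_n}|.

(** The atoms of the algebra generated by the [A i], except the complement of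
    their union, which is replaced by the empty set. *)
Definition atom A (j : 'I_natoms) : set T :=
  [set q | (exists i, A i q) /\ forall i, A i q <-> i \in enum_val j].

Lemma trivIset_atom A : trivIset setT (atom A).
Proof.
move=> i j _ _ [q [[_ hi] [_ hj]]]; apply: enum_val_inj; apply/setP => k.
by apply/idP/idP => [/hi/hj|/hj/hi].
Qed.

(** The number of points as a natural number, [0] standing for infinitely many. *)
Definition ccode (X : set T) : nat :=
  if `[< finite_set X >] then (size (finmap.enum_fset (fset_set X))).+1 else 0.
Definition cval (k : nat) : \bar R := if k is k'.+1 then k'%:R%:E else +oo%E.

Lemma counting_ccode X : counting X = cval (ccode X).
Proof. by rewrite /counting /ccode; case: ifP. Qed.

Lemma cval_inj : injective cval.
Proof.
move=> [|k] [|l] //= [] /eqP; rewrite eqr_nat => /eqP -> //.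
Qed.

Lemma ccodeP X k : ccode X = k <-> counting X = cval k.
Proof. by rewrite counting_ccode; split => [->//|/cval_inj]. Qed.

Lemma counting_atoms A (X : set T) i : (counting (X `&` A i) =
  \sum_(j < natoms | i \in enum_val j) counting (X `&` atom A j) :> \bar R)%E.
Proof.
rewrite counting_esum.
under eq_bigr do rewrite counting_esum esum_mkcondr.
rewrite -esum_sum; last by move=> q j _ _; case: ifP.
rewrite esum_mkcondr; apply: eq_esum => q _.
pose e : {set 'I_n} := finset (fun k => `[< A k q >]).
have eP k : A k q <-> k \in e by rewrite finset.in_set; split => /asboolP.
have [Aq|Aq] := pselect (A i q).
  rewrite mem_set// (bigD1 (enum_rank e))/=; last by rewrite enum_rankK; apply/eP.
  rewrite mem_set; last first.
    by split; [exists i|move=> k; rewrite enum_rankK].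
  rewrite big1 ?adde0// => j /andP[ij jne]; rewrite memNset// => -[_ h].
  move/eqP: jne; case; apply: enum_val_inj; rewrite enum_rankK.
  by apply/setP => k; apply/idP/idP => [/h/eP|/eP/h].
rewrite memNset// big1// => j ij; rewrite memNset// => -[_ h].
by apply: Aq; apply/h.
Qed.

Definition atom_codes A (X : set T) : {ffun 'I_natoms -> nat} :=
  [ffun j => ccode (X `&` atom A j)].

(** The count on [A i] is the sum of the counts on the atoms inside [A i], so an event
    about overlapping sets becomes one about disjoint sets. *)
Definition atom_event (B : 'I_n -> set (\bar R)) : set {ffun 'I_natoms -> nat} :=
  [set v | forall i, B i (\sum_(j < natoms | i \in enum_val j) cval (v j))%E].

Lemma atom_eventP A B X :
  (forall i, B i (counting (X `&` A i))) <-> atom_event B (atom_codes A X).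
Proof.
by split => h i; have := h i; rewrite /atom_event counting_atoms;
  (have -> // : (\sum_(j < natoms | i \in enum_val j) cval (atom_codes A X j) =
   \sum_(j < natoms | i \in enum_val j) counting (X `&` atom A j))%E
     by apply: eq_bigr => j _; rewrite ffunE counting_ccode).
Qed.

Lemma atom_codesP A X v :
  atom_codes A X = v <-> forall j, ccode (X `&` atom A j) = v j.
Proof.
split=> [<- j|h]; first by rewrite ffunE.
by apply/ffunP => j; rewrite ffunE.
Qed.

End atoms.

Section poisson_laws.
Context {R : realType}.
Implicit Types (S : set (R * R)) (mu : set (R * R) -> \bar R).

Lemma measurable_atom n (A : 'I_n -> set (R * R)) j :
  (forall i, measurable (A i)) -> measurable (atom A j).
Proof.
move=> mA; rewrite (_ : atom A j = (\bigcup_i A i) `&`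
    [set q | forall i, (if i \in enum_val j then A i else ~` A i) q]).
  apply: measurableI.
    by apply: countable_bigcupT_measurable => //; exact: countableP.
  by apply: measurable_forall => i; case: ifP => _ //; exact: measurableC.
apply/seteqP; split=> q.
  move=> [[i Ai] h]; split; first by exists i.
  by move=> k; case: ifPn => [/h//|/negP kj /h].
move=> [[i _ Ai] h]; split; first by exists i.
by move=> k; have := h k; case: ifPn.
Qed.

Lemma atom_sub n (A : 'I_n -> set (R * R)) S j :
  (forall i, A i `<=` S) -> atom A j `<=` S.
Proof. by move=> AS q [[i /AS]]. Qed.

Section one_process.
Context d (T : measurableType d) (P : probability T R) S mu (Pi : T -> set (R * R)).
Hypothesis hPi : poisson_point_process P S mu Pi.
Hypothesis mS : measurable S.

Lemma measurable_ppp : measurable_fun setT (Pi : T -> conf).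
Proof.
apply: measurable_conf => A mA; have [sub mc _ _] := hPi.
rewrite (_ : (fun x => _) = Defs.count Pi (A `&` S)).
  by apply: mc; [exact: measurableI|exact: subIsetr].
apply/funext => x; rewrite /Defs.count; congr counting.
by rewrite setIA; apply/esym/setIidl => q [/(proj2 (sub x))].
Qed.

Lemma measurable_ccode (A : set (R * R)) k : measurable A ->
  measurable [set w | ccode (Pi w `&` A) = k].
Proof.
move=> mA; rewrite (_ : [set w | _] = setT `&` (Defs.count Pi A) @^-1` [set cval k]).
  by have := measurableT_comp (@measurable_count R A mA) measurable_ppp; apply.
by rewrite setTI; apply/seteqP; split => w /= /ccodeP.
Qed.

Lemma disjoint_counts n (A : 'I_n -> set (R * R)) (v : 'I_n -> nat) :
  (forall i, measurable (A i)) -> (forall i, A i `<=` S) -> trivIset setT A ->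
  P [set w | forall i, ccode (Pi w `&` A i) = v i] =
  (\prod_(i < n) P [set w | ccode (Pi w `&` A i) = v i])%E.
Proof.
move=> mA AS tA; have [_ _ _ prod] := hPi.
have := prod n A (fun i => [set cval (v i)]) (fun i => conj (mA i) (AS i)) tA
  (fun i => emeasurable_set1 _).
have E i : [set w | [set cval (v i)] (Defs.count Pi (A i) w)] = [set w | ccode (Pi w `&` A i) = v i].
  by apply/seteqP; split => w /= /ccodeP.
under eq_bigr do rewrite E.
move=> <-; congr (P _); apply/seteqP; split => w /= h i; first exact/ccodeP/h.
exact/ccodeP/(h i).
Qed.

End one_process.

Section two_processes.
Context d1 (T1 : measurableType d1) (P1 : probability T1 R) S1
  (Pi1 : T1 -> set (R * R)).
Context d2 (T2 : measurableType d2) (P2 : probability T2 R) S2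
  (Pi2 : T2 -> set (R * R)).
Variables (mu : {measure set (R * R) -> \bar R}).
Hypothesis h1 : poisson_point_process P1 S1 mu Pi1.
Hypothesis h2 : poisson_point_process P2 S2 mu Pi2.
Hypothesis mS1 : measurable S1.
Hypothesis mS2 : measurable S2.

(** For a finite mean only the finite values have prescribed probabilities; the
    event that the count is infinite is handled by complement. *)
Lemma single_law (A1 A2 : set (R * R)) k : measurable A1 -> measurable A2 ->
  A1 `<=` S1 -> A2 `<=` S2 -> mu A1 = mu A2 ->
  P1 [set w | ccode (Pi1 w `&` A1) = k] = P2 [set w | ccode (Pi2 w `&` A2) = k].
Proof.
move=> m1 m2 s1 s2 muE.
have [_ _ p1 _] := h1; have [_ _ p2 _] := h2.
have [q1 r1] := p1 _ m1 s1; have [q2 r2] := p2 _ m2 s2.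
have E d (T : measurableType d) (Pi : T -> set (R * R)) A l :
    [set w | ccode (Pi w `&` A) = l] = [set w | Defs.count Pi A w = cval l].
  by apply/seteqP; split => w /= /ccodeP.
have ms1 := fun k => measurable_ccode h1 mS1 k m1.
have ms2 := fun k => measurable_ccode h2 mS2 k m2.
have : (0 <= mu A1)%E by [].
case muA : (mu A1) => [r| |] // _.
  have fin l : P1 [set w | ccode (Pi1 w `&` A1) = l.+1] =
      P2 [set w | ccode (Pi2 w `&` A2) = l.+1].
    by rewrite !E (q1 r muA) (q2 r)// -muE.
  case: k => [|k //].
  have : P1 ((fun w => ccode (Pi1 w `&` A1)) @^-1` [set k | k <> 0%N]) =
      P2 ((fun w => ccode (Pi2 w `&` A2)) @^-1` [set k | k <> 0%N]).
    by apply: nat_law => // -[//|k] _; exact: fin.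
  have C d (T : measurableType d) (Pi : T -> set (R * R)) A :
     (fun w => ccode (Pi w `&` A)) @^-1` [set k | k <> 0%N] =
     ~` [set w | ccode (Pi w `&` A) = 0%N] by [].
  rewrite !C !probability_setC//.
  have f1 : P1 [set w | ccode (Pi1 w `&` A1) = 0%N] \is a fin_num by exact: fin_num_measure.
  have f2 : P2 [set w | ccode (Pi2 w `&` A2) = 0%N] \is a fin_num by exact: fin_num_measure.
  by rewrite -(fineK f1) -(fineK f2) -!EFinB => -[] H; congr EFin; lra.
(* An infinite mean: the count is almost surely infinite. *)
have z d (T : measurableType d) (P : probability T R) (Pi : T -> set (R * R)) A :
    P [set w | Defs.count Pi A w = +oo%E] = 1%E -> forall l,
    measurable [set w | ccode (Pi w `&` A) = 0%N] ->
    measurable [set w | ccode (Pi w `&` A) = l.+1] ->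
    P [set w | ccode (Pi w `&` A) = l.+1] = 0%E.
  move=> P1e l m0 ml.
  have c0 : P (~` [set w | ccode (Pi w `&` A) = 0%N]) = 0%E.
    by rewrite probability_setC// E P1e subee.
  apply/eqP; rewrite eq_le measure_ge0 andbT -c0.
  by apply: le_measure; [exact/mem_set|exact/mem_set/measurableC|move=> w /= ->].
case: k => [|k]; last by rewrite !z ?r1 ?r2// -muE.
by rewrite !E r1// r2// -muE.
Qed.

(** Counts on overlapping sets are functions of the counts on the atoms, which are
    independent with laws determined by the means. *)
Lemma family_law n (A1 A2 : 'I_n -> set (R * R)) (B : 'I_n -> set (\bar R)) :
  (forall i, measurable (A1 i)) -> (forall i, measurable (A2 i)) ->
  (forall i, A1 i `<=` S1) -> (forall i, A2 i `<=` S2) ->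
  (forall j, mu (atom A1 j) = mu (atom A2 j)) ->
  P1 [set w | forall i, B i (counting (Pi1 w `&` A1 i))] =
  P2 [set w | forall i, B i (counting (Pi2 w `&` A2 i))].
Proof.
move=> m1 m2 s1 s2 muE.
have E d (T : measurableType d) (Pi : T -> set (R * R)) (A : 'I_n -> set (R * R)) :
    [set w | forall i, B i (counting (Pi w `&` A i))] =
    (atom_codes A \o Pi) @^-1` atom_event B.
  by apply/seteqP; split => w h; [exact/atom_eventP|exact: (iffRL (atom_eventP _ _ _) h)].
have F d (T : measurableType d) (Pi : T -> set (R * R)) (A : 'I_n -> set (R * R)) v :
    (atom_codes A \o Pi) @^-1` [set v] = [set w | forall j, ccode (Pi w `&` atom A j) = v j].
  by apply/seteqP; split => w h; [exact: (iffLR (atom_codesP _ _ _) h)|exact/atom_codesP].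
have key (v : {ffun 'I_(natoms n) -> nat}) :
    P1 [set w | forall j, ccode (Pi1 w `&` atom A1 j) = v j] =
    P2 [set w | forall j, ccode (Pi2 w `&` atom A2 j) = v j].
  rewrite (disjoint_counts h1 v (fun j => measurable_atom j m1)
    (fun j => atom_sub s1) (trivIset_atom (A := A1))).
  rewrite (disjoint_counts h2 v (fun j => measurable_atom j m2)
    (fun j => atom_sub s2) (trivIset_atom (A := A2))).
  apply: eq_bigr => j _; apply: single_law => //; try exact: measurable_atom.
  - exact: atom_sub.
  - exact: atom_sub.
rewrite !E; apply: countable_law => v; rewrite !F.
- by apply: measurable_forall => j; exact: (measurable_ccode h1 mS1 (v j) (measurable_atom j m1)).
- by apply: measurable_forall => j; exact: (measurable_ccode h2 mS2 (v j) (measurable_atom j m2)).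
- exact: key.
Qed.

End two_processes.
End poisson_laws.

(** * Laws and independence of restricted Poisson processes *)

Section cylinders.
Context {R : realType}.

Definition cyl n (A : 'I_n -> set (R * R)) (B : 'I_n -> set (\bar R)) : set (set (R * R)) :=
  [set N | forall i, B i (counting (N `&` A i))].

(** Events that constrain finitely many counts: a pi-system generating the
    sigma-algebra of configurations. *)
Definition cyls : set (set (set (R * R))) :=
  [set E | exists n (A : 'I_n -> set (R * R)) (B : 'I_n -> set (\bar R)),
    [/\ forall i, measurable (A i), forall i, measurable (B i) & E = cyl A B]].

Lemma cyls_setI : setI_closed cyls.
Proof.
move=> _ _ [n [A [B [mA mB ->]]]] [m [A' [B' [mA' mB' ->]]]].
exists (n + m)%N, (fun i => match fintype.split i with inl j => A j | inr k => A' k end),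
  (fun i => match fintype.split i with inl j => B j | inr k => B' k end); split.
- by move=> i; case: fintype.split.
- by move=> i; case: fintype.split.
apply/seteqP; split=> N /=.
  by move=> [h h'] i; case: fintype.split => j; [exact: h|exact: h'].
move=> h; split=> i.
  by have := h (unsplit (inl i)); rewrite unsplitK.
by have := h (unsplit (inr i)); rewrite unsplitK.
Qed.

Lemma cyls_measurable : (measurable : set (set (@conf R))) = <<s cyls>>.
Proof.
apply/seteqP; split.
  apply: smallest_sub; first exact: smallest_sigma_algebra.
  move=> _ [A mA [B mB ->]]; apply: sub_sigma_algebra.
  exists 1%N, (fun=> A), (fun=> B); split=> //.
  by apply/seteqP; split=> N /= h; [move=> _|exact: (h ord0)].
apply: smallest_sub; first exact: sigma_algebra_measurable.
move=> _ [n [A [B [mA mB ->]]]]; rewrite /cyl.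
apply: (@measurable_forall _ (@conf R)) => i.
by have := measurable_count (mA i) measurableT (mB i); rewrite setTI.
Qed.

Lemma cylsT : cyls setT.
Proof.
exists 0%N, (fun=> setT), (fun=> setT); split => //.
by apply/seteqP; split=> // N _ [].
Qed.

Lemma cyls_unique (m1 m2 : {measure set (@conf R) -> \bar R}) :
  (forall E, cyls E -> m1 E = m2 E) -> (m1 setT < +oo)%E ->
  forall E, measurable E -> m1 E = m2 E.
Proof.
move=> h fin; apply: (@measure_unique _ R (@conf R) cyls (fun=> setT)) => //.
- exact: cyls_measurable.
- exact: cyls_setI.
- by move=> _; exact: cylsT.
- by rewrite bigcup_const.
Qed.

End cylinders.

Lemma measurable_confI (R : realType) d (T : measurableType d) (N : T -> set (R * R))
    (L : set (R * R)) : measurable_fun setT (N : T -> conf) -> measurable L ->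
  measurable_fun setT (fun w => N w `&` L : conf).
Proof.
move=> mN mL; apply: measurable_conf => A mA.
under eq_fun do rewrite -setIA.
exact: (measurableT_comp (measurable_count (measurableI _ _ mL mA)) mN).
Qed.

Section transported_law.
Context {R : realType}.
Context d1 (T1 : measurableType d1) (P1 : probability T1 R) (S1 : set (R * R))
  (Pi1 : T1 -> set (R * R)).
Context d2 (T2 : measurableType d2) (P2 : probability T2 R) (S2 : set (R * R))
  (Pi2 : T2 -> set (R * R)).
Variables (mu : {measure set (R * R) -> \bar R}).
Hypothesis h1 : poisson_point_process P1 S1 mu Pi1.
Hypothesis h2 : poisson_point_process P2 S2 mu Pi2.
Hypothesis mS1 : measurable S1.
Hypothesis mS2 : measurable S2.
Variables (tr : R * R -> R * R) (S' : set (R * R)).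
Hypothesis mtr : measurable_fun setT tr.
Hypothesis tr_inj : injective tr.
Hypothesis mS' : measurable S'.
Hypothesis S'S2 : S' `<=` S2.
Hypothesis trS' : tr @^-1` S' `<=` S1.
Hypothesis trmu : forall A, measurable A -> A `<=` S' -> mu (tr @^-1` A) = mu A.

Lemma counting_image (X A : set (R * R)) :
  counting ((tr @` X `&` S') `&` A) = counting (X `&` tr @^-1` (S' `&` A)) :> \bar R.
Proof.
rewrite !counting_esum (_ : _ `&` _ = tr @` (X `&` tr @^-1` (S' `&` A))).
  by rewrite esum_image// => x y _ _; exact: tr_inj.
apply/seteqP; split=> q.
  by move=> [[[p Xp <-] S'p] Ap]; exists p.
by move=> [p [Xp [S'p Ap]] <-]; split => //; split => //; exists p.
Qed.

Let m' (A : set (R * R)) : measurable A -> measurable (tr @^-1` (S' `&` A)).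
Proof. by move=> mA; rewrite -[X in measurable X]setTI; apply: mtr => //; exact: measurableI. Qed.

Lemma measurable_image : measurable_fun setT (fun w => tr @` Pi1 w `&` S' : @conf R).
Proof.
apply: measurable_conf => A mA.
under eq_fun do rewrite counting_image.
exact: (measurableT_comp (measurable_count (m' mA)) (measurable_ppp h1 mS1)).
Qed.

(** By [cyls_unique] it suffices to compare finitely many counts; those of the image
    are counts of [Pi1] on preimages, which have the same means. *)
Lemma transported_law (E : set conf) : measurable E ->
  P1 [set w | E (tr @` Pi1 w `&` S')] = P2 [set w | E (Pi2 w `&` S')].
Proof.
move: E; pose l1 := image_law P1 measurable_image.
pose l2 := image_law P2 (measurable_confI (measurable_ppp h2 mS2) mS').
suff h : forall E, measurable E -> l1 E = l2 E by move=> E; exact: h.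
apply: cyls_unique; last by apply: (@le_lt_trans _ _ 1%E); [exact: probability_le1|exact: ltry].
move=> _ [n [A [B [mA mB ->]]]].
suff : P1 ((fun w => tr @` Pi1 w `&` S') @^-1` cyl A B) =
    P2 ((fun w => Pi2 w `&` S') @^-1` cyl A B) by [].
have := @family_law _ _ _ P1 S1 Pi1 _ _ P2 S2 Pi2 mu h1 h2 mS1 mS2 n
  (fun i => tr @^-1` (S' `&` A i)) (fun i => S' `&` A i) B.
move=> /(_ (fun i => m' (mA i)) (fun i => measurableI _ _ mS' (mA i))) F.
rewrite (_ : _ @^-1` _ = [set w | forall i, B i (counting (Pi1 w `&` tr @^-1` (S' `&` A i)))]).
  rewrite [RHS](_ : _ = P2 [set w | forall i, B i (counting (Pi2 w `&` (S' `&` A i)))]).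
    apply: F.
    - by move=> i q [/trS'].
    - by move=> i q [/S'S2].
    move=> j; have <- : tr @^-1` atom (fun i => S' `&` A i) j =
       atom (fun i => tr @^-1` (S' `&` A i)) j by [].
    apply: trmu; last by apply: atom_sub => i q [].
    by apply: measurable_atom => i; exact: measurableI.
  by congr (P2 _); apply/seteqP; split => w /= h i; have := h i; rewrite setIA.
by apply/seteqP; split => w /= h i; have := h i; rewrite counting_image.
Qed.

End transported_law.

Section independence.
Context {R : realType}.
Context d (T : measurableType d) (P : probability T R) (S : set (R * R)) (mu : set (R * R) -> \bar R)
  (Pi : T -> set (R * R)).
Hypothesis hPi : poisson_point_process P S mu Pi.
Hypothesis mS : measurable S.
Variable L : set (R * R).
Hypothesis mL : measurable L.

Lemma probability_fin_ge0 (F : set T) (mF : measurable F) : (P F \is a fin_num) * (0 <= fine (P F)).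
Proof. by split; [exact: fin_num_measure|exact: fine_ge0]. Qed.

(** Both sides, as functions of [E], are finite measures, so they agree as soon as they
    agree on a generating pi-system. *)
Lemma indep_conf (N : T -> @conf R) (mN : measurable_fun setT N) (F : set T)
  (mF : measurable F) :
  (forall E, cyls E -> P (N @^-1` E `&` F) = (P (N @^-1` E) * P F)%E) ->
  forall E, measurable E -> P (N @^-1` E `&` F) = (P (N @^-1` E) * P F)%E.
Proof.
move=> h E mE; have [fF F0] := probability_fin_ge0 mF.
pose G := [set N @^-1` E | E in cyls].
have mN' : measurable_fun setT (N : g_sigma_algebraType G -> @conf R).
  apply: (@measurability _ _ _ _ _ _ (cyls : set (set (@conf R)))).
    exact: cyls_measurable.
  by move=> _ [A cA <-]; rewrite setTI; apply: sub_sigma_algebra; exists A.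
have cm A : cyls A -> measurable (A : set (@conf R)).
  by move=> cA; rewrite cyls_measurable; exact: sub_sigma_algebra.
suff : mrestr P mF (N @^-1` E) = mscale (NngNum F0) P (N @^-1` E).
  by rewrite /mrestr /mscale /= fineK// muleC.
apply: (@g_sigma_algebra_measure_unique _ R T G _ (fun=> setT)).
- by move=> _ [A /cm mA <-]; rewrite -[X in measurable X]setTI; exact: mN.
- by move=> _; exists setT => //; exact: cylsT.
- by rewrite bigcup_const.
- move=> _ _ [A cA <-] [B cB <-]; rewrite -preimage_setI.
  by exists (A `&` B) => //; exact: cyls_setI.
- move=> _ [A cA <-]; have := h A cA.
  by rewrite /= /mrestr /mscale /= fineK// muleC.
- by move=> _; rewrite -ge0_fin_numE//; exact: fin_num_measure.
- by have := mN' measurableT E mE; rewrite setTI.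
Qed.

Lemma indep_countable (C : countType) (c : T -> C) (F : set T) (U : set C) :
  measurable F -> (forall k, measurable (c @^-1` [set k])) ->
  (forall k, P (c @^-1` [set k] `&` F) = (P (c @^-1` [set k]) * P F)%E) ->
  P (c @^-1` U `&` F) = (P (c @^-1` U) * P F)%E.
Proof.
move=> mF mc h; have [fF F0] := probability_fin_ge0 mF.
suff : mrestr P mF (c @^-1` U) = mscale (NngNum F0) P (c @^-1` U).
  by rewrite /mrestr /mscale /= fineK// muleC.
apply: countable_law => // k; have := h k.
by rewrite /= /mrestr /mscale /= fineK// muleC.
Qed.

Section two_families.
Variables (n m : nat) (A : 'I_n -> set (R * R)) (C : 'I_m -> set (R * R)).
Hypotheses (mA : forall i, measurable (A i)) (mC : forall i, measurable (C i)).
Hypotheses (AS : forall i, A i `<=` S) (CS : forall i, C i `<=` S).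
Hypotheses (AL : forall i, A i `<=` L) (CL : forall i, C i `<=` ~` L).

Let mcode k (D : 'I_k -> set (R * R)) v : (forall i, measurable (D i)) ->
  measurable ((atom_codes D \o Pi) @^-1` [set v]).
Proof.
move=> mD; rewrite (_ : _ @^-1` _ = [set w | forall j, ccode (Pi w `&` atom D j) = v j]).
  by apply: measurable_forall => j; exact: (measurable_ccode hPi mS (v j) (measurable_atom j mD)).
by apply/seteqP; split => w h; [exact: (iffLR (atom_codesP _ _ _) h)|exact/atom_codesP].
Qed.

(** The atoms of the two families are disjoint from each other because [L]
    separates them, so all their counts are independent together. *)
Lemma indep_codes u v :
  P ((atom_codes A \o Pi) @^-1` [set u] `&` (atom_codes C \o Pi) @^-1` [set v]) =
  (P ((atom_codes A \o Pi) @^-1` [set u]) * P ((atom_codes C \o Pi) @^-1` [set v]))%E.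
Proof.
have E k (D : 'I_k -> set (R * R)) x : (atom_codes D \o Pi) @^-1` [set x] =
    [set w | forall j, ccode (Pi w `&` atom D j) = x j].
  by apply/seteqP; split => w h; [exact: (iffLR (atom_codesP _ _ _) h)|exact/atom_codesP].
pose D (i : 'I_(natoms n + natoms m)) := match fintype.split i with
  inl j => atom A j | inr k => atom C k end.
pose x (i : 'I_(natoms n + natoms m)) := match fintype.split i with
  inl j => u j | inr k => v k end.
have mD i : measurable (D i) by rewrite /D; case: fintype.split => j; exact: measurable_atom.
have DS i : D i `<=` S by rewrite /D; case: fintype.split => j; exact: atom_sub.
have tD : trivIset setT D.
  move=> i j _ _ [q]; rewrite /D.
  rewrite -[i]splitK -[j]splitK !unsplitK.
  case: (fintype.split i) => i'; case: (fintype.split j) => j' [].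
  - by move=> h1 h2; congr (unsplit (inl _)); apply: (@trivIset_atom _ _ A) => //; exists q.
  - by move=> [[k /AL Lq] _] [[l /CL]].
  - by move=> [[k /CL Lq] _] [[l /AL]].
  - by move=> h1 h2; congr (unsplit (inr _)); apply: (@trivIset_atom _ _ C) => //; exists q.
have := disjoint_counts hPi x mD DS tD; rewrite big_split_ord/=.
under eq_bigr do rewrite /D /x (unsplitK (inl _)).
under [X in (_ * X)%E]eq_bigr do rewrite /D /x (unsplitK (inr _)).
rewrite !E (disjoint_counts hPi u (fun j => measurable_atom j mA)
    (fun j => atom_sub AS) (trivIset_atom (A := A))).
rewrite (disjoint_counts hPi v (fun j => measurable_atom j mC)
    (fun j => atom_sub CS) (trivIset_atom (A := C))).
move=> <-; congr (P _); apply/seteqP; split=> w /=.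
  by move=> [h1 h2] i; rewrite /D /x; case: fintype.split.
by move=> h; split=> j; [have := h (unsplit (inl j))|have := h (unsplit (inr j))];
  rewrite /D /x unsplitK.
Qed.

Lemma indep_families (B : 'I_n -> set (\bar R)) (B' : 'I_m -> set (\bar R)) :
  P ([set w | forall i, B i (counting (Pi w `&` A i))] `&`
     [set w | forall i, B' i (counting (Pi w `&` C i))]) =
  (P [set w | forall i, B i (counting (Pi w `&` A i))] *
   P [set w | forall i, B' i (counting (Pi w `&` C i))])%E.
Proof.
have E k (D : 'I_k -> set (R * R)) (B0 : 'I_k -> set (\bar R)) :
    [set w | forall i, B0 i (counting (Pi w `&` D i))] =
    (atom_codes D \o Pi) @^-1` atom_event B0.
  by apply/seteqP; split => w h; [exact/atom_eventP|exact: (iffRL (atom_eventP _ _ _) h)].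
rewrite !E.
have mU k (D : 'I_k -> set (R * R)) U : (forall i, measurable (D i)) ->
    measurable ((atom_codes D \o Pi) @^-1` U).
  move=> mD; rewrite (_ : _ @^-1` U = \bigcup_v
    if pselect (U v) is left _ then (atom_codes D \o Pi) @^-1` [set v] else set0).
    apply: countable_bigcupT_measurable; first exact: countableP.
    by move=> v; case: pselect => // _; exact: mcode.
  apply/seteqP; split=> [w Uw|w [v _]]; last by case: pselect => //= Uv ->.
  by exists (atom_codes D (Pi w)) => //; case: pselect.
apply: indep_countable; [exact: mU|by move=> k; exact: mcode|move=> u].
rewrite setIC [RHS]muleC.
apply: indep_countable; [exact: mcode|by move=> k; exact: mcode|move=> v].
by rewrite setIC [RHS]muleC indep_codes.
Qed.

End two_families.

(** Independence passes from counts on sets inside and outside [L] to all events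
    by two applications of [indep_conf]. *)
Lemma restr_indep (E E' : set conf) : measurable E -> measurable E' ->
  P [set w | E (Pi w `&` L) /\ E' (Pi w `&` ~` L)] =
  (P [set w | E (Pi w `&` L)] * P [set w | E' (Pi w `&` ~` L)])%E.
Proof.
have [sub _ _ _] := hPi.
have mN L' : measurable L' -> measurable_fun setT (fun w => Pi w `&` L' : @conf R).
  by move=> mL'; exact: (measurable_confI (measurable_ppp hPi mS)).
have cylE L' n (A : 'I_n -> set (R * R)) B :
    (fun w => Pi w `&` L') @^-1` cyl A B =
    [set w | forall i, B i (counting (Pi w `&` (S `&` L' `&` A i)))].
  have e w i : Pi w `&` L' `&` A i = Pi w `&` (S `&` L' `&` A i).
    apply/seteqP; split=> q; last by move=> [pq [[_ lq] aq]].
    by move=> [[pq lq] aq]; do !split => //; exact: (proj2 (sub w)).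
  by apply/seteqP; split=> w /= h i; have := h i; rewrite e.
move=> mE mE'; apply: (@indep_conf _ (mN _ mL) _ _ _ E mE).
  by rewrite -[X in measurable X]setTI; exact: mN (measurableC mL) _ _ _.
move=> _ [n [A [B [mA mB ->]]]]; rewrite setIC [RHS]muleC.
apply: (@indep_conf _ (mN _ (measurableC mL)) _ _ _ E' mE').
  rewrite -[X in measurable X]setTI; apply: mN => //.
  by rewrite cyls_measurable; apply: sub_sigma_algebra; exists n, A, B.
move=> _ [m [C [B' [mC mB' ->]]]]; rewrite setIC [RHS]muleC !cylE.
apply: indep_families.
- by move=> i; apply: measurableI => //; exact: measurableI.
- by move=> i; apply: measurableI => //; apply: measurableI => //; exact: measurableC.
- by move=> i q [[]].
- by move=> i q [[]].
- by move=> i q [[]].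
- by move=> i q [[]].
Qed.

End independence.

(** * Measurability of the solution in the configuration *)

Lemma sum_over_mkcond {R : realType} {T : choiceType} (S : set T) (b : T -> bool)
    (f : T -> R) :
  sum_over (S `&` [set q | b q]) f = sum_over S (fun q => if b q then f q else 0).
Proof.
rewrite /sum_over !esum_mkcondr; congr (fine _ - fine _); apply: eq_esum => q _.
  have -> : (q \in [set q | b q]) = b q.
    by apply/idP/idP => [/set_mem//|bq]; exact/mem_set.
  by case: (b q) => //; rewrite maxxx.
have -> : (q \in [set q | b q]) = b q.
  by apply/idP/idP => [/set_mem//|bq]; exact/mem_set.
by case: (b q) => //; rewrite oppr0 maxxx.
Qed.

Section measurable_solution.
Context {R : realType} (J : R -> R * R -> R) (g : R * R -> R).
Hypothesis g0 : forall q, 0 < g q.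
Hypothesis Jg : forall x q, `|J x q| <= g q.
Hypothesis Jlip : forall x x' q, `|J x q - J x' q| <= g q * `|x - x'|.
Hypothesis mg : measurable_fun setT g.
Hypothesis mJ : measurable_fun setT (fun z : R * (R * R) => J z.1 z.2).
Variable a0 : R.

(** The configurations for which the equation is solvable. The others are replaced by
    the empty configuration, so that the solution is defined and measurable
    everywhere. *)
Definition good (N : set (R * R)) : Prop := (\esum_(q in N) (g q)%:E < +oo)%E.

Definition trim (N : conf) : @conf R := if pselect (good N) is left _ then N else set0.

Lemma trim_id N : good N -> trim N = N.
Proof. by rewrite /trim; case: pselect. Qed.

Lemma summable_trim N : summable (trim N) (EFin \o g).
Proof.
apply: summable_lt => [q _|]; first exact: ltW.
by rewrite /trim; case: pselect => //; rewrite esum_set0 ltry.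
Qed.

Lemma good_summable N : good N -> summable N (EFin \o g).
Proof. by move=> gN; have := summable_trim N; rewrite trim_id. Qed.

Lemma measurable_good : measurable (good : set (@conf R)).
Proof.
have mE := @measurable_esum_conf R g mg (fun q => ltW (g0 q)).
have := mE measurableT [set x | (x < +oo)%E].
rewrite setTI; apply; rewrite (_ : [set x | _] = ~` [set +oo%E]).
  exact/measurableC/emeasurable_set1.
by apply/seteqP; split=> x /=; rewrite ltey => /eqP.
Qed.

Lemma measurable_trim : measurable_fun setT trim.
Proof.
apply: measurable_conf => A mA.
rewrite (_ : (fun N => _) = (fun N : conf => if N \in (good : set (@conf R))
    then counting ((N : set _) `&` A) else 0%E)); last first.
  apply/funext => N; rewrite /trim; case: pselect => gN; first by rewrite mem_set.
  by rewrite memNset// set0I counting_esum esum_set0.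
apply: measurable_fun_ifT => //.
  apply: (measurable_fun_bool true) => //; rewrite setTI.
  rewrite (_ : _ @^-1` _ = (good : set (@conf R))); first exact: measurable_good.
  by apply/seteqP; split => N /=; [move=> /eqP /eqP /set_mem|move=> h; rewrite mem_set].
exact: measurable_count.
Qed.

Let L m := [set q : R * R | m.+1%:R^-1 <= g q].

Let mL m : measurable (L m).
Proof.
rewrite -[X in measurable X]setTI (_ : L m = g @^-1` `[m.+1%:R^-1, +oo[%classic).
  by apply: mg => //; exact: measurable_itv.
by apply/seteqP; split => q /=; rewrite in_itv/= andbT.
Qed.

Let Lcover : \bigcup_m L m = setT.
Proof.
apply/seteqP; split => // q _.
have [m _ hm] := near_infty_natSinv_lt (PosNum (g0 q)).
by exists m => //=; apply/ltW/hm => /=.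
Qed.

Let Lfin m N : (counting ((trim N : set _) `&` L m) < +oo :> \bar R)%E.
Proof.
have sN := summable_trim N.
have : (\esum_(q in trim N `&` L m) (m.+1%:R * g q)%:E < +oo)%E.
  have := @summableZ R _ _ g m.+1%:R (sub_summable (@subIsetl _ (trim N) (L m)) sN).
  rewrite /summable; apply: le_lt_trans; apply: le_esum => q _.
  by rewrite lee_fin ler_norm.
apply: le_lt_trans; rewrite counting_esum; apply: le_esum => q [_ Lq].
by rewrite lee_fin -ler_pdivrMl// mulr1.
Qed.

(** Measurability in the pair (configuration, time) is needed for the induction, since
    the next iterate sums the previous one over times that are points of the
    configuration. *)
Lemma measurable_iterate n :
  measurable_fun setT (fun z : conf * R => iterate J a0 (trim z.1) n z.2).
Proof.
elim: n => [|n ih] /=; first exact: measurable_cst.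
apply: measurable_funD; first exact: measurable_cst.
rewrite [X in measurable_fun _ X](_ : _ = (fun z : conf * R =>
    sum_over (trim z.1 : set _) (fun q => if q.1 < z.2
      then J (iterate J a0 (trim z.1) n q.1) q else 0))); last first.
  by apply/funext => z; exact: sum_over_mkcond.
(* On each [L m] the weight is bounded below, so a trimmed configuration has
   finitely many points there. *)
apply: (@measurable_sum_over R _ _ (fun z : conf * R => trim z.1) _ L mL _ Lcover
  (fun z => if z.2.1 < z.1.2 then J (iterate J a0 (trim z.1.1) n z.2.1) z.2 else 0)).
- exact: (measurableT_comp measurable_trim measurable_fst).
- by move=> m x; exact: Lfin.
apply: measurable_fun_ifT => //.
  apply: measurable_fun_ltr.
    exact: (measurableT_comp measurable_fst measurable_snd).
  exact: (measurableT_comp measurable_snd measurable_fst).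
apply: (measurableT_comp mJ
  (g := fun z : (conf * R) * (R * R) => (iterate J a0 (trim z.1.1) n z.2.1, z.2))).
apply: measurable_fun_pair => //=.
apply: (measurableT_comp ih (g := fun z : (conf * R) * (R * R) => (z.1.1, z.2.1))).
apply: measurable_fun_pair => /=.
  exact: (measurableT_comp measurable_fst measurable_fst).
exact: (measurableT_comp measurable_fst measurable_snd).
Qed.

Let g0' q : 0 <= g q. Proof. exact: ltW. Qed.

Lemma measurable_presol :
  measurable_fun setT (fun z : conf * R => presol J a0 (trim z.1) z.2).
Proof.
apply: (measurable_fun_cvg measurable_iterate) => z _.
exact: (@iterate_cvg R J g g0' Jg Jlip a0 _ (summable_trim z.1) z.2).
Qed.

Lemma measurable_sol s :
  measurable_fun setT (fun N : conf => sol J a0 (trim N) s).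
Proof.
apply: measurable_funD; first exact: measurable_cst.
rewrite [X in measurable_fun _ X](_ : _ = (fun N : conf =>
    sum_over (trim N : set _) (fun q => if q.1 <= s
      then J (presol J a0 (trim N) q.1) q else 0))); last first.
  by apply/funext => z; exact: sum_over_mkcond.
apply: (@measurable_sum_over R _ _ trim measurable_trim L mL _ Lcover
  (fun z => if z.2.1 <= s then J (presol J a0 (trim z.1) z.2.1) z.2 else 0)).
- by move=> m x; exact: Lfin.
apply: measurable_fun_ifT => //.
  apply: measurable_fun_ler => //.
  exact: (measurableT_comp measurable_fst measurable_snd).
apply: (measurableT_comp mJ
  (g := fun z : conf * (R * R) => (presol J a0 (trim z.1) z.2.1, z.2))).
apply: measurable_fun_pair => //=.
apply: (measurableT_comp measurable_presol (g := fun z : conf * (R * R) => (z.1, z.2.1))).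
apply: measurable_fun_pair => //=.
exact: (measurableT_comp measurable_fst measurable_snd).
Qed.

Variables (c d : R).
Hypothesis cd : c < d.

Definition sol_path (N : conf) : cadlag c d :=
  Cadlag (is_cadlag_sol Jg a0 (summable_trim N) c d).

Lemma measurable_sol_path : measurable_fun setT (sol_path : conf -> borel (cadlag c d)).
Proof. by apply: (measurable_path cd) => s _; exact: measurable_sol. Qed.

End measurable_solution.

(** * Jump sizes and their dependence on the state *)

Section powers.
Context {R : realType}.
Implicit Types (y s : R).

Lemma powR_exp y s : 0 < y -> y `^ s = expR (s * ln y).
Proof. by move=> y0; rewrite /powR gt_eqF. Qed.

Lemma exp_diff (u v : R) : `|expR u - expR v| <= `|u - v| * expR (Num.max u v).
Proof.
wlog uv : u v / v <= u.
  move=> H; have [/H//|uv] := orP (le_total v u).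
  by rewrite distrC (distrC u) maxC; exact: H.
rewrite (max_idPl uv) !ger0_norm ?subr_ge0 ?ler_expR//.
have : 1 + (v - u) <= expR (v - u) := expR_ge1Dx _.
move/(ler_wpM2r (expR_ge0 u)); rewrite -expRD subrK; lra.
Qed.

Lemma ln_le_powR y (e : R) : 1 <= y -> 0 < e -> ln y <= y `^ e / e.
Proof.
move=> y1 e0; rewrite powR_exp ?(lt_le_trans ltr01)// ler_pdivlMr// mulrC.
by apply: le_trans (expR_ge1Dx _); rewrite lerDr.
Qed.

Lemma spow_norm y s : `|spow y s| <= `|y| `^ s.
Proof.
rewrite /spow normrM normr_sg ger0_norm ?powR_ge0//.
by case: (y != 0); rewrite ?mul1r ?mul0r ?powR_ge0.
Qed.

(** The exponent enters through [exp (s ln |y|)], whence the logarithm. *)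
Lemma spow_diff y s s' : y != 0 -> `|spow y s - spow y s'| <=
  `|s - s'| * `|ln `|y| | * expR (Num.max (s * ln `|y|) (s' * ln `|y|)).
Proof.
move=> y0; rewrite /spow -mulrBr normrM normr_sg y0 mul1r.
rewrite !powR_exp ?normr_gt0//; apply: (le_trans (exp_diff _ _)).
by rewrite -mulrBl normrM.
Qed.

Lemma spow0 s : spow 0 s = 0 :> R.
Proof. by rewrite /spow sgr0 mul0r. Qed.

End powers.

Section jumps.
Context {R : realType} (alpha : R -> R) (a b M : R).
Hypotheses (a0 : 0 < a) (ab : a < b) (b1 : b < 1).
Hypothesis alpha_itv : forall x, a <= alpha x <= b.
Hypothesis M0 : 0 <= M.
Hypothesis alpha_lip : forall x y, `|alpha x - alpha y| <= M * `|x - y|.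

Definition jump (x : R) (q : R * R) : R := spow q.2 (- (alpha x)^-1).

Let alpha0 x : 0 < alpha x.
Proof. by apply: lt_le_trans a0 _; case/andP: (alpha_itv x). Qed.

Let b0 : 0 < b. Proof. exact: lt_trans ab. Qed.

Lemma inv_alpha x : b^-1 <= (alpha x)^-1 <= a^-1.
Proof. by case/andP: (alpha_itv x) => h1 h2; rewrite !lef_pV2 ?posrE// h1 h2. Qed.

Lemma inv_alpha_lip x y : `|(alpha x)^-1 - (alpha y)^-1| <= M / a ^+ 2 * `|x - y|.
Proof.
have ax := alpha0 x; have ay := alpha0 y.
have -> : (alpha x)^-1 - (alpha y)^-1 = (alpha y - alpha x) * ((alpha x)^-1 * (alpha y)^-1).
  rewrite mulrBl mulrCA mulfV ?gt_eqF// mulr1 mulrA mulfV ?gt_eqF// mul1r //.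
rewrite normrM distrC.
have /andP[_ x2] := inv_alpha x; have /andP[_ y2] := inv_alpha y.
rewrite [X in _ * X]ger0_norm; last by rewrite mulr_ge0// invr_ge0 ltW.
have h : (alpha x)^-1 * (alpha y)^-1 <= (a ^+ 2)^-1.
  by rewrite -exprVn expr2 ler_pM// invr_ge0 ltW.
rewrite mulrAC; apply: ler_pM => //.
by rewrite mulr_ge0// invr_ge0 ltW.
Qed.

(** The exponent of the tail of the jump sizes: any [p] with [1 < p < 1 / b]
    makes the sums converge and leaves room for a logarithm. *)
Definition tail_exp : R := (1 + b^-1) / 2.

Lemma tail_exp_gt1 : 1 < tail_exp.
Proof. have : 1 < b^-1 by rewrite invf_gt1. rewrite /tail_exp; lra. Qed.

Lemma tail_exp_lt : tail_exp < b^-1.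
Proof. have : 1 < b^-1 by rewrite invf_gt1. rewrite /tail_exp; lra. Qed.

Definition weight_const : R := 1 + M / a ^+ 2 * (1 + (b^-1 - tail_exp)^-1).

(** A bound, valid for all states, on both the size and the Lipschitz constant of the
    jump at [q]. For [|y| <= 1] the logarithm is dominated by one more power
    of [1 / |y|]; it need not be summable against the area, since only
    finitely many such points occur. *)
Definition weight (q : R * R) : R := weight_const *
  (if `|q.2| <= 1 then 1 + `|q.2| `^ (- (a^-1 + 1)) else `|q.2| `^ (- tail_exp)).

Let theta0 : 0 < b^-1 - tail_exp. Proof. by rewrite subr_gt0 tail_exp_lt. Qed.

Let Ma0 : 0 <= M / a ^+ 2. Proof. by rewrite divr_ge0// exprn_ge0// ltW. Qed.

Lemma weight_const_ge1 : 1 <= weight_const.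
Proof. by rewrite lerDl mulr_ge0// addr_ge0// invr_ge0 ltW. Qed.

Lemma weight_gt0 q : 0 < weight q.
Proof.
rewrite mulr_gt0 ?(lt_le_trans ltr01 weight_const_ge1)//.
case: ifPn => [_|]; first by rewrite ltr_pwDl// powR_ge0.
by rewrite -ltNge => /(lt_trans ltr01) y0; rewrite powR_gt0.
Qed.

Lemma jump_weight x q : `|jump x q| <= weight q.
Proof.
rewrite /jump /weight; set y := q.2.
have [y0|y0] := eqVneq y 0.
  by have := ltW (weight_gt0 q); rewrite /weight -/y y0 spow0 normr0.
have ny : 0 < `|y| by rewrite normr_gt0.
apply: (le_trans (spow_norm _ _)).
have /andP[h1 h2] := inv_alpha x; have th := theta0.
case: ifPn => [y1|]; last rewrite -ltNge => y1.
  apply: (@le_trans _ _ (1 + `|y| `^ (- (a^-1 + 1)))); last first.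
    by rewrite ler_peMl ?weight_const_ge1// addr_ge0// powR_ge0.
  apply: (@le_trans _ _ (`|y| `^ (- (a^-1 + 1)))); last by rewrite lerDr.
  rewrite !powR_exp// ler_expR; have : ln `|y| <= 0 by exact: ln_le0.
  by move=> l0; apply: ler_wnM2r => //; rewrite lerN2; lra.
apply: (@le_trans _ _ (`|y| `^ (- tail_exp))); last first.
  by rewrite ler_peMl ?weight_const_ge1// powR_ge0.
rewrite !powR_exp// ler_expR; have l0 : 0 <= ln `|y| by exact/ln_ge0/ltW.
by apply: ler_wpM2r => //; lra.
Qed.

Lemma jump_lip x x' q : `|jump x q - jump x' q| <= weight q * `|x - x'|.
Proof.
rewrite /jump /weight; set y := q.2.
have [y0|y0] := eqVneq y 0.
  by have := ltW (weight_gt0 q); rewrite /weight -/y y0 !spow0 subrr normr0 => ?;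
     rewrite mulr_ge0.
have ny : 0 < `|y| by rewrite normr_gt0.
apply: (le_trans (spow_diff _ _ y0)).
rewrite (_ : - (alpha x)^-1 - - (alpha x')^-1 = (alpha x')^-1 - (alpha x)^-1); last first.
  by rewrite opprK addrC.
have hD : `|(alpha x')^-1 - (alpha x)^-1| <= M / a ^+ 2 * `|x - x'|.
  by rewrite distrC; exact: inv_alpha_lip.
have /andP[h1 h2] := inv_alpha x; have /andP[h1' h2'] := inv_alpha x'.
have th := theta0.
have ti0 : 0 <= (b^-1 - tail_exp)^-1 by rewrite invr_ge0 ltW.
have key (E : R) : 0 <= E -> `|ln `|y| | *
    expR (Num.max (- (alpha x)^-1 * ln `|y|) (- (alpha x')^-1 * ln `|y|)) <=
    (1 + (b^-1 - tail_exp)^-1) * E ->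
  `|(alpha x')^-1 - (alpha x)^-1| * `|ln `|y| | *
  expR (Num.max (- (alpha x)^-1 * ln `|y|) (- (alpha x')^-1 * ln `|y|)) <=
  weight_const * E * `|x - x'|.
  move=> E0 h; rewrite -mulrA; apply: (le_trans (ler_pM _ _ hD h)) => //.
  rewrite /weight_const; set c := M / _; set ti := _^-1; set D := `|x - x'|.
  have ED : 0 <= E * D by rewrite mulr_ge0 ?normr_ge0.
  lra.
case: ifPn => [y1|]; last rewrite -ltNge => y1.
  apply: key; first by rewrite addr_ge0// powR_ge0.
  apply: (@le_trans _ _ (`|y| `^ (- (a^-1 + 1)))); last first.
    apply: (@le_trans _ _ (1 + `|y| `^ (- (a^-1 + 1)))); first by rewrite lerDr.
    by rewrite ler_peMl ?lerDl// addr_ge0// powR_ge0.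
  have l0 : ln `|y| <= 0 by exact: ln_le0.
  rewrite powR_exp// opprD mulrDl expRD [leRHS]mulrC; apply: ler_pM => //.
  - by rewrite ler0_norm// mulN1r; apply: le_trans (expR_ge1Dx _); rewrite lerDr.
  - by rewrite ler_expR ge_max; apply/andP; split; apply: ler_wnM2r => //; lra.
have l0 : 0 <= ln `|y| by exact/ln_ge0/ltW.
apply: key; first exact: powR_ge0.
apply: (@le_trans _ _ ((`|y| `^ (b^-1 - tail_exp) / (b^-1 - tail_exp)) *
    `|y| `^ (- b^-1))).
  apply: ler_pM => //.
    by rewrite ger0_norm//; apply: ln_le_powR => //; exact: ltW.
  rewrite powR_exp// ler_expR ge_max; apply/andP; split; apply: ler_wpM2r => //; lra.
rewrite mulrAC -powRD; last by apply/implyP => _; rewrite gt_eqF.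
rewrite (_ : b^-1 - tail_exp - b^-1 = - tail_exp); last by lra.
by rewrite mulrC ler_wpM2r ?powR_ge0// lerDr.
Qed.

Lemma measurable_weight : measurable_fun setT weight.
Proof.
apply: measurable_funM; first exact: measurable_cst.
have mn : measurable_fun setT (fun q : R * R => `|q.2|).
  by apply: measurableT_comp => //; exact: measurableT_comp.
have mp (s : R) : measurable_fun setT (fun q : R * R => `|q.2| `^ s).
  exact: (measurableT_comp (measurable_powR s) mn).
apply: measurable_fun_ifT => //; first exact: measurable_fun_ler.
by apply: measurable_funD.
Qed.

Lemma measurable_exponent : measurable_fun setT (fun x => - (alpha x)^-1).
Proof.
apply: continuous_measurable_fun.
have K0 : 0 < M / a ^+ 2 + 1 by rewrite ltr_wpDl.
apply: (lip_continuous K0) => x y.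
rewrite (_ : - (alpha x)^-1 - - (alpha y)^-1 = (alpha y)^-1 - (alpha x)^-1); last first.
  by rewrite opprK addrC.
rewrite distrC; apply: le_trans (inv_alpha_lip _ _) _.
by rewrite ler_wpM2r// lerDl.
Qed.

Lemma measurable_jump : measurable_fun setT (fun z : R * (R * R) => jump z.1 z.2).
Proof.
have my : measurable_fun setT (fun z : R * (R * R) => z.2.2).
  by apply: measurableT_comp => //; exact: measurableT_comp.
have mn : measurable_fun setT (fun z : R * (R * R) => `|z.2.2|).
  by apply: measurableT_comp.
have mpow : measurable_fun setT (fun z : R * (R * R) =>
    expR (- (alpha z.1)^-1 * ln `|z.2.2|)).
  apply: measurableT_comp => //; apply: measurable_funM.
    exact: (measurableT_comp measurable_exponent measurable_fst).
  exact: (measurableT_comp (@measurable_ln R) mn).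
rewrite (_ : (fun z => _) = fun z : R * (R * R) => if 0 < z.2.2 then
    expR (- (alpha z.1)^-1 * ln `|z.2.2|) else if z.2.2 < 0 then
    - expR (- (alpha z.1)^-1 * ln `|z.2.2|) else 0).
  apply: measurable_fun_ifT => //; first exact: measurable_fun_ltr.
  apply: measurable_fun_ifT => //; first exact: measurable_fun_ltr.
  exact: measurableT_comp.
apply/funext => z; rewrite /jump /spow; case: (ltrgtP 0 z.2.2) => y0.
- by rewrite gtr0_sg// mul1r powR_exp// normr_gt0 gt_eqF.
- by rewrite ltr0_sg// mulN1r powR_exp// normr_gt0 lt_eqF.
- by rewrite -y0 sgr0 mul0r.
Qed.

End jumps.

(** * Means of sums over Poisson points *)

Section poisson_mean.
Context {R : realType}.

Lemma poisson_pmf_sum (r : R) n : 0 < r ->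
  \sum_(0 <= k < n) poisson_pmf r k <= 1.
Proof.
move=> r0; rewrite -lee_fin -sumEFin.
have h k : (0 <= (poisson_pmf r k)%:E)%E by rewrite lee_fin poisson_pmf_ge0.
have <- : poisson_prob r 0 setT = 1%E by exact: probability_setT.
rewrite /poisson_prob r0 -nneseries_esumT//.
by apply: nneseries_lim_ge => k _.
Qed.

Lemma poisson_pmfS (r : R) k : 0 < r ->
  k.+1%:R * poisson_pmf r k.+1 = r * poisson_pmf r k.
Proof.
move=> r0; rewrite /poisson_pmf r0 factS natrM invfM exprS.
have k0 : (k.+1%:R : R) * k.+1%:R^-1 = 1 by rewrite mulfV// pnatr_eq0.
move: k0; move: (k.+1%:R : R) (k.+1%:R^-1 : R) (k`!%:R^-1 : R) => u v f uv.
transitivity (u * v * (r * (r ^+ k * f * expR (- r)))); last by rewrite uv mul1r.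
lra.
Qed.

(** [k p (k)] is [r p (k - 1)] for the Poisson weights [p], so the truncated mean
    is [r] times a truncated total mass. *)
Lemma poisson_mean_le (r : R) n : 0 < r ->
  \sum_(0 <= k < n) k%:R * poisson_pmf r k <= r.
Proof.
move=> r0; case: n => [|n]; first by rewrite big_geq// ltW.
rewrite big_nat_recl// mul0r add0r.
under eq_bigr do rewrite poisson_pmfS//.
by rewrite -mulr_sumr; apply: ler_piMr; [exact: ltW|exact: poisson_pmf_sum].
Qed.

Section counts.
Context d (T : measurableType d) (P : probability T R) (S : set (R * R))
  (mu : set (R * R) -> \bar R) (Pi : T -> set (R * R)).
Hypothesis hPi : poisson_point_process P S mu Pi.
Hypothesis mS : measurable S.

Lemma measurable_counting (A : set (R * R)) : measurable A ->
  measurable_fun setT (fun w => counting (Pi w `&` A) : \bar R).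
Proof.
by move=> mA; exact: (measurableT_comp (measurable_count mA) (measurable_ppp hPi mS)).
Qed.

(** The probabilities of the finite values are prescribed; that an infinite
    count has probability zero follows as these already sum to one. *)
Lemma mean_count (A : set (R * R)) (r : R) : 0 <= r -> measurable A -> A `<=` S ->
  mu A = r%:E -> (\int[P]_w counting (Pi w `&` A) <= r%:E)%E.
Proof.
move=> r0 mA AS muA; have [_ _ law _] := hPi; have [q _] := law A mA AS.
have {}q := q r muA.
pose F k := [set w | ccode (Pi w `&` A) = k].
have mF k : measurable (F k) by exact: (measurable_ccode hPi mS).
have tF : trivIset setT F by move=> i j _ _ [w [/= <- <-]].
have FT : setT = \bigcup_k F k.
  by apply/seteqP; split => w // _; exists (ccode (Pi w `&` A)).
have FE k : P (F k.+1) = poisson_prob r 0 [set k].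
  rewrite -(q k); congr (P _); apply/seteqP; split => w /= h.
    exact/(iffLR (ccodeP _ k.+1) h).
  exact/(iffRL (ccodeP _ k.+1) h).
have F0 : P (F 0%N) = 0%E.
  have : P ((fun w => ccode (Pi w `&` A)) @^-1` [set k | k <> 0%N]) =
      poisson_prob r 0 (succn @^-1` [set k | k <> 0%N]).
    apply: nat_law => // k k0; case: k k0 => // k _; apply: etrans (FE k) _.
    rewrite (_ : succn @^-1` [set k.+1] = [set k])//.
    by apply/seteqP; split => l /= => [[]|->].
  have -> : succn @^-1` [set k | k <> 0%N] = setT by apply/seteqP; split.
  rewrite probability_setT.
  have -> : (fun w => ccode (Pi w `&` A)) @^-1` [set k | k <> 0%N] = ~` F 0%N by [].
  rewrite probability_setC//.
  have fF : P (F 0%N) \is a fin_num by exact: fin_num_measure.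
  by rewrite -(fineK fF) -EFinB => -[] h; congr EFin; lra.
rewrite FT ge0_integral_bigcup//; last by rewrite -FT; exact: measurable_counting.
have E k : (\int[P]_(x in F k) counting (Pi x `&` A) = cval k * P (F k))%E.
  rewrite -integral_cst//; apply: eq_integral => w /set_mem Fw.
  by rewrite counting_ccode Fw.
under eq_eseriesr do rewrite E.
apply: lime_le.
  apply: is_cvg_nneseries => k _ _; rewrite mule_ge0//; case: k => [|k] /=.
    exact: leey.
  by rewrite lee_fin.
apply: nearW => -[|n]; first by rewrite big_geq// lee_fin.
rewrite big_nat_recl//= F0 mule0 add0e.
under eq_bigr do rewrite FE.
move: r0; rewrite le_eqVlt => /predU1P[<-|r0].
  rewrite big1_seq// => k _; rewrite /poisson_prob ltxx /dirac indicE.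
  by case: k => [|k]; [rewrite mul0e|rewrite memNset ?mule0].
have E' k : (k%:R%:E * poisson_prob r 0 [set k] = (k%:R * poisson_pmf r k)%:E)%E.
  by rewrite /poisson_prob r0 esum_set1 ?lee_fin ?poisson_pmf_ge0.
under eq_bigr do rewrite E'.
by rewrite sumEFin lee_fin poisson_mean_le.
Qed.

End counts.

Section tails.
Context d (T : measurableType d) (P : probability T R) (S : set (R * R))
  (Pi : T -> set (R * R)).
Hypothesis hPi : poisson_point_process P S (lebesgue_measure \x lebesgue_measure)%E Pi.
Hypothesis mS : measurable S.

Lemma mu_rectangle (s h rho : R) : 0 <= h -> 0 <= rho ->
  (lebesgue_measure \x lebesgue_measure)%E (`]s, (s + h)[ `*` `[- rho, rho]) =
   (2 * h * rho)%:E.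
Proof.
move=> h0 r0; rewrite product_measure1E//= !lebesgue_measure_itv/= !lte_fin ltrDl.
move: h0; rewrite le_eqVlt => /predU1P[<-|->]; first by rewrite ltxx mul0e mulr0 mul0r.
have [->|rn] := eqVneq rho 0; first by rewrite oppr0 ltxx mule0 mulr0.
have r1 : 0 < rho by rewrite lt_neqAle eq_sym rn.
rewrite ifT; last by lra.
by rewrite -!EFinD -EFinM; congr EFin; lra.
Qed.

Definition strip (s h : R) (Y : set R) : set (R * R) := `]s, (s + h)[ `*` Y.

Lemma measurable_strip s h Y : measurable Y -> measurable (strip s h Y).
Proof. by move=> mY; apply: measurableX => //; exact: measurable_itv. Qed.

Lemma measurable_gt_norm (rho : R) : measurable [set y : R | rho < `|y|].
Proof.
rewrite -[X in measurable X]setTI (_ : [set y | _] = (fun y : R => `|y|) @^-1` `]rho, +oo[%classic).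
  have mn : measurable_fun setT (fun y : R => `|y|) by exact: measurableT_comp.
  by apply: mn => //; exact: measurable_itv.
by apply/seteqP; split => y /=; rewrite in_itv/= andbT.
Qed.

Definition tail_sum (p s h rho : R) (w : T) : \bar R :=
  \esum_(q in Pi w `&` strip s h [set y | rho < `|y|]) (`|q.2| `^ (- p))%:E.

Lemma measurable_power (p : R) : measurable_fun setT (fun q : R * R => `|q.2| `^ p).
Proof.
apply: (measurableT_comp (measurable_powR p)).
by apply: measurableT_comp => //; exact: measurableT_comp.
Qed.

Lemma measurable_tail_sum p s h rho : measurable_fun setT (tail_sum p s h rho).
Proof.
have mN := measurable_confI (measurable_ppp hPi mS)
  (measurable_strip s h (measurable_gt_norm rho)).
have := measurableT_comp (@measurable_esum_conf R (fun q => `|q.2| `^ (- p))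
  (measurable_power _) (fun q => powR_ge0 _ _)) mN.
exact.
Qed.

Lemma geometric_sum_le (x : R) n : 0 <= x < 1 ->
  \sum_(0 <= k < n) x ^+ k <= (1 - x)^-1.
Proof.
move=> /andP[x0 x1].
have -> : \sum_(0 <= k < n) x ^+ k = (1 - x ^+ n) / (1 - x).
  have := geometric_seriesE (1 : R) (negbT (lt_eqF x1)).
  move=> /(congr1 (fun u => u n)) /=; rewrite mul1r => <-.
  by rewrite /series /=; apply: eq_bigr => k _; rewrite /geometric /= mul1r.
by rewrite ler_pdivrMr ?subr_gt0// mulVf ?gt_eqF ?subr_gt0// gerBl exprn_ge0.
Qed.

(** The bands [2^k rho < |y| <= 2^(k+1) rho] have mass of order [2^k rho]
    while the summand is at most [(2^k rho)^(-p)] there. *)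
Lemma tail_mean (p : R) : 1 < p -> exists2 C, 0 <= C &
  forall s h rho, 0 <= h -> 0 < rho -> `]s, (s + h)[ `*` setT `<=` S ->
    (\int[P]_w tail_sum p s h rho w <= (C * h * rho `^ (1 - p))%:E)%E.
Proof.
move=> p1; pose x : R := 2 `^ (1 - p).
have x01 : 0 <= x < 1.
  rewrite powR_ge0/= /x powR_exp// -[ltRHS]expR0 ltr_expR.
  have l2 : 0 < ln (2 : R) by apply: ln_gt0; rewrite ltr1n.
  by move: l2; move: (ln 2) => l l0; nra.
exists (4 * (1 - x)^-1); first by rewrite mulr_ge0// invr_ge0 subr_ge0; case/andP: x01 => _ /ltW.
move=> s h rho h0 r0 sub.
pose A k := strip s h [set y | 2 ^+ k * rho < `|y| /\ `|y| <= 2 ^+ k.+1 * rho].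
have mA k : measurable (A k).
  apply: measurable_strip.
  rewrite (_ : [set y | _] = [set y : R | 2 ^+ k * rho < `|y|] `&`
      ~` [set y | 2 ^+ k.+1 * rho < `|y|]).
    by apply: measurableI; [|apply: measurableC]; exact: measurable_gt_norm.
  by apply/seteqP; split => y /= [y1 y2]; split => //;
    [apply/negP; rewrite -leNgt|rewrite leNgt; apply/negP].
have p2 k : 0 < (2 : R) ^+ k by rewrite exprn_gt0.
have tA : trivIset setT A.
  have key i j : (i < j)%N -> A i `&` A j = set0.
    move=> ij; rewrite -subset0 => q [[_ [_ q2]] [_ [q3 _]]].
    have : (2 : R) ^+ i.+1 * rho <= 2 ^+ j * rho.
      by rewrite ler_pM2r// ler_eXn2l// ltr1n.
    by move: q2 q3; lra.
  move=> i j _ _ [q Aq]; have [ij|ji|//] := ltngtP i j.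
    by move: Aq; rewrite key.
  by move: Aq; rewrite setIC key.
have UA : strip s h [set y | rho < `|y|] = \bigcup_k A k.
  apply/seteqP; split => q; last first.
    move=> [k _ [q1 [q2 _]]]; split => //=; apply: le_lt_trans q2.
    by rewrite ler_peMl ?(ltW r0)// exprn_ege1// ler1n.
  move=> [q1 /= q2].
  have [n hn] : exists n, `|q.2| <= 2 ^+ n * rho.
    exists (Num.truncn (`|q.2| / rho)).+1; rewrite -ler_pdivrMr//.
    apply: (le_trans (ltW (truncnS_gt _))).
    by rewrite -natrX ler_nat; apply: ltnW; exact: ltn_expl.
  have ex : exists n, (`|q.2| <= 2 ^+ n * rho) by exists n.
  case: (ex_minnP ex) => -[|m] hm min.
    by move: hm; rewrite expr0 mul1r leNgt q2.
  exists m => //; split => //=; split => //.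
  by rewrite ltNge; apply/negP => /min; rewrite ltnn.
(* The supremum of [|y| ^ - p] over the band [A k]. *)
pose c k : R := (2 ^+ k * rho) `^ (- p).
have le1 w : (tail_sum p s h rho w <=
    \sum_(0 <= k <oo) (c k)%:E * counting (Pi w `&` A k))%E.
  rewrite /tail_sum UA setI_bigcupr nneseries_sum_bigcup; last 2 first.
  - exact: trivIset_setIl.
  - by move=> q; rewrite lee_fin powR_ge0.
  apply: lee_nneseries => [k _ _|k _].
    by apply: esum_ge0 => q _; rewrite lee_fin powR_ge0.
  rewrite -esum_fine_scale ?powR_ge0//; apply: le_esum => q [_ [_ [q2 _]]].
  have c0 : 0 < 2 ^+ k * rho by rewrite mulr_gt0.
  rewrite lee_fin /c !powR_exp// ?(lt_trans c0)// ler_expR !mulNr lerN2.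
  rewrite ler_pM2l ?(lt_trans ltr01)// ler_ln ?posrE// ?(lt_trans c0)//.
  exact: ltW.
apply: (@le_trans _ _ (\int[P]_w \sum_(0 <= k <oo) (c k)%:E * counting (Pi w `&` A k))%E).
  apply: ge0_le_integral => //.
  - by move=> w _; apply: esum_ge0 => q _; rewrite lee_fin powR_ge0.
  - exact: measurable_tail_sum.
  - apply: ge0_emeasurable_sum => [k w _ _|k _].
      by rewrite mule_ge0 ?lee_fin ?powR_ge0 ?counting_ge0.
    by apply: measurable_funeM; exact: (measurable_counting hPi mS (mA k)).
rewrite integral_nneseries//; last 2 first.
- by move=> k; apply: measurable_funeM; exact: (measurable_counting hPi mS (mA k)).
- by move=> k w _; rewrite mule_ge0 ?lee_fin ?powR_ge0 ?counting_ge0.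
have le2 k : (\int[P]_w ((c k)%:E * counting (Pi w `&` A k)) <=
    (4 * h * rho `^ (1 - p) * x ^+ k)%:E)%E.
  rewrite (ge0_integralZl _ measurableT (measurable_counting hPi mS (mA k)))//; last first.
    by rewrite lee_fin powR_ge0.
  have r2 : 0 <= 2 ^+ k.+1 * rho by rewrite mulr_ge0 ?ltW.
  pose B := strip s h `[- (2 ^+ k.+1 * rho), 2 ^+ k.+1 * rho].
  have mB : measurable B by apply: measurable_strip; exact: measurable_itv.
  have BS : B `<=` S by move=> q [q1 _]; apply: sub.
  have le3 := mean_count hPi mS (mulr_ge0 (mulr_ge0 (ler0n _ 2) h0) r2) mB BS
    (mu_rectangle s h0 r2).
  have le4 : (\int[P]_w counting (Pi w `&` A k) <= (2 * h * (2 ^+ k.+1 * rho))%:E)%E.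
    apply: le_trans le3; apply: ge0_le_integral => //.
    - exact: (measurable_counting hPi mS (mA k)).
    - exact: (measurable_counting hPi mS mB).
    move=> w _; rewrite !counting_esum; apply: esum_subset => // q [Pq [q1 [_ q2]]].
    by split => //; split => //=; rewrite in_itv/= -ler_norml.
  apply: (le_trans (lee_wpmul2l _ le4)); first by rewrite lee_fin powR_ge0.
  rewrite -EFinM lee_fin /c powRM ?(ltW r0) ?(ltW (p2 k))//.
  have -> : rho `^ (1 - p) = rho * rho `^ (- p).
    by rewrite powRD ?powRr1 ?(ltW r0)//; apply/implyP => _; rewrite gt_eqF.
  have -> : x ^+ k = 2 ^+ k * (2 ^+ k) `^ (- p).
    rewrite /x -powR_mulrn ?powR_ge0// -powRrM mulrC powRrM powR_mulrn//.
    by rewrite powRD ?powRr1 ?ltW//; apply/implyP => _; rewrite gt_eqF.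
  by rewrite exprS; lra.
apply: lime_le.
  apply: is_cvg_nneseries => k _ _; apply: integral_ge0 => w _.
  by rewrite mule_ge0 ?lee_fin ?powR_ge0 ?counting_ge0.
apply: nearW => n.
apply: (@le_trans _ _ (\sum_(0 <= k < n) (4 * h * rho `^ (1 - p) * x ^+ k)%:E)%E).
  by apply: lee_sum => k _; exact: le2.
rewrite sumEFin lee_fin -mulr_sumr.
have K0 : 0 <= 4 * h * rho `^ (1 - p) by rewrite !mulr_ge0 ?powR_ge0.
by have := ler_wpM2l K0 (geometric_sum_le n x01); lra.
Qed.

End tails.
End poisson_mean.

(** * Weak convergence from closeness in probability *)

Section integrals_off_null_sets.
Context {R : realType} d (T : measurableType d) (mu : {measure set T -> \bar R}).
Variables (N : set T).
Hypotheses (mN : measurable N) (N0 : mu N = 0%E).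

Import HBNNSimple.

(** The integral of a nonnegative function is a supremum over the simple
    functions below it, whether or not it is measurable; those may be set to
    [0] on a null set. *)
Let sup_le (f g : T -> \bar R) : (forall x, 0 <= g x)%E ->
  (forall x, ~ N x -> (f x <= g x)%E) ->
  (ereal_sup [set sintegral mu h | h in [set h : {nnsfun T >-> R} |
     forall x, ((h x)%:E <= f x)%E]] <=
   ereal_sup [set sintegral mu h | h in [set h : {nnsfun T >-> R} |
     forall x, ((h x)%:E <= g x)%E]])%E.
Proof.
move=> g0 fg; apply: ge_ereal_sup => _ [h hf <-].
pose h' := mul_nnsfun h (indic_nnsfun R (measurableC mN)).
have -> : sintegral mu h = sintegral mu h'.
  rewrite -!integralT_nnsfun; apply: ge0_ae_eq_integral => //.
  - exact/measurable_EFinP.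
  - exact/measurable_EFinP.
  - by move=> x _; rewrite lee_fin.
  - by move=> x _; rewrite lee_fin.
  exists N; split => // x /= /not_implyP[_ ne]; apply: contrapT => Nx; apply: ne.
  congr EFin; apply: etrans (_ : h x * \1_(~` N) x = _); last by [].
  by rewrite indicE mem_set ?mulr1.
apply: ereal_sup_ubound; exists h' => // x.
suff : ((h x * \1_(~` N) x)%:E <= g x)%E by [].
have [Nx|Nx] := pselect (N x).
  by rewrite indicE memNset ?mulr0//=; apply.
by rewrite indicE mem_set ?mulr1//; apply: le_trans (fg x Nx).
Qed.

Lemma integral_off_null (D : set T) (f g : T -> \bar R) :
  (forall x, ~ N x -> f x = g x) ->
  (\int[mu]_(x in D) f x = \int[mu]_(x in D) g x)%E.
Proof.
move=> fg; rewrite /integral.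
have E x : ~ N x -> (f \_ D) x = (g \_ D) x by move=> Nx; rewrite !patchE fg.
congr (_ - _)%E; apply/eqP; rewrite eq_le; apply/andP; split; apply: sup_le => // x Nx;
  by rewrite ?funeposE ?funenegE E.
Qed.

End integrals_off_null_sets.

Section bounded_expectations.
Context {R : realType} d (T : measurableType d) (P : probability T R).
Implicit Types (f g : T -> R).

Lemma bounded_integrable f (M : R) : measurable_fun setT f ->
  (forall x, `|f x| <= M) -> P.-integrable setT (EFin \o f).
Proof.
move=> mf fM; apply: measurable_bounded_integrable => //.
  by apply: (@le_lt_trans _ _ 1%E); [exact: probability_le1|exact: ltry].
exists M; split; first exact: num_real.
by move=> x Mx y _; apply: le_trans (fM y) (ltW Mx).
Qed.

Lemma expectation_Rintegral f (M : R) : measurable_fun setT f ->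
  (forall x, `|f x| <= M) -> 'E_P[f]%E = (\int[P]_x f x)%:E.
Proof.
move=> mf fM; rewrite unlock /Rintegral fineK//.
by apply: integrable_fin_num => //; exact: (bounded_integrable mf fM).
Qed.

End bounded_expectations.

Section inf_convolution.
Context {R : realType} {S : pseudoPMetricType R} (phi : S -> R) (M : R).
Hypothesis phiM : forall x, `|phi x| <= M.

(** A Lipschitz approximation of [phi] from below, obtained by inf-convolution with
    [k] times the distance. The distance is expressed by the radius [e] of a ball,
    as the space carries only a family of balls. *)
Definition inf_conv (k : nat) (x : S) : R :=
  inf [set v | exists y e, [/\ 0 < e, ball x e y & v = phi y + k%:R * e]].

Let lb k x : lbound [set v | exists y e, [/\ 0 < e, ball x e y & v = phi y + k%:R * e]] (- M).
Proof.
move=> _ [y [e [e0 _ ->]]]; have := phiM y; rewrite ler_norml => /andP[h _].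
by rewrite -[- M]addr0 lerD// mulr_ge0// ltW.
Qed.

Let hlb k x : has_lbound [set v | exists y e, [/\ 0 < e, ball x e y & v = phi y + k%:R * e]].
Proof. by exists (- M); exact: lb. Qed.

Let ne k x : [set v | exists y e, [/\ 0 < e, ball x e y & v = phi y + k%:R * e]] !=set0.
Proof. by exists (phi x + k%:R * 1), x, 1; split => //; exact: ballxx. Qed.

Lemma inf_conv_le k x : inf_conv k x <= phi x.
Proof.
apply/ler_addgt0Pr => e e0.
have e1 : 0 < e / k.+1%:R by rewrite divr_gt0.
apply: (@le_trans _ _ (phi x + k%:R * (e / k.+1%:R))).
  by apply: ge_inf => //; exists x, (e / k.+1%:R); split => //; exact: ballxx.
by rewrite lerD2l mulrCA ler_piMr ?(ltW e0)// ler_pdivrMr// mul1r ler_nat.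
Qed.

Lemma inf_conv_norm k x : `|inf_conv k x| <= M.
Proof.
rewrite ler_norml (le_trans (inf_conv_le k x)) ?andbT; last first.
  exact: le_trans (ler_norm _) (phiM x).
by apply: lb_le_inf => //; exact: lb.
Qed.

Lemma inf_conv_ball k x y e : 0 < e -> ball x e y ->
  inf_conv k x <= inf_conv k y + k%:R * e.
Proof.
move=> e0 xy; rewrite -lerBlDr; apply: lb_le_inf => // _ [z [e' [e'0 yz ->]]].
rewrite lerBlDr; apply: ge_inf => //; exists z, (e + e'); split => //.
- exact: addr_gt0.
- exact: ball_triangle xy yz.
- lra.
Qed.

Lemma inf_conv_continuous k : continuous (inf_conv k).
Proof.
move=> x; apply/cvgrPdist_le => e e0.
have e1 : 0 < e / k.+1%:R by rewrite divr_gt0.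
apply/nbhs_ballP; exists (e / k.+1%:R) => //= y xy.
have ke : k%:R * (e / k.+1%:R) <= e.
  by rewrite mulrCA ler_piMr ?(ltW e0)// ler_pdivrMr// mul1r ler_nat.
rewrite ler_norml; apply/andP; split.
  by have := le_trans (inf_conv_ball k e1 (ball_sym xy)) (lerD (lexx _) ke); lra.
by have := le_trans (inf_conv_ball k e1 xy) (lerD (lexx _) ke); lra.
Qed.

(** A competitor [y] far from [x] costs more than the oscillation of [phi] once [k] is
    large; the near ones have almost the same value. *)
Lemma inf_conv_cvg x : {for x, continuous phi} -> inf_conv k x @[k --> \oo] --> phi x.
Proof.
move=> cphi; apply/cvgrPdist_le => e e0.
have /cvgrPdist_le/(_ e e0)/nbhs_ballP[dl /= dl0 hdl] := cphi.
have M0 : 0 <= M by exact: le_trans (normr_ge0 _) (phiM x).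
exists (Num.truncn (2 * M / dl)).+1 => // k /= hk.
rewrite ger0_norm ?subr_ge0 ?inf_conv_le// lerBlDr addrC -lerBlDr.
apply: lb_le_inf => // _ [y [e' [e'0 xy ->]]].
have [ee|ee] := leP e' dl.
  have := hdl _ (le_ball ee xy); rewrite ler_norml => /andP[_ h].
  by have := mulr_ge0 (ler0n R k) (ltW e'0); lra.
have kd : 2 * M <= k%:R * dl.
  rewrite -ler_pdivrMr//; apply: (le_trans (ltW (truncnS_gt _))).
  by rewrite ler_nat.
have := ler_wpM2l (ler0n R k) (ltW ee).
have := phiM y; have := phiM x; rewrite !ler_norml => /andP[_ h1] /andP[h2 _]; lra.
Qed.

End inf_convolution.

Section weak_convergence.
Context {R : realType} {S : pseudoPMetricType R}.
Context d (T : measurableType d) (P : probability T R).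
Context d' (T' : measurableType d') (P' : probability T' R).
Context (I : Type) (F : set_system I) (FF : ProperFilter F).
Variables (X L : I -> T -> S) (Y : T' -> S).
Hypothesis mX : \forall r \near F, forall phi : S -> R, continuous phi ->
  measurable_fun setT (phi \o X r).
Hypothesis mL : \forall r \near F, forall phi : S -> R, continuous phi ->
  measurable_fun setT (phi \o L r).
Hypothesis lawL : \forall r \near F, forall phi : S -> R, continuous phi ->
  (exists M, forall x, `|phi x| <= M) -> 'E_P[phi \o L r]%E = 'E_P'[phi \o Y]%E.
Hypothesis close : forall dl eta : R, 0 < dl -> 0 < eta -> \forall r \near F,
  exists B, [/\ measurable B, (P B <= eta%:E)%E & forall w, ~ B w -> ball (L r w) dl (X r w)].

Let lower (phi : S -> R) (M e : R) : continuous phi -> (forall x, `|phi x| <= M) -> 0 < e ->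
  \forall r \near F, (\int[P]_w phi (L r w)) - e <= \int[P]_w phi (X r w).
Proof.
move=> cphi phiM e0.
have M0 : 0 <= M by exact: le_trans (normr_ge0 _) (phiM point).
have [r0 [mL0 law0]] := filter_ex (filterI mL lawL).
have cpsi k := inf_conv_continuous phiM (k := k).
have int (f : T -> R) : measurable_fun setT f -> (forall x, `|f x| <= M) ->
    P.-integrable setT (EFin \o f) by move=> mf fM; exact: bounded_integrable mf fM.
(* The law of [L r] does not depend on [r], so [k] may be chosen once. *)
have [k hk] : exists k, \int[P]_w phi (L r0 w) - e / 2 <= \int[P]_w inf_conv phi k (L r0 w).
  have [] := @dominated_convergence _ T R P setT measurableT
    (fun k w => (inf_conv phi k (L r0 w))%:E) (fun w => (phi (L r0 w))%:E) (cst M%:E).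
  - by move=> k; apply/measurable_EFinP; exact: mL0.
  - by apply/measurable_EFinP; exact: mL0.
  - apply: aeW => w _; apply: cvg_EFin; first exact: nearW.
    exact: (inf_conv_cvg phiM (cphi _)).
  - exact: finite_measure_integrable_cst.
  - by apply: aeW => w k _; rewrite lee_fin inf_conv_norm.
  move=> _ _ hc.
  have iphi := int _ (mL0 _ cphi) (fun w => phiM (L r0 w)).
  rewrite -(fineK (integrable_fin_num measurableT iphi)) in hc.
  move/fine_cvgP: hc => -[_ /cvgrPdist_le/(_ (e / 2))].
  rewrite divr_gt0// => /(_ isT)[k _ /(_ k (leqnn _)) /=].
  by rewrite ler_norml => /andP[_ h]; exists k; rewrite /Rintegral; lra.
have lawk r (phi1 : S -> R) : continuous phi1 -> (forall x, `|phi1 x| <= M) ->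
   (forall phi : S -> R, continuous phi -> measurable_fun setT (phi \o L r)) ->
   (forall phi : S -> R, continuous phi ->
    (exists M, forall x, `|phi x| <= M) -> 'E_P[phi \o L r]%E = 'E_P'[phi \o Y]%E) ->
   \int[P]_w phi1 (L r w) = \int[P]_w phi1 (L r0 w).
  move=> c1 b1 m1 l1.
  have := l1 phi1 c1 (ex_intro _ M b1); rewrite -(law0 phi1 c1 (ex_intro _ M b1)).
  by rewrite unlock /Rintegral /= => ->.
pose dl := e / (8 * k.+1%:R); pose eta := e / (8 * (M + 1)).
have dl0 : 0 < dl by rewrite divr_gt0// mulr_gt0.
have eta0 : 0 < eta by rewrite divr_gt0// mulr_gt0// ltr_pwDr.
near=> r.
have mXr : forall phi : S -> R, continuous phi -> measurable_fun setT (phi \o X r).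
  by near: r.
have mLr : forall phi : S -> R, continuous phi -> measurable_fun setT (phi \o L r).
  by near: r.
have lawr : forall phi : S -> R, continuous phi ->
  (exists M, forall x, `|phi x| <= M) -> 'E_P[phi \o L r]%E = 'E_P'[phi \o Y]%E.
  by near: r.
have [B [mB PB hB]] : exists B, [/\ measurable B, (P B <= eta%:E)%E &
  forall w, ~ B w -> ball (L r w) dl (X r w)] by near: r; exact: close.
rewrite (lawk r phi cphi phiM mLr lawr).
have := lawk r _ (cpsi k) (inf_conv_norm phiM k) mLr lawr.
have kdl : k%:R * dl <= e / 8.
  rewrite /dl invfM [e * _]mulrA mulrCA ler_piMr ?divr_ge0 ?(ltW e0)//.
  by rewrite ler_pdivrMr// mul1r ler_nat.
have Meta : 2 * M * eta <= e / 4.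
  rewrite /eta invfM !mulrA -[leRHS]mulr1 ler_pdivrMr ?ltr_pwDr//.
  have : 0 <= e * M by rewrite mulr_ge0// ltW.
  by move: (e * M) (ltW e0) => u; lra.
have i1 := int _ (mXr _ cphi) (fun w => phiM (X r w)).
have i2 := int _ (mLr _ (cpsi k)) (fun w => inf_conv_norm phiM k (L r w)).
pose c := k%:R * dl.
have i3 : P.-integrable setT (EFin \o (fun w => c + 2 * M * \1_B w)).
  apply: (@bounded_integrable _ _ _ _ _ (c + 2 * M)).
    by apply: measurable_funD => //; apply: measurable_funM.
  have c0 : 0 <= c by rewrite mulr_ge0// ltW.
  move=> w; rewrite indicE; case: (w \in B); rewrite ?mulr1 ?mulr0 ?addr0.
    by rewrite ger0_norm// addr_ge0// mulr_ge0.
  by rewrite ger0_norm// lerDl mulr_ge0.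
have pw w : inf_conv phi k (L r w) <= phi (X r w) + (c + 2 * M * \1_B w).
  have [Bw|Bw] := pselect (B w).
    have c0 : 0 <= c by rewrite mulr_ge0// ltW.
    have := inf_conv_norm phiM k (L r w); have := phiM (X r w).
    by rewrite indicE mem_set//= mulr1 !ler_norml => /andP[h1 h2] /andP[h3 h4]; lra.
  rewrite indicE memNset// mulr0 addr0.
  apply: (le_trans (inf_conv_ball phiM k dl0 (hB w Bw))).
  by rewrite lerD2r (inf_conv_le phiM).
have i13 : P.-integrable setT (EFin \o (fun w => phi (X r w) + (c + 2 * M * \1_B w))).
  have := @integrableD _ _ _ P setT measurableT _ _ i1 i3.
  by apply: eq_integrable => // w _ /=; rewrite EFinD.
have := le_Rintegral measurableT i2 i13 (fun w _ => pw w).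
rewrite RintegralD//.
have -> : \int[P]_x (c + 2 * M * \1_B x) = c + 2 * M * fine (P B).
  have iB : P.-integrable setT (EFin \o (\1_B : T -> R)) by exact: integrable_indic.
  have ic : P.-integrable setT (EFin \o (cst c : T -> R)).
    exact: finite_measure_integrable_cst.
  have iMB : P.-integrable setT (EFin \o (fun x => 2 * M * \1_B x)).
    have := @integrableZl _ _ _ P setT measurableT (2 * M) _ iB.
    by apply: eq_integrable => // w _ /=; rewrite EFinM.
  rewrite RintegralD// RintegralZl// Rintegral_cst//.
  have -> : fine (P setT) = 1 by have := @probability_setT _ _ _ P => /= ->.
  rewrite mulr1; congr (_ + _ * _).
  by rewrite /Rintegral integral_indic// setIT.
have PB' : fine (P B) <= eta.
  by rewrite -lee_fin fineK//; exact: fin_num_measure.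
have : 2 * M * fine (P B) <= 2 * M * eta by rewrite ler_wpM2l// mulr_ge0.
rewrite -/c in kdl *.
by move=> h1 h2 h3; lra.
Unshelve. all: by end_near. Qed.

(** Lower bounds for all test functions suffice, as [- phi] is one too; and a
    continuous [phi] is an increasing limit of Lipschitz functions, for which
    [X r] may be replaced by the close variable [L r]. *)
Lemma weak_convergence : cvg_in_distribution P P' F X Y.
Proof.
move=> phi cphi [M phiM].
have cN : continuous (fun x => - phi x) by move=> x; apply: cvgN; exact: cphi.
have NM x : `|- phi x| <= M by rewrite normrN.
have [r0 [mL0 law0]] := filter_ex (filterI mL lawL).
have E0 := law0 phi cphi (ex_intro _ M phiM).
have iL r : (forall phi : S -> R, continuous phi -> measurable_fun setT (phi \o L r)) ->
    'E_P[phi \o L r]%E = (\int[P]_w phi (L r w))%:E.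
  by move=> m; exact: (expectation_Rintegral _ (m _ cphi) (fun w => phiM (L r w))).
have iX r : (forall phi : S -> R, continuous phi -> measurable_fun setT (phi \o X r)) ->
    'E_P[phi \o X r]%E = (\int[P]_w phi (X r w))%:E.
  by move=> m; exact: (expectation_Rintegral _ (m _ cphi) (fun w => phiM (X r w))).
have RN (f : T -> R) : measurable_fun setT f -> (forall w, `|f w| <= M) ->
    \int[P]_w (- f w) = - \int[P]_w f w.
  move=> mf fM; have fi := bounded_integrable P mf fM.
  have := @RintegralZl _ _ _ P setT f (-1) measurableT fi.
  by rewrite mulN1r => <-; apply: eq_Rintegral => w _; rewrite mulN1r.
rewrite -E0 iL//.
suff : (\int[P]_w phi (X r w)) @[r --> F] --> \int[P]_w phi (L r0 w).
  move=> h; apply: (@cvg_trans _ ((\int[P]_w phi (X r w))%:E @[r --> F])).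
    apply: near_eq_cvg; near=> r; rewrite iX//; near: r; exact: mX.
  by apply: cvg_EFin => //; exact: nearW.
apply/cvgrPdist_le => e e0.
near=> r.
have mXr : forall phi : S -> R, continuous phi -> measurable_fun setT (phi \o X r).
  by near: r.
have mLr : forall phi : S -> R, continuous phi -> measurable_fun setT (phi \o L r).
  by near: r.
have lawr : forall phi : S -> R, continuous phi ->
  (exists M, forall x, `|phi x| <= M) -> 'E_P[phi \o L r]%E = 'E_P'[phi \o Y]%E.
  by near: r.
have EL : \int[P]_w phi (L r w) = \int[P]_w phi (L r0 w).
  have := lawr phi cphi (ex_intro _ M phiM); rewrite -E0 iL// iL// => -[]//.
have l1 : (\int[P]_w phi (L r w)) - e <= \int[P]_w phi (X r w).
  by near: r; exact: (lower cphi phiM e0).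
have l2 : (\int[P]_w (- phi (L r w))) - e <= \int[P]_w (- phi (X r w)).
  by near: r; exact: (lower cN NM e0).
move: l2; rewrite !RN//; last 2 first.
- exact: mXr.
- exact: mLr.
by rewrite ler_norml -EL => l2; apply/andP; split; lra.
Unshelve. all: by end_near. Qed.

End weak_convergence.

(** * Almost sure summability of the jumps *)

Lemma ae_lt_pinfty {R : realType} d (T : measurableType d) (P : {measure set T -> \bar R})
    (f : T -> \bar R) : measurable_fun setT f -> (forall w, (0 <= f w)%E) ->
  (\int[P]_w f w < +oo)%E -> {ae P, forall w, (f w < +oo)%E}.
Proof.
move=> mf f0 fi; have : P.-integrable setT f.
  apply/integrableP; split => //.
  by under eq_integral do rewrite gee0_abs//.
move=> /(integrable_ae measurableT); apply: filterS => w /(_ Logic.I).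
by rewrite ge0_fin_numE.
Qed.

Section poisson_summability.
Context {R : realType} d (T : measurableType d) (P : probability T R) (S : set (R * R))
  (Pi : T -> set (R * R)).
Hypothesis hPi : poisson_point_process P S (lebesgue_measure \x lebesgue_measure)%E Pi.
Hypothesis mS : measurable S.

(** Only the far points need a decay condition: almost surely there are finitely many
    points with [|y| <= 1]. *)
Lemma poisson_esum_lt_pinfty (s h : R) (f : R * R -> R) (K p : R) :
  0 <= h -> `]s, (s + h)[ `*` setT `<=` S -> 1 < p -> 0 <= K ->
  (forall q, 0 <= f q) -> (forall q, 1 < `|q.2| -> f q <= K * `|q.2| `^ (- p)) ->
  {ae P, forall w, (\esum_(q in Pi w `&` strip s h setT) (f q)%:E < +oo)%E}.
Proof.
move=> h0 sub p1 K0 f0 fK.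
have [C C0 hC] := tail_mean hPi mS p1.
have a1 : {ae P, forall w, (tail_sum Pi p s h 1 w < +oo)%E}.
  apply: ae_lt_pinfty; first exact: (measurable_tail_sum hPi mS).
    by move=> w; apply: esum_ge0 => q _; rewrite lee_fin powR_ge0.
  by apply: (le_lt_trans (hC s h 1 h0 ltr01 sub)); exact: ltry.
pose B := strip s h `[- (1 : R), 1].
have mB : measurable B by apply: measurable_strip; exact: measurable_itv.
have a2 : {ae P, forall w, (counting (Pi w `&` B) < +oo :> \bar R)%E}.
  apply: ae_lt_pinfty; first exact: (measurable_counting hPi mS mB).
    by move=> w; exact: counting_ge0.
  apply: (@le_lt_trans _ _ (2 * h * 1)%:E); last exact: ltry.
  apply: (mean_count hPi mS) => //; last exact: mu_rectangle.
    by rewrite mulr1 mulr_ge0.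
  by move=> q [q1 _]; exact: sub.
apply: filterS2 a1 a2 => w w1 w2.
have ge0 (X : set (R * R)) q : X q -> (0 <= (f q)%:E)%E by rewrite lee_fin.
rewrite (esumID [set q | 1 < `|q.2|]) => [|q _]; last by rewrite lee_fin.
apply: lte_add_pinfty.
  apply: (@le_lt_trans _ _ (K%:E * tail_sum Pi p s h 1 w)%E).
    rewrite /tail_sum -esumZ//.
    apply: (@le_trans _ _ (\esum_(q in (Pi w `&` strip s h setT) `&` [set q | 1 < `|q.2|]) (K * `|q.2| `^ (- p))%:E)).
      by apply: le_esum => q [_ q2]; rewrite lee_fin; exact: fK.
    apply: esum_subset => [q _|q [[Pq [q1 _]] q2]] //.
    by rewrite lee_fin mulr_ge0 ?powR_ge0.
  by rewrite lte_mul_pinfty.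
apply: (@le_lt_trans _ _ (\esum_(q in Pi w `&` B) (f q)%:E)).
  apply: esum_subset => [q _|q [[Pq [q1 _]] /= q2]]; first by rewrite lee_fin.
  split => //; split => //=.
  by rewrite in_itv/= -ler_norml leNgt; exact/negP.
move: w2; rewrite /counting; case: asboolP => // fB _.
rewrite esum_fset//; first by rewrite fsbig_finite//= sumEFin ltry.
by move=> q _; rewrite lee_fin.
Qed.

End poisson_summability.

Lemma derive_bound_lip {R : realType} (f : R -> R) (M : R) :
  (forall x, derivable f x 1) -> (forall x, `|derive1 f x| <= M) ->
  forall x y, `|f x - f y| <= M * `|x - y|.
Proof.
move=> df fM x y; wlog xy : x y / y <= x.
  move=> H; have [/H//|xy] := orP (le_total y x).
  by rewrite distrC (distrC x); exact: H.
move: xy; rewrite le_eqVlt => /predU1P[->|xy]; first by rewrite !subrr normr0 mulr0.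
have [c _ ->] : exists2 c, c \in `]y, x[ & f x - f y = derive1 f c * (x - y).
  apply: MVT => // [z _|]; first by rewrite derive1E; exact: derivableP.
  apply: continuous_subspaceT => z; apply: differentiable_continuous.
  exact/derivable1_diffP.
by rewrite normrM ler_wpM2r.
Qed.

(** * Resampling the future *)

Section kernel.
Context {R : realType} d (T : measurableType d) (P : probability T R) (S : set (R * R))
  (mu : set (R * R) -> \bar R) (Pi : T -> set (R * R)).
Hypothesis hPi : poisson_point_process P S mu Pi.
Hypothesis mS : measurable S.
Variable L : set (R * R).
Hypothesis mL : measurable L.

Let N1 (w : T) : @conf R := Pi w `&` L.
Let N2 (w : T) : @conf R := Pi w `&` ~` L.
Let G := point_process_sigma (fun w => Pi w `&` L).

Let mN1 : measurable_fun setT N1.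
Proof. exact: (measurable_confI (measurable_ppp hPi mS)). Qed.

Let mN2 : measurable_fun setT N2.
Proof. exact: (measurable_confI (measurable_ppp hPi mS) (measurableC mL)). Qed.

Let GE : G = preimage_set_system setT N1 measurable.
Proof.
rewrite /G /point_process_sigma -(g_sigma_preimageE setT N1 (@conf_gen R)).
congr smallest; apply/seteqP; split => E.
  move=> [A mA [B mB ->]]; exists [set N | B (counting (N `&` A))].
    by exists A => //; exists B.
  by rewrite setTI.
move=> [_ [A mA [B mB ->]] <-]; exists A => //; exists B => //.
by rewrite setTI.
Qed.

Let restricted_sigmaP E : G E <-> exists2 U : set (@conf R), measurable U & E = N1 @^-1` U.
Proof.
rewrite GE; split; first by move=> [U mU <-]; exists U => //; rewrite setTI.
by move=> [U mU ->]; exists U => //; rewrite setTI.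
Qed.

Let l1 := image_law P mN1.
Let l2 := image_law P mN2.

Let mN12 : measurable_fun setT (fun w => (N1 w, N2 w)).
Proof. exact: measurable_fun_pair. Qed.

Let joint (W : set (@conf R * @conf R)) : measurable W ->
  P [set w | W (N1 w, N2 w)] = (l1 \x l2)%E W.
Proof.
move=> mW; rewrite (@product_measure_unique _ _ _ _ R l1 l2 (image_law P mN12) _ W mW).
  exact: (esym (image_lawE P mN12 W)).
move=> A B mA mB; exact: (restr_indep hPi mS mL).
Qed.

Section stitched.
Context d' (V : measurableType d') (Phi : @conf R -> V).
Hypothesis mPhi : measurable_fun setT Phi.

(** Used with [L] the strip of the times up to the present: the past of [w] followed
    by the future of [w']. *)
Definition stitch (w w' : T) : @conf R := (Pi w `&` L) `|` (Pi w' `&` ~` L).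

Let join (N : @conf R * @conf R) : @conf R := (N.1 `&` L) `|` (N.2 `&` ~` L).

Let mjoin : measurable_fun setT join.
Proof.
apply: measurable_conf => A mA.
rewrite (_ : (fun N => _) = (fun N => counting ((N.1 : set _) `&` (L `&` A)) +
    counting ((N.2 : set _) `&` (~` L `&` A)))%E).
  apply: emeasurable_funD.
    exact: (measurableT_comp (measurable_count (measurableI _ _ mL mA)) measurable_fst).
  have mLC := measurableC mL.
  exact: (measurableT_comp (measurable_count (measurableI _ _ mLC mA)) measurable_snd).
apply/funext => N; rewrite !counting_esum (esumID L)//; congr (_ + _)%E;
  congr esum; apply/seteqP; split => q.
- by move=> [[[[]|[? ?]] ?] ?].
- by move=> [? [? ?]]; split => //; split => //; left.
- by move=> [[[[]|[? ?]] ?] ?].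
- by move=> [? [? ?]]; split => //; split => //; right.
Qed.

Let joinE w w' : join (N1 w, N2 w') = stitch w w'.
Proof. by rewrite /join /N1 /N2 /= -!setIA !setIid. Qed.

Lemma stitch_id w : stitch w w = Pi w.
Proof. by rewrite /stitch -setIUr setUv setIT. Qed.

Lemma measurable_stitch w : measurable_fun setT (stitch w).
Proof.
rewrite (_ : stitch w = fun w' => join (N1 w, N2 w')); last first.
  by apply/funext => w'; rewrite joinE.
apply: (measurableT_comp mjoin); exact: measurable_fun_pair.
Qed.

Definition stitched_law (w : T) : probability V R :=
  image_law P (measurableT_comp mPhi (measurable_stitch w)).

Let W (B : set V) : set (@conf R * @conf R) := (Phi \o join) @^-1` B.

Let mW B : measurable B -> measurable (W B).
Proof.
move=> mB; rewrite -[W B]setTI.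
exact: (measurableT_comp mPhi mjoin).
Qed.

Let stitched_lawE w B : stitched_law w B = l2 (xsection (W B) (N1 w)).
Proof.
apply: (etrans (image_lawE _ _ _)); apply/esym; apply: (etrans (image_lawE P mN2 _)).
apply/esym; congr (P _); apply/seteqP; split => w' /=.
  by rewrite -joinE => h; apply/xsectionP.
by move=> /xsectionP; rewrite /W /= joinE.
Qed.

Let msec B : measurable B ->
  measurable_fun setT (fun N : @conf R => l2 (xsection (W B) N)).
Proof. by move=> mB; apply: measurable_fun_xsection; exact: mW. Qed.

Lemma stitched_law_measurable B (V' : set (\bar R)) : measurable B -> measurable V' ->
  G ((stitched_law ^~ B) @^-1` V').
Proof.
move=> mB mV'; apply/restricted_sigmaP.
exists ((fun N : @conf R => l2 (xsection (W B) N)) @^-1` V').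
  by rewrite -[X in measurable X]setTI; exact: msec.
by apply/seteqP; split => w /=; rewrite stitched_lawE.
Qed.

(** By independence, resampling the future given the past does not change the joint
    law of past and future; this is the product formula [joint] integrated over
    the past. *)
Lemma stitched_law_integral B F : measurable B -> G F ->
  (P (F `&` [set w | B (Phi (Pi w))]) = \int[P]_(w in F) stitched_law w B)%E.
Proof.
move=> mB /restricted_sigmaP[U mU ->].
have -> : N1 @^-1` U `&` [set w | B (Phi (Pi w))] =
    [set w | (W B `&` U `*` setT) (N1 w, N2 w)].
  apply/seteqP; split => w /=.
    by move=> [h1 h2]; split => //; rewrite /W /= joinE stitch_id.
  by move=> [h1 [h2 _]]; split => //; move: h1; rewrite /W /= joinE stitch_id.
rewrite joint; last by apply: measurableI; [exact: mW|exact: measurableX].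
transitivity (\int[l1]_(N in U) l2 (xsection (W B) N))%E.
  rewrite [RHS]integral_mkcond; apply: eq_integral => N _.
  rewrite patchE /= xsectionI; case: ifPn => [NU|NU].
    rewrite in_xsectionX//; by rewrite setIT.
  by rewrite notin_xsectionX// setI0 measure0.
have := @ge0_integral_pushforward _ _ _ _ R N1 mN1 P U
  (fun N => l2 (xsection (W B) N)) mU.
move=> h; rewrite -[RHS]/(\int[P]_(w in N1 @^-1` U) (stitched_law w B))%E.
apply: etrans (etrans (h _ _) _).
- by [].
- exact: measurable_funS (msec mB).
- by move=> N _; exact: measure_ge0.
by apply: eq_integral => w _; rewrite stitched_lawE.
Qed.

End stitched.

Lemma point_process_sigma_sub F : G F -> measurable F.
Proof. by move=> /restricted_sigmaP[U mU ->]; rewrite -[X in measurable X]setTI; exact: mN1. Qed.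

End kernel.

(** * Conditional laws *)

Section conditional_laws.
Context {R : realType} d (T : measurableType d) (P : probability T R).

(** The uniqueness of densities, on the space equipped with the
    sub-sigma-algebra and the restriction of [P] to it. *)
Lemma sub_sigma_ae_eq (gen : set (set T)) (f g : T -> \bar R) :
  (forall E, <<s gen>> E -> measurable E) ->
  (forall V, measurable V -> <<s gen>> (f @^-1` V)) ->
  (forall V, measurable V -> <<s gen>> (g @^-1` V)) ->
  (forall w, 0 <= f w <= 1)%E -> (forall w, 0 <= g w <= 1)%E ->
  (forall E, <<s gen>> E -> (\int[P]_(w in E) f w = \int[P]_(w in E) g w)%E) ->
  {ae P, forall w, f w = g w}.
Proof.
move=> sub mf mg f01 g01 fg.
pose T1 := g_sigma_algebraType gen.
have mid : measurable_fun setT (id : T -> T1).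
  by move=> _ A mA; rewrite setTI; exact: sub.
pose mu := pushforward P (id : T -> T1).
have mf1 : measurable_fun setT (f : T1 -> \bar R).
  by move=> _ V mV; rewrite setTI; exact: mf.
have mg1 : measurable_fun setT (g : T1 -> \bar R).
  by move=> _ V mV; rewrite setTI; exact: mg.
have int (h : T1 -> \bar R) D : measurable D -> measurable_fun setT h ->
   (forall w, 0 <= h w <= 1)%E -> (\int[mu]_(w in D) h w = \int[P]_(w in D) h w)%E.
  move=> mD mh h01.
  apply: (@ge0_integral_pushforward _ _ _ _ R (id : T -> T1) mid P D h mD).
    exact: measurable_funS mh.
  by move=> w _; have /andP[] := h01 w.
have fi : mu.-integrable setT (f : T1 -> \bar R).
  apply/integrableP; split => //.
  under eq_integral do rewrite gee0_abs ?(andP (f01 _)).1//.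
  rewrite int//; apply: (@le_lt_trans _ _ (\int[P]_w cst 1%E w)%E).
    apply: ge0_le_integral => // [w _| |w _].
    - by have /andP[] := f01 w.
    - exact: (measurableT_comp mf1 mid).
    - by have /andP[] := f01 w.
  rewrite integral_cst// mul1e.
  by apply: (@le_lt_trans _ _ 1%E); [exact: probability_le1|exact: ltry].
have [A [mA A0 hA]] : mu.-negligible [set w | ~ (setT w -> f w = g w)].
  apply: (@integral_ae_eq _ _ R mu setT measurableT g f fi mg1) => E _ mE.
  by rewrite !int//; exact: fg.
exists A; split => //; first exact: sub.
by move=> w /= h; apply: hA => /= h'; apply: h; exact: h'.
Qed.

End conditional_laws.

Section stitched_conditional_law.
Context {R : realType} d (T : measurableType d) (P : probability T R) (S : set (R * R))
  (mu : set (R * R) -> \bar R) (Pi : T -> set (R * R)).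
Hypothesis hPi : poisson_point_process P S mu Pi.
Hypothesis mS : measurable S.
Variable L : set (R * R).
Hypothesis mL : measurable L.

(** The hypothesis only asks that Borel sets do not separate [X w] from
    [Phi (Pi w)]: distinct representatives of the same path are allowed. *)
Lemma stitched_conditional_law (V : ptopologicalType) (Phi : @conf R -> borel V)
    (mPhi : measurable_fun setT Phi) (X : T -> V) :
  {ae P, forall w (B : set (borel V)), measurable B -> B (X w) = B (Phi (Pi w))} ->
  conditional_law P (point_process_sigma (fun w => Pi w `&` L)) X
    (stitched_law hPi mS mL mPhi).
Proof.
move=> [N [mN N0 hN]] B mB; split.
  by move=> V' mV'; exact: stitched_law_measurable.
move=> F GF; rewrite -stitched_law_integral//.
rewrite (@integral_off_null _ _ _ P N mN N0 _ _ (fun w => (\1_B (Phi (Pi w)))%:E)); last first.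
  move=> w Nw; have E : B (X w) = B (Phi (Pi w)).
    by apply: contrapT => h; apply: Nw; apply: hN => /= h'; apply: h; exact: h'.
  rewrite !indicE; congr ((_ : bool)%:R)%:E.
  by apply/idP/idP => /set_mem h; apply/mem_set; [rewrite -E|rewrite E].
have mF := point_process_sigma_sub hPi mS mL GF.
have mE : measurable [set w | B (Phi (Pi w))].
  rewrite -[X in measurable X]setTI.
  exact: (measurableT_comp mPhi (measurable_ppp hPi mS)).
rewrite (_ : (fun w => _) = (fun w => (\1_[set w | B (Phi (Pi w))] w)%:E)).
  by rewrite integral_indic// setIC.
by [].
Qed.

(** Almost sure equality for one event at a time, applied to the countably many code
    sets, and then [borel_unique]. *)
Lemma conditional_law_unique (c e : R) (X : T -> cadlag c e)
    (kappa kappa' : T -> probability (borel (cadlag c e)) R) : c < e ->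
  conditional_law P (point_process_sigma (fun w => Pi w `&` L)) X kappa ->
  conditional_law P (point_process_sigma (fun w => Pi w `&` L)) X kappa' ->
  {ae P, forall w B, measurable B -> kappa w B = kappa' w B}.
Proof.
move=> ce h h'.
have one B : measurable B -> {ae P, forall w, kappa w B = kappa' w B}.
  move=> mB; have [m i] := h B mB; have [m' i'] := h' B mB.
  apply: sub_sigma_ae_eq m m' _ _ _.
  - by move=> E; exact: (point_process_sigma_sub hPi mS mL).
  - by move=> w; rewrite measure_ge0 probability_le1.
  - by move=> w; rewrite measure_ge0 probability_le1.
  by move=> E GE; rewrite -i// i'.
have : {ae P, forall w, forall n (v : {ffun 'I_(2 ^ n) -> int}),
    kappa w [set x | path_code n x = v] = kappa' w [set x | path_code n x = v]}.
  apply: ae_foralln => n.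
  have : {ae P, forall w k, if choice.unpickle k is Some v then
      kappa w [set x | path_code n x = v] = kappa' w [set x | path_code n x = v] else True}.
    apply: ae_foralln => k; case: choice.unpickle => [v|]; last by apply: aeW.
    by apply: one; exact: path_code_measurable.
  by apply: filterS => w hw v; have := hw (choice.pickle v); rewrite choice.pickleK.
apply: filterS => w hw B mB.
by apply: (borel_unique (path_disc_near ce) (path_coarsenE (d := e)) (path_code_measurable ce)).
Qed.

End stitched_conditional_law.

(** * Freezing the coefficient *)

Lemma le_sum_over {R : realType} {T : choiceType} (S : set T) (f h : T -> R) (v : R) :
  (forall q, S q -> `|f q| <= h q) -> (\esum_(q in S) (h q)%:E <= v%:E)%E ->
  `|sum_over S f| <= v.
Proof.
move=> fh hv; have h0 q : S q -> 0 <= h q by move=> /fh; exact: le_trans.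
have sh : summable S (EFin \o h).
  by apply: summable_lt => //; apply: le_lt_trans hv _; exact: ltry.
apply: le_trans (le_sum_over_psum fh sh) _.
by rewrite -lee_fin /psum fineK//; exact: summable_fin.
Qed.

Section frozen_coefficient.
Context {R : realType} (alpha : R -> R) (a b M : R).
Hypotheses (a_gt0 : 0 < a) (ab : a < b) (b1 : b < 1).
Hypothesis alpha_itv : forall x, a <= alpha x <= b.
Hypothesis M0 : 0 <= M.
Hypothesis alpha_lip : forall x y, `|alpha x - alpha y| <= M * `|x - y|.

Let J := jump alpha.
Let g := weight a b M.
Let g0 q : 0 <= g q. Proof. exact: ltW (weight_gt0 _ _ _ _ q). Qed.
Let Jg x q : `|J x q| <= g q. Proof. exact: jump_weight. Qed.
Let Jlip x x' q : `|J x q - J x' q| <= g q * `|x - x'|. Proof. exact: jump_lip. Qed.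
Let K := M / a ^+ 2.
Let K0 : 0 <= K. Proof. by rewrite divr_ge0// exprn_ge0// ltW. Qed.

Lemma jump_far x q : 1 <= `|q.2| -> `|J x q| <= `|q.2| `^ (- b^-1).
Proof.
move=> y1; apply: (le_trans (spow_norm _ _)).
have y0 : 0 < `|q.2| by exact: lt_le_trans y1.
have [h1 _] := andP (inv_alpha a_gt0 ab alpha_itv x).
rewrite !powR_exp// ler_expR; have l0 : 0 <= ln `|q.2| by exact: ln_ge0.
by apply: ler_wpM2r => //; rewrite lerN2.
Qed.

(** Large [|y|] correspond to small jumps; the logarithm produced by varying
    the exponent is absorbed by a small power [|y| ^ e]. *)
Lemma jump_diff_far x z q (e v : R) : 1 <= `|q.2| -> 0 < e -> `|x - z| <= v ->
  K * v <= e ->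
  `|J x q - J z q| <= K * v / e * `|q.2| `^ (- ((alpha z)^-1 - 2 * e)).
Proof.
move=> y1 e0 xz Kv; set y := q.2 in y1 *.
have y0 : 0 < `|y| by exact: lt_le_trans y1.
have yn : y != 0 by rewrite -normr_gt0.
have l0 : 0 <= ln `|y| by exact: ln_ge0.
set s := - (alpha x)^-1; set s' := - (alpha z)^-1.
have ss : `|s - s'| <= K * v.
  rewrite /s /s' opprK addrC distrC.
  apply: (le_trans (_ : _ <= K * `|x - z|)); last by rewrite ler_wpM2l.
  rewrite distrC distrC; exact: (inv_alpha_lip a_gt0 ab alpha_itv alpha_lip).
apply: (le_trans (spow_diff s s' yn)).
have h1 : expR (Num.max (s * ln `|y|) (s' * ln `|y|)) <= `|y| `^ (s' + e).
  rewrite powR_exp// ler_expR ge_max; apply/andP; split; apply: ler_wpM2r => //.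
    by have := ler_norm (s - s'); lra.
  by rewrite lerDl ltW.
rewrite (ger0_norm l0).
have h2 := ln_le_powR y1 e0.
have -> : K * v / e * `|y| `^ (- ((alpha z)^-1 - 2 * e)) =
    K * v * (`|y| `^ e / e) * `|y| `^ (s' + e).
  have -> : - ((alpha z)^-1 - 2 * e) = e + (s' + e) by rewrite /s'; lra.
  rewrite powRD; last by apply/implyP => _; rewrite gt_eqF.
  by move: (e^-1) => u; lra.
by apply: ler_pM; [rewrite mulr_ge0|exact: expR_ge0|exact: ler_pM|].
Qed.

Variables (a0 : R) (N : set (R * R)).
Hypothesis gN : good g N.

Let sN : summable N (EFin \o g).
Proof. exact: (good_summable (fun q => weight_gt0 a_gt0 ab b1 M0 q)). Qed.

Let X := sol J a0 N.

Lemma sol_increment (t h : R) : 0 <= h -> X (t + h) - X t =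
  sum_over (N `&` (`]t, t + h] `*` setT)) (fun q => J (presol J a0 N q.1) q).
Proof.
move=> h0; rewrite /X /sol.
have sJ : summable (upto N (t + h)) (EFin \o (fun q => J (presol J a0 N q.1) q)).
  apply: (@sub_summable _ _ N); first exact: upto_sub.
  by apply: le_summable sN => q _.
rewrite (sum_overID [set q | q.1 <= t] sJ).
have -> : upto N (t + h) `&` [set q | q.1 <= t] = upto N t.
  apply/seteqP; split => q; first by move=> [[Nq _] q1].
  by move=> [Nq /= q1]; split => //; split => //=; apply: le_trans q1 _; rewrite lerDl.
have -> : upto N (t + h) `&` ~` [set q | q.1 <= t] = N `&` (`]t, t + h] `*` setT).
  apply/seteqP; split => q.
    move=> [[Nq /= q1] /negP]; rewrite -ltNge => q2.
    by split => //; split => //=; rewrite in_itv/= q2.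
  move=> [Nq [/= + _]]; rewrite in_itv/= => /andP[q1 q2].
  by split => //=; apply/negP; rewrite -ltNge.
by lra.
Qed.

Variables (t H rho v A e : R).
Hypotheses (rho1 : 1 <= rho) (e0 : 0 < e) (Kv : K * v <= e).
Hypothesis far : forall q, N q -> t < q.1 < t + H -> rho < `|q.2|.
Hypothesis hv : (\esum_(q in N `&` strip t H [set y : R | rho < `|y|]%R)
  (`|q.2| `^ (- b^-1))%:E <= v%:E)%E.
Hypothesis hA : (\esum_(q in N `&` strip t H [set y : R | rho < `|y|]%R)
  (`|q.2| `^ (- ((alpha (X t))^-1 - 2 * e)))%:E <= A%:E)%E.

Let sub h : h < H -> N `&` (`]t, t + h] `*` setT) `<=` N `&` strip t H [set y | rho < `|y|].
Proof.
move=> hH q [Nq [/= + _]]; rewrite in_itv/= => /andP[q1 q2].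
have qH : q.1 < t + H by apply: le_lt_trans q2 _; rewrite ltrD2l.
by split => //; split => /=; [rewrite in_itv/= q1|apply: far; rewrite ?q1].
Qed.

Let far1 q : (N `&` strip t H [set y | rho < `|y|]) q -> 1 <= `|q.2|.
Proof. by move=> [_ [_ /= /ltW]]; exact: le_trans. Qed.

Lemma short_time_increment h : 0 <= h -> h < H -> `|X (t + h) - X t| <= v.
Proof.
move=> h0 hH; rewrite sol_increment//.
apply: (@le_sum_over _ _ _ _ (fun q => `|q.2| `^ (- b^-1))).
  by move=> q /(sub hH)/far1; exact: jump_far.
apply: le_trans hv; apply: esum_subset; last exact: sub.
by move=> q _; rewrite lee_fin powR_ge0.
Qed.

Lemma short_time_left_limit u : t < u < t + H -> `|presol J a0 N u - X t| <= v.
Proof.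
move=> /andP[tu uH].
have c : `|X s - X t| @[s --> u^'-] --> `|presol J a0 N u - X t|.
  by apply: cvg_norm; apply: cvgB; [exact: sol_cvg_left|exact: cvg_cst].
rewrite -(cvg_lim _ c)//; apply: limr_le; first by apply/cvg_ex; eexists; exact: c.
near=> s; have -> : s = t + (s - t) by lra.
apply: short_time_increment.
  by rewrite subr_ge0; apply: ltW; near: s; exact: nbhs_left_gt.
by rewrite ltrBlDl; apply: lt_trans uH; near: s; exact: nbhs_left_lt.
Unshelve. all: by end_near. Qed.

(** On the window the state moves by at most [v], which changes the exponent of
    every jump by at most [K * v]; the effect is summed by [jump_diff_far]. *)
Lemma frozen_coefficient h : 0 <= h -> h < H ->
  `|X (t + h) - X t - sum_over (N `&` (`]t, t + h] `*` setT)) (J (X t))| <=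
  K * v / e * A.
Proof.
move=> h0 hH; rewrite sol_increment//.
have v0 : 0 <= v by rewrite -lee_fin; apply: le_trans hv; apply: esum_ge0 => q _;
  rewrite lee_fin powR_ge0.
have sJ (w : R -> R) : summable (N `&` (`]t, t + h] `*` setT)) (EFin \o (fun q => J (w q.1) q)).
  apply: (@sub_summable _ _ N); first exact: subIsetl.
  by apply: le_summable sN => q _.
rewrite -(sum_overB (sJ _) (sJ (fun=> X t))).
set S := N `&` _; set p := (alpha (X t))^-1 - 2 * e.
have hS : (\esum_(q in S) (`|q.2| `^ (- p))%:E <= A%:E)%E.
  apply: le_trans hA; apply: esum_subset; last exact: sub.
  by move=> q _; rewrite lee_fin powR_ge0.
have c0 : 0 <= K * v / e by apply: divr_ge0; [exact: mulr_ge0|exact: ltW].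
have sp : summable S (EFin \o (fun q : R * R => `|q.2| `^ (- p))).
  apply: summable_lt => [q _|]; first exact: powR_ge0.
  by apply: le_lt_trans hS _; exact: ltry.
apply: (le_trans (le_sum_over_psum (h := fun q => K * v / e * `|q.2| `^ (- p)) _ _)).
- move=> q Sq; have := sub hH Sq => Sq'; have := far1 Sq' => q1.
  apply: jump_diff_far => //; apply: short_time_left_limit.
  by case: Sq' => _ [/= + _]; rewrite in_itv.
- exact: summableZ.
rewrite psumZ//.
rewrite ler_wpM2l// -lee_fin /psum fineK//.
by apply: summable_fin => // q _; exact: powR_ge0.
Qed.

End frozen_coefficient.

(** * Zooming and the rarity of large jumps *)

Section affine_scaling.
Context {R : realType}.

Lemma measurable_affine (k m : R) : measurable_fun setT (fun x : R => k * x + m).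
Proof. by apply: measurable_funD => //; exact: measurable_funM. Qed.

Lemma lebesgue_affine (k m : R) (A : set R) : 0 < k -> measurable A ->
  lebesgue_measure ((fun x => k * x + m) @^-1` A) = (k^-1%:E * lebesgue_measure A)%E.
Proof.
move=> k0 mA; have k0' : 0 <= k by exact: ltW.
pose f := (fun x : R => k * x + m) : _ -> measurableTypeR R.
have mf : measurable_fun setT f by exact: measurable_affine.
have h : lebesgue_measure A = mscale (NngNum k0') (pushforward (@lebesgue_measure R) f) A.
  move=> mf'; apply: lebesgue_measure_unique => // _ [[x y]] _ <-.
  rewrite -[RHS]/(k%:E * lebesgue_measure (f @^-1` `]x, y]%classic))%E.
  rewrite (_ : f @^-1` _ = `](x - m) / k, (y - m) / k]%classic).
    rewrite !lebesgue_measure_itv/= !lte_fin ltr_pM2r ?invr_gt0// ltrD2r.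
    case: ifPn => _; last by rewrite mule0.
    rewrite -!EFinD -EFinM; congr EFin; rewrite -mulrBl mulrCA mulfV ?gt_eqF// mulr1; lra.
  apply/seteqP; split => z /=; rewrite !in_itv/= /f ltr_pdivrMr// ler_pdivlMr//;
    by move=> /andP[]; rewrite mulrC; move: (z * k) => u ? ?; apply/andP; split; lra.
by rewrite (h mf) /mscale /= muleA -EFinM mulVf ?gt_eqF// mul1e.
Qed.

(** Zooming in by [1 / r] in time and contracting space by [r] preserves the
    area. *)
Definition zoom (t r : R) (q : R * R) : R * R := ((q.1 - t) / r, r * q.2).

Lemma zoom_injective t r : 0 < r -> injective (zoom t r).
Proof.
move=> r0 [x y] [x' y'] [/= h1 h2].
have rn : r != 0 by rewrite gt_eqF.
congr (_, _).
  by apply: (addIr (- t)); apply: (mulIf (_ : r^-1 != 0)) h1; rewrite invr_eq0.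
exact: mulfI h2.
Qed.

Lemma measurable_zoom t r : measurable_fun setT (zoom t r).
Proof.
apply: measurable_fun_pair.
  by apply: measurable_funM => //; exact: measurable_funB.
exact: measurable_funM.
Qed.

Lemma zoom_area t r (A : set (R * R)) : 0 < r -> measurable A ->
  (lebesgue_measure \x lebesgue_measure)%E (zoom t r @^-1` A) =
  (lebesgue_measure \x lebesgue_measure)%E A.
Proof.
move=> r0 mA.
pose z : measurableTypeR R * measurableTypeR R -> measurableTypeR R * measurableTypeR R :=
  zoom t r.
have mz : measurable_fun setT z by exact: measurable_zoom.
have h mz' := @product_measure_unique _ _ _ _ R (@lebesgue_measure R) (@lebesgue_measure R)
  (@measure_function_pushforward__canonical__measure_function_Measure _ _ _ _ R
    ((@lebesgue_measure R) \x (@lebesgue_measure R))%E z mz').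
rewrite (h mz _ A mA)// => X Y mX mY.
rewrite -[LHS]/((lebesgue_measure \x lebesgue_measure)%E (zoom t r @^-1` (X `*` Y))).
have -> : zoom t r @^-1` (X `*` Y) =
    ((fun x => r^-1 * x + (- (t / r))) @^-1` X) `*` ((fun y => r * y + 0) @^-1` Y).
  by apply/seteqP; split => -[x y] /=; rewrite addr0 mulrBl mulrC.
rewrite product_measure1E; last 2 first.
- rewrite -[X in measurable X]setTI; exact: measurable_affine.
- rewrite -[X in measurable X]setTI; exact: measurable_affine.
apply: etrans (congr2 _ (lebesgue_affine _ _ mX) (lebesgue_affine _ _ mY)) _ => //.
  by rewrite invr_gt0.
rewrite invrK muleACA -EFinM mulfV ?gt_eqF// mul1e.
by [].
Qed.

Lemma spow_scale (r y s : R) : 0 < r -> spow (r * y) s = r `^ s * spow y s.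
Proof.
move=> r0; rewrite /spow sgrM gtr0_sg// mul1r normrM (gtr0_norm r0) powRM// ?ltW//.
by rewrite mulrCA.
Qed.

(** The factor is the same for all points, as [spow] is homogeneous; this is the
    self-similarity of stable motion, path by path. *)
Lemma stable_motion_zoom (beta t r c u : R) (N : set (R * R)) : 0 < r -> u < c ->
  stable_motion beta (zoom t r @` N `&` (`]0, c[ `*` setT)) u =
  r `^ (- beta^-1) *
  sum_over (N `&` (`]t, t + r * u] `*` setT)) (fun q => spow q.2 (- beta^-1)).
Proof.
move=> r0 uc; rewrite /stable_motion -sum_overZ ?powR_gt0//.
rewrite (_ : _ `&` (`]0, u] `*` setT) = zoom t r @` (N `&` (`]t, t + r * u] `*` setT))).
  rewrite sum_over_image; last by move=> x y _ _; exact: zoom_injective.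
  by apply: eq_sum_over => q _ /=; exact: spow_scale.
have zE x : (0 < (x - t) / r <= u) = (t < x <= t + r * u).
  by rewrite ltr_pdivlMr// mul0r subr_gt0 ler_pdivrMr// lerBlDl [u * r]mulrC.
apply/seteqP; split => q.
  move=> [[[p Np <-] _] [/= + _]]; rewrite in_itv/= zE => pI.
  by exists p => //; split => //; split => //=; rewrite in_itv.
move=> [p [Np [/= + _]] <-]; rewrite in_itv/= -zE => pI.
split; last by split => //=; rewrite in_itv.
split; first by exists p.
by split => //=; rewrite in_itv/=; case/andP: pI => -> /= /le_lt_trans; apply.
Qed.

End affine_scaling.

Lemma markov_ge0 {R : realType} d (T : measurableType d) (P : {measure set T -> \bar R})
    (f : T -> \bar R) (m e : R) : measurable_fun setT f -> (forall w, 0 <= f w)%E ->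
  (\int[P]_w f w <= m%:E)%E -> 0 < e -> (P [set w | e%:E <= f w] <= (m / e)%:E)%E.
Proof.
move=> mf f0 fm e0.
have := @le_integral_comp_abse _ T R P setT measurableT f e id (@measurable_id _ _ _)
  (fun r h => h) (fun x y _ _ h => h) mf e0.
under eq_integral do rewrite /= gee0_abs//.
rewrite setTI => /le_trans/(_ fm).
rewrite (_ : [set x | (e%:E <= `|f x|)%E] = [set w | (e%:E <= f w)%E]); last first.
  by apply/seteqP; split => x /=; rewrite gee0_abs.
by rewrite -lee_pdivlMl// mulrC EFinM.
Qed.

Lemma near_power_small {R : realType} (k x e : R) : 0 < x -> 0 < e ->
  \forall r \near (0 : R)^'+, k * r `^ x <= e.
Proof.
move=> x0 e0.
have c : k * r `^ x @[r --> (0 : R)^'+] --> k * 0.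
  by apply: cvgM; [exact: cvg_cst|exact: powR_cvg0].
rewrite mulr0 in c; move/cvgrPdist_le : c => /(_ e e0).
apply: filterS => r; rewrite sub0r normrN; exact: le_trans (ler_norm _).
Qed.

Section far_points.
Context {R : realType} d (T : measurableType d) (P : probability T R) (S : set (R * R))
  (Pi : T -> set (R * R)).
Hypothesis hPi : poisson_point_process P S (lebesgue_measure \x lebesgue_measure)%E Pi.
Hypothesis mS : measurable S.
Variables (t h0 c : R).
Hypotheses (h00 : 0 < h0) (c0 : 0 < c).
Hypothesis subS : `]t, (t + h0)[ `*` setT `<=` S.

Let sub r : r * c <= h0 -> `]t, (t + r * c)[ `*` setT `<=` S.
Proof.
move=> rh q [/= + _]; rewrite in_itv/= => /andP[q1 q2]; apply: subS; split => //=.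
by rewrite in_itv/= q1/=; apply: lt_le_trans q2 _; rewrite lerD2l.
Qed.

Let near_window : \forall r \near (0 : R)^'+, 0 < r /\ r * c <= h0.
Proof.
near=> r; split; first by near: r; exact: nbhs_right_gt.
rewrite -ler_pdivlMr//; apply: ltW; near: r; apply: nbhs_right_lt.
exact: divr_gt0.
Unshelve. all: by end_near. Qed.

Let near_le (e : R) : 0 < e -> \forall r \near (0 : R)^'+, r <= e.
Proof. by move=> e0; near=> r; apply: ltW; near: r; exact: nbhs_right_lt.
Unshelve. all: by end_near. Qed.

Lemma few_close_points (m r : R) : 0 < r -> r * c <= h0 -> 0 <= m ->
  (P [set w | 1%:E <= counting (Pi w `&` strip t (r * c) `[(- (m / r))%R, (m / r)%R]) :> \bar R] <= (2 * c * m)%:E)%E.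
Proof.
move=> r0 rc m0; pose B := strip t (r * c) `[- (m / r), m / r].
have mB : measurable B by apply: measurable_strip; exact: measurable_itv.
(* The area of the rectangle does not depend on [r]. *)
have E : 2 * c * m = 2 * (r * c) * (m / r).
  transitivity (2 * c * m * (r / r)); first by rewrite divff ?mulr1// gt_eqF.
  by move: (r^-1) => u; lra.
rewrite -[2 * c * m]divr1; apply: markov_ge0 => //.
  exact: (measurable_counting hPi mS mB).
apply: (mean_count hPi mS) => //.
- by rewrite !mulr_ge0// ltW.
- by move=> q [q1 _]; apply: (sub rc).
by rewrite E; apply: mu_rectangle; [rewrite mulr_ge0// ltW|rewrite divr_ge0// ltW].
Qed.

(** Over a window of length of order [r], the points with [|y| <= m / r] have a
    mean number of order [m]; the sum of [|y| ^ - p] over the others has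
    a mean of order [r ^ p]. *)
Lemma small_tail_sum (p m y eta : R) : 1 < p -> 0 < m -> 0 < y -> 0 < eta ->
  forall x, x < p -> \forall r \near (0 : R)^'+,
  (P [set w | (y * r `^ x)%:E <= tail_sum Pi p t (r * c) (m / r) w] <= eta%:E)%E.
Proof.
move=> p1 m0 y0 eta0 x xp.
have [C C0 hC] := tail_mean hPi mS p1.
near=> r.
have [r0 rc] : 0 < r /\ r * c <= h0 by near: r.
have rc0 : 0 <= r * c by rewrite mulr_ge0// ltW.
have mr0 : 0 < m / r by rewrite divr_gt0.
have yr0 : 0 < y * r `^ x by rewrite mulr_gt0// powR_gt0.
have h := hC t (r * c) (m / r) rc0 mr0 (sub rc).
apply: le_trans (markov_ge0 (measurable_tail_sum hPi mS p t (r * c) (m / r)) _ h yr0) _.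
  by move=> w; apply: esum_ge0 => q _; rewrite lee_fin powR_ge0.
rewrite lee_fin.
have -> : C * (r * c) * (m / r) `^ (1 - p) / (y * r `^ x) =
    (C * c * m `^ (1 - p) / y) * r `^ (p - x).
  rewrite powRM ?invr_ge0 ?(ltW m0) ?(ltW r0)// -powR_inv1 ?(ltW r0)// -powRrM.
  rewrite invfM -powRN.
  have -> : r `^ (p - x) = r * (r `^ (-1 * (1 - p)) * r `^ (- x)).
    rewrite -{2}[r]powRr1 ?(ltW r0)// -!powRD; last 2 first.
    - by apply/implyP => _; rewrite gt_eqF.
    - by apply/implyP => _; rewrite gt_eqF.
    by congr powR; lra.
  by move: (r `^ (- x)) (y^-1) => u v; lra.
by near: r; apply: near_power_small => //; lra.
Unshelve. all: by end_near. Qed.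

(** A union bound. A window of length [r c] contains a point with [|y| <= m / r]
    with probability at most [2 c m], which a small [m] makes small; for this
    [m] the two sums have means of smaller order than the bounds asked for,
    by [small_tail_sum]. *)
Lemma far_points (p p' x y eta : R) : 1 < p -> 1 < p' -> x < p' -> 0 < y -> 0 < eta ->
  \forall r \near (0 : R)^'+, exists B, [/\ measurable B, (P B <= eta%:E)%E &
    forall w, ~ B w -> exists rho, [/\ 1 <= rho,
      forall q, Pi w q -> t < q.1 < t + r * c -> rho < `|q.2|,
      (tail_sum Pi p t (r * c) rho w <= r%:E)%E &
      (tail_sum Pi p' t (r * c) rho w <= (y * r `^ x)%:E)%E]].
Proof.
move=> p1 p1' xp y0 eta0.
have e3 : 0 < eta / 3 by rewrite divr_gt0.
pose m := eta / 3 / (2 * c).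
have m0 : 0 < m by rewrite divr_gt0// mulr_gt0.
near=> r.
have [r0 rc] : 0 < r /\ r * c <= h0 by near: r.
have h1 := few_close_points r0 rc (ltW m0).
have h2 : (P [set w | (1 * r `^ 1)%:E <= tail_sum Pi p t (r * c) (m / r) w] <= (eta / 3)%:E)%E.
  by near: r; exact: small_tail_sum.
have h3 : (P [set w | (y * r `^ x)%:E <= tail_sum Pi p' t (r * c) (m / r) w] <= (eta / 3)%:E)%E.
  by near: r; exact: small_tail_sum.
rewrite mul1r powRr1 ?(ltW r0)// in h2.
pose cnt w := counting (Pi w `&` strip t (r * c) `[- (m / r), m / r]) : \bar R.
have mcnt : measurable_fun setT cnt.
  by apply: (measurable_counting hPi mS); apply: measurable_strip; exact: measurable_itv.
have mset (f : T -> \bar R) (e : \bar R) : measurable_fun setT f -> measurable [set w | (e <= f w)%E].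
  move=> mf; rewrite -[X in measurable X]setTI; apply: emeasurable_fun_le => //.
exists ([set w | (1%:E <= cnt w)%E] `|`
  [set w | (r%:E <= tail_sum Pi p t (r * c) (m / r) w)%E] `|`
  [set w | ((y * r `^ x)%:E <= tail_sum Pi p' t (r * c) (m / r) w)%E]).
have M1 := mset _ 1%:E mcnt.
have M2 := mset _ r%:E (measurable_tail_sum hPi mS p t (r * c) (m / r)).
have M3 := mset _ (y * r `^ x)%:E (measurable_tail_sum hPi mS p' t (r * c) (m / r)).
split.
- by apply: measurableU => //; exact: measurableU.
- apply: (le_trans (measureU2 _ _ _)) => //; first exact: measurableU.
  have -> : eta%:E = ((eta / 3)%:E + (eta / 3)%:E + (eta / 3)%:E)%E.
    by rewrite -!EFinD; congr EFin; lra.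
  apply: leeD h3; apply: (le_trans (measureU2 _ _ _)) => //.
  apply: leeD h2; apply: (le_trans h1); rewrite lee_fin /m mulrC.
  by rewrite divfK// gt_eqF// mulr_gt0.
move=> w /not_orP[/not_orP[/= /negP + /negP +] /negP].
rewrite -!ltNge => w1 w2 w3; exists (m / r); split.
- by rewrite ler_pdivlMr// mul1r; near: r; exact: near_le.
- move=> q Pq qI; rewrite ltNge; apply/negP => qm.
  move: w1; rewrite ltNge => /negP; apply; rewrite /cnt counting_esum.
  apply: esum_ge; exists [set q].
    split; first exact: finite_set1.
    move=> _ ->; split => //; split; first by rewrite /= in_itv.
    by rewrite /= in_itv/= -ler_norml.
  by rewrite fsbig_set1.
- exact: ltW.
- exact: ltW.
Unshelve. all: by end_near. Qed.

End far_points.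

(** * Indistinguishable paths *)

Section plane_area.
Context {R : realType}.

(** The product measure, retyped on the Borel sets of the plane for the canonical
    structure of real numbers; the two sigma-algebras are the same. *)
Definition area : set (R * R) -> \bar R := (lebesgue_measure \x lebesgue_measure)%E.

Let area0 : area set0 = 0%E. Proof. exact: measure0. Qed.
Let area_ge0 A : (0 <= area A)%E. Proof. exact: measure_ge0. Qed.
Let area_additive : semi_sigma_additive area.
Proof. exact: (@measure_semi_sigma_additive _ _ _ (lebesgue_measure \x lebesgue_measure)%E). Qed.
HB.instance Definition _ := isMeasure.Build _ _ _ area area0 area_ge0 area_additive.

End plane_area.

Lemma expectation_law {R : realType} d1 (T1 : measurableType d1) (P1 : probability T1 R)
    d2 (T2 : measurableType d2) (P2 : probability T2 R) d (V : measurableType d)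
    (N1 : T1 -> V) (N2 : T2 -> V) (h : V -> R) (M : R) :
  measurable_fun setT N1 -> measurable_fun setT N2 -> measurable_fun setT h ->
  (forall x, `|h x| <= M) ->
  (forall E, measurable E -> P1 (N1 @^-1` E) = P2 (N2 @^-1` E)) ->
  'E_P1[h \o N1]%E = 'E_P2[h \o N2]%E.
Proof.
move=> m1 m2 mh hM law; rewrite unlock.
have mh' : measurable_fun setT (EFin \o h) by exact/measurable_EFinP.
have i1 : P1.-integrable (N1 @^-1` setT) ((EFin \o h) \o N1).
  exact: (@bounded_integrable _ _ _ P1 (h \o N1) M (measurableT_comp mh m1) (fun w => hM (N1 w))).
have i2 : P2.-integrable (N2 @^-1` setT) ((EFin \o h) \o N2).
  exact: (@bounded_integrable _ _ _ P2 (h \o N2) M (measurableT_comp mh m2) (fun w => hM (N2 w))).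
have := integral_pushforward m1 mh' i1 measurableT.
have := integral_pushforward m2 mh' i2 measurableT.
rewrite !preimage_setT => e2 e1.
apply: etrans (esym e1) (etrans _ e2).
apply: (@eq_measure_integral _ _ _ _
  (@measure_function_pushforward__canonical__measure_function_Measure _ _ _ _ R P2 N2 m2)
  (@measure_function_pushforward__canonical__measure_function_Measure _ _ _ _ R P1 N1 m1)).
by move=> A mA _; exact: law.
Qed.

Section indistinguishable_points.
Context {R : realType} {S : pseudoPMetricType R} (x y : S).
Hypothesis xy : forall e : R, 0 < e -> ball x e y.

Lemma indistinguishable_open (U : set S) : open U -> U x = U y.
Proof.
have key (x' y' : S) : (forall e : R, 0 < e -> ball x' e y') -> open U -> U x' -> U y'.
  move=> xy' oU Ux; have : nbhs x' U by exact: open_nbhs_nbhs.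
  by move=> /nbhs_ballP[e /= e0]; apply; exact: xy'.
move=> oU; apply/propext; split; first exact: key xy oU.
by apply: key oU => e e0; apply: ball_sym; exact: xy.
Qed.

(** In a pseudometric space a point and its copies at distance zero lie in the same
    open sets, and this property is stable under complements and countable unions. *)
Lemma indistinguishable_borel (B : set (borel S)) : measurable B -> B x = B y.
Proof.
move: B; apply: smallest_sub; last exact: indistinguishable_open.
split => [//|A Axy|A Axy]; first by apply/propext; rewrite /setD /= Axy.
by apply/propext; split => -[k _ Ak]; exists k => //; move: Ak; rewrite Axy.
Qed.

Lemma indistinguishable_continuous (phi : S -> R) : continuous phi -> phi x = phi y.
Proof.
move=> /continuous_borel mphi.
have h := indistinguishable_borel (mphi measurableT _ (measurable_set1 (phi y))).
by have [] : (setT `&` phi @^-1` [set phi y]) x by rewrite h.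
Qed.

End indistinguishable_points.

Section cadlag_representatives.
Context {R : realType} (c d : R).

Lemma cadlag_ball (f g : cadlag c d) (e e' : R) : e' < e ->
  (forall u, c <= u < d -> `|f u - g u| <= e') -> 0 <= e' -> ball f e g.
Proof.
move=> ee h e0; apply/skorohod_ballP; exists id; first exact: time_change_id.
exists e' => // u; rewrite in_itv/= => uI; rewrite subrr normr0; split => //; exact: h.
Qed.

Lemma to_cadlagE (f : R -> R) : is_cadlag c d f -> cadlag_path (to_cadlag c d f) = f.
Proof. by move=> fD; rewrite /to_cadlag; case: pselect. Qed.

Lemma to_cadlag_path (f : cadlag c d) : to_cadlag c d f = f.
Proof.
case: f => f fD; rewrite /to_cadlag /=; case: pselect => // fD'.
by congr Cadlag; exact: Prop_irrelevance.
Qed.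

Lemma is_cadlag_eq (f g : R -> R) : (forall u, c <= u < d -> f u = g u) ->
  is_cadlag c d f -> is_cadlag c d g.
Proof.
move=> fg [fr fl]; split => u uI.
  rewrite -fg//; apply: cvg_trans (fr u uI); apply: near_eq_cvg.
  case/andP: uI => cu ud; near=> x; apply: fg.
  apply/andP; split; last by near: x; exact: nbhs_right_lt.
  by apply: (le_trans cu); apply: ltW; near: x; exact: nbhs_right_gt.
have /cvg_ex[/= l hl] := fl u uI; apply/cvg_ex; exists l.
apply: cvg_trans hl; apply: near_eq_cvg.
case/andP: uI => cu ud; near=> x; apply: fg.
apply/andP; split; first by apply: ltW; near: x; exact: nbhs_left_gt.
by apply: lt_le_trans ud; near: x; exact: nbhs_left_lt.
Unshelve. all: by end_near. Qed.

End cadlag_representatives.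

Section zoomed_paths.
Context {R : realType} (c d c' d' t r : R).
Hypotheses (r0 : 0 < r) (lo : c <= t + r * c') (hi : t + r * d' <= d).

Let cvg_affine_right u : t + r * x @[x --> u^'+] --> (t + r * u)^'+.
Proof.
have cont : t + r * x @[x --> u] --> t + r * u.
  by apply: cvgD; [exact: cvg_cst|apply: cvgM; [exact: cvg_cst|exact: cvg_id]].
move=> A; rewrite /at_right /within /= => nA.
have h : \forall x \near u, t + r * u < t + r * x -> A (t + r * x) := cont _ nA.
suff : \forall x \near u, u < x -> A (t + r * x) by [].
apply: filterS h => x hx ux; apply: hx.
by rewrite ltrD2l ltr_pM2l.
Qed.

Let cvg_affine_left u : t + r * x @[x --> u^'-] --> (t + r * u)^'-.
Proof.
have cont : t + r * x @[x --> u] --> t + r * u.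
  by apply: cvgD; [exact: cvg_cst|apply: cvgM; [exact: cvg_cst|exact: cvg_id]].
move=> A; rewrite /at_left /within /= => nA.
have h : \forall x \near u, t + r * x < t + r * u -> A (t + r * x) := cont _ nA.
suff : \forall x \near u, x < u -> A (t + r * x) by [].
apply: filterS h => x hx ux; apply: hx.
by rewrite ltrD2l ltr_pM2l.
Qed.

Lemma is_cadlag_zoom (f : R -> R) (k m : R) : is_cadlag c d f ->
  is_cadlag c' d' (fun u => k * (f (t + r * u) - m)).
Proof.
move=> [fr fl]; split => u /andP[u1 u2].
  have uI : c <= t + r * u < d.
    rewrite (le_trans lo) ?lerD2l ?ler_pM2l//=; apply: lt_le_trans hi.
    by rewrite ltrD2l ltr_pM2l.
  apply: cvgM; first exact: cvg_cst.
  apply: cvgB; last exact: cvg_cst.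
  exact: (@cvg_comp _ _ _ (fun x => t + r * x) f _ _ _ (@cvg_affine_right u) (fr _ uI)).
have uI : c < t + r * u <= d.
  rewrite (le_trans _ hi) ?lerD2l ?ler_pM2l// andbT; apply: le_lt_trans lo _.
  by rewrite ltrD2l ltr_pM2l.
have /cvg_ex[/= l hl] := fl _ uI; apply/cvg_ex; exists (k * (l - m)).
apply: cvgM; first exact: cvg_cst.
apply: cvgB; last exact: cvg_cst.
exact: (@cvg_comp _ _ _ (fun x => t + r * x) f _ _ _ (@cvg_affine_left u) hl).
Qed.

End zoomed_paths.

(** * The path driven by a configuration *)

Section jump_driven_path.
Context {R : realType} (alpha : R -> R) (a b M : R).
Hypotheses (a_gt0 : 0 < a) (ab : a < b) (b1 : b < 1).
Hypothesis alpha_itv : forall x, a <= alpha x <= b.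
Hypothesis M0 : 0 <= M.
Hypothesis alpha_lip : forall x y, `|alpha x - alpha y| <= M * `|x - y|.

Definition driven_path (a0 c d : R) : conf -> cadlag c d :=
  sol_path (weight_gt0 a_gt0 ab b1 M0) (jump_weight a_gt0 ab b1 alpha_itv M0) a0 c d.

Lemma measurable_driven_path a0 c d : c < d ->
  measurable_fun setT (driven_path a0 c d : conf -> borel (cadlag c d)).
Proof.
move=> cd; apply: measurable_sol_path => //.
- exact: jump_lip.
- exact: measurable_weight.
- exact: measurable_jump alpha_itv M0 alpha_lip.
Qed.

Lemma driven_pathE a0 c d (N : conf) : good (weight a b M) N ->
  cadlag_path (driven_path a0 c d N) = sol (jump alpha) a0 N.
Proof. by move=> gN; rewrite /driven_path /sol_path /= trim_id. Qed.

Lemma measurable_good_weight : measurable (good (weight a b M) : set (@conf R)).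
Proof. exact: (measurable_good (weight_gt0 a_gt0 ab b1 M0) (measurable_weight _ _ _)). Qed.

Lemma good_sub (N N' : set (R * R)) : N' `<=` N -> good (weight a b M) N ->
  good (weight a b M) N'.
Proof.
move=> sub; apply: le_lt_trans; apply: esum_subset => // q _.
by rewrite lee_fin ltW//; exact: weight_gt0.
Qed.

Lemma good_ID (N L : set (R * R)) : good (weight a b M) (N `&` L) ->
  good (weight a b M) (N `&` ~` L) -> good (weight a b M) N.
Proof.
rewrite /good => h1 h2; rewrite (esumID L)//; first exact: lte_add_pinfty.
by move=> q _; rewrite lee_fin ltW//; exact: weight_gt0.
Qed.

Lemma poisson_good d (T : measurableType d) (P : probability T R) (S : set (R * R))
    (Pi : T -> set (R * R)) (s h : R) :
  poisson_point_process P S (lebesgue_measure \x lebesgue_measure)%E Pi ->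
  measurable S -> 0 <= h -> `]s, (s + h)[ `*` setT `<=` S ->
  {ae P, forall w, good (weight a b M) (Pi w `&` strip s h setT)}.
Proof.
move=> hPi mS h0 sub.
apply: (poisson_esum_lt_pinfty hPi mS h0 sub (tail_exp_gt1 a_gt0 ab b1)
  (K := weight_const a b M)).
- by apply: le_trans ler01 _; exact: weight_const_ge1.
- by move=> q; apply: ltW; exact: weight_gt0.
by move=> q q1; rewrite /weight ifF//; apply/negbTE; rewrite -ltNge.
Qed.

End jump_driven_path.

(** * Convergence for a fixed past *)

(** The stable motion of index [beta], as a measurable function of the point
    configuration: the jumps are those of the driven path with a constant index. *)
Section constant_index.
Context {R : realType} (a b beta : R).
Hypotheses (a_gt0 : 0 < a) (ab : a < b) (b1 : b < 1) (hbeta : a <= beta <= b).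
Variable c : R.
Hypothesis c0 : 0 < c.

Let lip0 (x y : R) : `|beta - beta| <= 0 * `|x - y|.
Proof. by rewrite subrr normr0 mul0r. Qed.

Definition motion_path : conf -> cadlag 0 c :=
  driven_path a_gt0 ab b1 (fun=> hbeta) (lexx 0) 0 0 c.

Lemma measurable_motion_path :
  measurable_fun setT (motion_path : conf -> borel (cadlag 0 c)).
Proof. exact: measurable_driven_path. Qed.

Lemma motion_pathE (A : set (R * R)) (u : R) : u < c ->
  good (weight a b 0) (A `&` (`]0, c[ `*` setT)) ->
  cadlag_path (motion_path (A `&` (`]0, c[ `*` setT))) u = stable_motion beta A u.
Proof.
move=> uc gA; rewrite driven_pathE// /sol add0r /stable_motion.
have -> : upto (A `&` (`]0, c[ `*` setT)) u = A `&` (`]0, u] `*` setT).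
  apply/seteqP; split => q.
    move=> [[Aq [/= + _]] /= qu]; rewrite in_itv/= => /andP[q0 _].
    by split => //; split => //=; rewrite in_itv/= q0.
  move=> [Aq [/= + _]]; rewrite in_itv/= => /andP[q0 qu].
  by split => //; split => //; split => //=; rewrite in_itv/= q0 (le_lt_trans qu).
by apply: eq_sum_over.
Qed.

End constant_index.

Lemma scaled_error {R : realType} (r s k e y D : R) : 0 < r ->
  `|D| <= k * r / e * (y * r `^ (s - 1)) -> r `^ (- s) * `|D| <= k / e * y.
Proof.
move=> r0 hD; apply: (le_trans (ler_wpM2l (powR_ge0 _ _) hD)).
have alg (p q i f x : R) : p * (k * x * i * (f * q)) = k * i * f * (p * q * x) by lra.
rewrite alg -powRD; last by apply/implyP => _; rewrite gt_eqF.
have -> : - s + (s - 1) = -1 by lra.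
by rewrite powR_inv1 ?(ltW r0)// mulVf ?gt_eqF// mulr1.
Qed.

Section fixed_past.
Context {R : realType} (alpha : R -> R) (a b M : R).
Hypotheses (a_gt0 : 0 < a) (ab : a < b) (b1 : b < 1).
Hypothesis alpha_itv : forall x, a <= alpha x <= b.
Hypothesis M0 : 0 <= M.
Hypothesis alpha_lip : forall x y, `|alpha x - alpha y| <= M * `|x - y|.
Variables (t0 t1 a0 t : R).
Hypotheses (t1_gt0 : 0 < t1) (htt : t0 <= t < t1).

Let S := `]t0, t1[%classic `*` [set: R].
Let S' := `](0 : R), +oo[%classic `*` [set: R].
Let L := `]t0, t]%classic `*` [set: R].
Let Sc := `]0, t1[%classic `*` [set: R].

Let t01 : t0 < t1. Proof. by case/andP: htt => ? ?; lra. Qed.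
Let mS : measurable S. Proof. by apply: measurableX => //; exact: measurable_itv. Qed.
Let mS' : measurable S'. Proof. by apply: measurableX => //; exact: measurable_itv. Qed.
Let mL : measurable L. Proof. by apply: measurableX => //; exact: measurable_itv. Qed.
Let mSc : measurable Sc. Proof. by apply: measurableX => //; exact: measurable_itv. Qed.

Context d (T : measurableType d) (P : probability T R) (Pi : T -> set (R * R)).
Hypothesis hPi : poisson_point_process P S (lebesgue_measure \x lebesgue_measure)%E Pi.
Context d' (T' : measurableType d') (P' : probability T' R) (Pi' : T' -> set (R * R)).
Hypothesis hPi' : poisson_point_process P' S' (lebesgue_measure \x lebesgue_measure)%E Pi'.

Let J := jump alpha.
Let g := weight a b M.
Let path : conf -> cadlag t0 t1 := driven_path a_gt0 ab b1 alpha_itv M0 a0 t0 t1.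
Let mpath : measurable_fun setT (path : conf -> borel (cadlag t0 t1)).
Proof. exact: measurable_driven_path. Qed.

Variable w : T.
Hypothesis gw : good g (Pi w).

Let z := sol J a0 (Pi w) t.
Let beta := alpha z.

Let PiS w' q : Pi w' q -> t0 < q.1 < t1.
Proof. by case: hPi => /(_ w')[_ sub] _ _ _ /sub[/=]; rewrite in_itv. Qed.

Lemma stitch_good w' : good g (Pi w') -> good g (stitch Pi L w w').
Proof.
move=> gw'; apply: (good_ID a_gt0 ab b1 M0 (L := L)).
  by apply: (good_sub a_gt0 ab b1 M0) gw => q [[[]|[_ nL]] Lq].
by apply: (good_sub a_gt0 ab b1 M0) gw' => q [[[_ Lq]|[]] nL].
Qed.

Lemma stitch_past w' : sol J a0 (stitch Pi L w w') t = z.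
Proof.
apply: sol_causal; apply/seteqP; split => q.
  move=> [[[]|[Pq nL]] /= qt]; first by [].
  case: nL; split => //=; rewrite in_itv/= qt andbT.
  by case/andP: (PiS Pq).
move=> [Pq /= qt]; split => //; left; split => //; split => //=.
by rewrite in_itv/= qt andbT; case/andP: (PiS Pq).
Qed.

Lemma stitch_future w' (A : set (R * R)) : (forall q, A q -> t < q.1) ->
  stitch Pi L w w' `&` A = Pi w' `&` A.
Proof.
move=> At; apply/seteqP; split => q [].
  move=> [[_ [/= + _]]|[Pq _]] Aq; last by [].
  by rewrite in_itv/= => /andP[_ /(lt_le_trans (At _ Aq))]; rewrite ltxx.
move=> Pq Aq; split => //; right; split => // -[/= + _].
by rewrite in_itv/= => /andP[_ /(lt_le_trans (At _ Aq))]; rewrite ltxx.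
Qed.

Context {V : pseudoPMetricType R} (Psi : (R -> R) -> V).
Hypothesis Psi_near : forall (f h : R -> R) (e e' : R), 0 <= e' -> e' < e ->
  is_cadlag 0 t1 f -> is_cadlag 0 t1 h ->
  (forall u, 0 <= u < t1 -> `|f u - h u| <= e') -> ball (Psi f) e (Psi h).
Hypothesis mPsi : measurable_fun setT
  ((fun f : cadlag 0 t1 => Psi f) : borel (cadlag 0 t1) -> borel V).

Lemma is_cadlag_rescale (f : cadlag t0 t1) r : 0 < r -> r * t1 <= t1 - t ->
  is_cadlag 0 t1 (rescale alpha t f r).
Proof.
move=> r0 rt; apply: (is_cadlag_zoom (c := t0) (d := t1)) => //.
- by rewrite mulr0 addr0; case/andP: htt.
- by rewrite -lerBrDl.
- exact: cadlagP.
Qed.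

Lemma measurable_rescale r : 0 < r -> r * t1 <= t1 - t ->
  measurable_fun setT ((fun f : cadlag t0 t1 => Psi (rescale alpha t f r)) :
    borel (cadlag t0 t1) -> borel V).
Proof.
move=> r0 rt.
rewrite [X in measurable_fun _ X](_ : _ = (fun f : cadlag 0 t1 => Psi f) \o
    (fun f : cadlag t0 t1 => to_cadlag 0 t1 (rescale alpha t f r))); last first.
  by apply/funext => f /=; rewrite to_cadlagE//; exact: is_cadlag_rescale.
apply: (measurableT_comp mPsi); apply: (measurable_path t1_gt0) => s /andP[s0 s1].
rewrite [X in measurable_fun _ X](_ : _ = (fun f : cadlag t0 t1 => rescale alpha t f r s));
  last by apply/funext => f; rewrite to_cadlagE//; exact: is_cadlag_rescale.
have /andP[tt0 tt1] := htt.
have ev u : t0 <= u < t1 -> measurable_fun setT (fun f : borel (cadlag t0 t1) => (f : cadlag t0 t1) u).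
  exact: measurable_eval.
have ts : t0 <= t + r * s < t1.
  rewrite (le_trans tt0) ?lerDl ?mulr_ge0// ?ltW//=.
  by apply: lt_le_trans (_ : t + r * t1 <= _); [rewrite ltrD2l ltr_pM2l|lra].
apply: measurable_funM; last by apply: measurable_funB; exact: ev.
under eq_fun do rewrite powR_exp//.
apply: measurableT_comp => //; apply: measurable_funM => //.
have mc := measurable_exponent a_gt0 ab alpha_itv M0 alpha_lip.
by apply: (measurableT_comp mc); exact: ev.
Qed.

Let X r w' : V := Psi (rescale alpha t (path (stitch Pi L w w')) r).
Let motion := motion_path a_gt0 ab b1 (alpha_itv z) t1.
Let Lim r w' : V := Psi (motion (zoom t r @` Pi w' `&` Sc)).
Let Y w' : V := Psi (stable_motion beta (Pi' w')).

Let near_r : \forall r \near (0 : R)^'+, 0 < r /\ r * t1 <= t1 - t.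
Proof.
have /andP[tt0 tt1] := htt.
near=> r; split; first by near: r; exact: nbhs_right_gt.
rewrite -ler_pdivlMr//; apply: ltW; near: r; apply: nbhs_right_lt.
by rewrite divr_gt0// subr_gt0.
Unshelve. all: by end_near. Qed.

Let mstitch : measurable_fun setT (fun w' => path (stitch Pi L w w') : borel (cadlag t0 t1)).
Proof. exact: (measurableT_comp mpath (measurable_stitch hPi mS mL w)). Qed.

Let mX r : 0 < r -> r * t1 <= t1 - t -> measurable_fun setT (X r : T -> borel V).
Proof. by move=> r0 rt; exact: (measurableT_comp (measurable_rescale r0 rt) mstitch). Qed.

Let mzoom r : 0 < r -> measurable_fun setT (fun w' => zoom t r @` Pi w' `&` Sc : @conf R).
Proof.
move=> r0; apply: (@measurable_image R _ T P S Pi (@area R)) => //.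
  exact: measurable_zoom.
exact: zoom_injective.
Qed.

Let mPi' : measurable_fun setT (fun w' => Pi' w' `&` Sc : @conf R).
Proof. exact: (measurable_confI (measurable_ppp hPi' mS')). Qed.

Let mPsim : measurable_fun setT ((fun N : conf => Psi (motion N)) : conf -> borel V).
Proof. by apply: (measurableT_comp mPsi); exact: measurable_motion_path. Qed.

Let law r (E : set conf) : 0 < r -> r * t1 <= t1 - t -> measurable E ->
  P [set w' | E (zoom t r @` Pi w' `&` Sc)] = P' [set w' | E (Pi' w' `&` Sc)].
Proof.
move=> r0 rt mE; have /andP[tt0 tt1] := htt.
apply: (@transported_law R _ T P S Pi _ T' P' S' Pi' (@area R)) => //.
- exact: measurable_zoom.
- exact: zoom_injective.
- move=> q [/= + _]; rewrite in_itv/= => /andP[q0 _]; split => //=.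
  by rewrite in_itv/= q0.
- move=> q [/= + _]; rewrite in_itv/= ltr_pdivlMr// mul0r subr_gt0 ltr_pdivrMr// => /andP[q0 q1].
  split => //=; rewrite in_itv/= (le_lt_trans tt0 q0)/=.
  by have := q1; rewrite mulrC; lra.
- by move=> A mA _; exact: zoom_area.
Qed.

Let good' : set (set (R * R)) := good (weight a b 0).

Let mgood' : measurable (good' : set (@conf R)).
Proof. exact: measurable_good_weight. Qed.

Let ae_good' : {ae P', forall w', good' (Pi' w' `&` Sc)}.
Proof.
have := @poisson_good R a b 0 a_gt0 ab b1 (lexx 0) _ T' P' S' Pi' 0 t1 hPi' mS' (ltW t1_gt0).
rewrite /strip add0r; apply.
by move=> q [/= + _]; rewrite in_itv/= => /andP[q0 _]; split => //=; rewrite in_itv/= q0.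
Qed.

Let null_zoom r : 0 < r -> r * t1 <= t1 - t ->
  P [set w' | ~ good' (zoom t r @` Pi w' `&` Sc)] = 0%E.
Proof.
move=> r0 rt; rewrite (law r0 rt (measurableC mgood')).
have [N [mN N0 hN]] := ae_good'.
apply: (subset_measure0 _ mN hN N0).
by rewrite -[X in measurable X]setTI; exact: (mPi' measurableT (measurableC mgood')).
Qed.

Let ae_good : {ae P, forall w', good g (Pi w')}.
Proof.
have h : 0 <= t1 - t0 by rewrite subr_ge0 ltW.
have := @poisson_good R a b M a_gt0 ab b1 M0 _ T P S Pi t0 (t1 - t0) hPi mS h.
rewrite /strip addrC subrK => /(_ (fun q h => h)).
apply: filterS => w'; rewrite -/S; congr (good _ _); apply/setIidl => q /PiS qI.
by split => //=; rewrite in_itv.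
Qed.

(** The frozen increments rescale exactly to the stable motion of the zoomed
    points, so the difference is the error of [frozen_coefficient] multiplied
    by [r ^ (- 1 / beta)]. *)
Let close_paths w' r rho y e u :
  0 < r -> r * t1 <= t1 - t -> good g (Pi w') -> good' (zoom t r @` Pi w' `&` Sc) ->
  1 <= rho -> 0 < e -> M / a ^+ 2 * r <= e ->
  (forall q, Pi w' q -> t < q.1 < t + r * t1 -> rho < `|q.2|) ->
  (tail_sum Pi b^-1 t (r * t1) rho w' <= r%:E)%E ->
  (tail_sum Pi (beta^-1 - 2 * e) t (r * t1) rho w' <= (y * r `^ (beta^-1 - 1))%:E)%E ->
  0 <= u < t1 ->
  `|motion (zoom t r @` Pi w' `&` Sc) u -
    rescale alpha t (path (stitch Pi L w w')) r u| <= M / a ^+ 2 / e * y.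
Proof.
move=> r0 rt gw' gz rho1 e0 Kr hfar h1 h2 /andP[u0 u1].
have gst := stitch_good gw'.
have zt : sol J a0 (stitch Pi L w w') t = z := stitch_past w'.
have pE : cadlag_path (path (stitch Pi L w w')) = sol J a0 (stitch Pi L w w').
  exact: driven_pathE.
have mE : motion (zoom t r @` Pi w' `&` Sc) u = stable_motion beta (zoom t r @` Pi w' `&` Sc) u.
  rewrite -[in LHS](setIid Sc) setIA; apply: motion_pathE; first exact: u1.
  by rewrite -setIA setIid; exact: gz.
have strips (D : set R) : stitch Pi L w w' `&` strip t (r * t1) D = Pi w' `&` strip t (r * t1) D.
  by apply: stitch_future => q [/= + _]; rewrite in_itv/= => /andP[].
have far q : stitch Pi L w w' q -> t < q.1 < t + r * t1 -> rho < `|q.2|.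
  move=> Sq qI; apply: (hfar _ _ qI); case/andP: qI => q1 _.
  have : (stitch Pi L w w' `&` [set q | t < q.1]) q by split.
  rewrite stitch_future; first by case.
  by move=> q' h; exact: h.
have fc : `|sol J a0 (stitch Pi L w w') (t + r * u) - z -
    sum_over (Pi w' `&` (`]t, t + r * u] `*` setT)) (J z)| <=
    M / a ^+ 2 * r / e * (y * r `^ (beta^-1 - 1)).
  have := @frozen_coefficient R alpha a b M a_gt0 ab b1 alpha_itv M0 alpha_lip a0
    (stitch Pi L w w') gst t (r * t1) rho r (y * r `^ (beta^-1 - 1)) e rho1 e0 Kr far.
  rewrite strips zt => /(_ h1 h2 (r * u) (mulr_ge0 (ltW r0) u0)).
  move: {h1 h2 hfar far} (r * u < r * t1) (ltr_pM2l r0 u t1) => _ ->.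
  move=> /(_ u1); rewrite stitch_future => [//|].
  by move=> q [/= + _]; rewrite in_itv/= => /andP[].
move: {h1 h2 hfar far strips} fc => fc.
rewrite mE (stable_motion_zoom beta t (Pi w') r0 u1) /rescale pE zt.
rewrite distrC -mulrBr normrM (ger0_norm (powR_ge0 _ _)).
exact: scaled_error fc.
Qed.

(** The process built on the zoomed points has, for every [r], the law of the limit
    ([law]) and is close to the rescaled path off the event of [far_points]. *)
Lemma fixed_past_convergence : cvg_in_distribution P P' ((0 : R)^'+) X Y.
Proof.
have FF : ProperFilter ((0 : R)^'+) by exact: at_right_proper_filter.
apply: (@weak_convergence R V _ T P _ T' P' R _ FF X Lim Y).
- apply: filterS near_r => r [r0 rt] phi cphi.
  exact: (measurableT_comp (continuous_borel cphi) (mX r0 rt)).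
- apply: filterS near_r => r [r0 rt] phi cphi.
  exact: (measurableT_comp (continuous_borel cphi) (measurableT_comp mPsim (mzoom r0))).
- apply: filterS near_r => r [r0 rt] phi cphi [C phiC].
  have mh := measurableT_comp (continuous_borel cphi) mPsim.
  have := @expectation_law R _ T P _ T' P' _ conf _ _ _ C (mzoom r0) mPi' mh
    (fun N => phiC (Psi (motion N))) (fun E mE => law r0 rt mE).
  move=> h; apply: etrans h _; rewrite unlock.
  have [N [mN N0 hN]] := ae_good'.
  apply: (integral_off_null mN N0) => w' Nw'.
  have gw' : good' (Pi' w' `&` Sc) by apply: contrapT => h; exact: Nw' (hN _ h).
  congr EFin; apply: (@indistinguishable_continuous R V) => // e e0.
  have E u : 0 <= u < t1 -> motion (Pi' w' `&` Sc) u = stable_motion beta (Pi' w') u.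
    by move=> /andP[_ u1]; exact: motion_pathE.
  apply: (Psi_near (e' := 0)) => //; first exact: cadlagP.
    by apply: is_cadlag_eq (E) (cadlagP _).
  by move=> u uI; rewrite E// subrr normr0.
move=> dl eta dl0 eta0.
have /andP[tt0 tt1] := htt.
have b0 : 0 < b by exact: lt_trans ab.
have hb1 : 1 < b^-1 by rewrite invf_gt1.
pose K := M / a ^+ 2.
have K0 : 0 <= K by rewrite divr_ge0// exprn_ge0// ltW.
have K1 : 0 < K + 1 by rewrite ltr_wpDl.
have [hbeta _] := andP (inv_alpha a_gt0 ab alpha_itv z).
rewrite -/beta in hbeta.
(* With this [e] the exponent [1 / beta - 2 e] exceeds [1], so that the second sum
   has a finite mean, and exceeds [1 / beta - 1], the order required of it. *)
pose e := Num.min 1 (b^-1 - 1) / 4.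
have e0 : 0 < e by rewrite divr_gt0// lt_min ltr01 subr_gt0.
have e1 : e <= 1 / 4 by rewrite /e ler_pM2r ?invr_gt0// ge_min lexx.
have eb : e <= (b^-1 - 1) / 4 by rewrite /e ler_pM2r ?invr_gt0// ge_min lexx orbT.
(* Chosen so that the error [K / e * y] is at most [dl / 2]; [K + 1] avoids a
   division by zero. *)
pose y := dl * e / (2 * (K + 1)).
have y0 : 0 < y by apply: divr_gt0; apply: mulr_gt0.
have Ky : K / e * y <= dl / 2.
  have -> : K / e * y = (dl / 2) * (K / (K + 1)) * (e / e).
    have alg (k u v f : R) : k * u * (dl * f * (2^-1 * v)) = dl / 2 * (k * v) * (f * u) by lra.
    by rewrite /y [(2 * (K + 1))^-1]invfM; exact: alg.
  rewrite divff ?gt_eqF// mulr1 ler_piMr ?divr_ge0// ?(ltW dl0)//.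
  by rewrite ler_pdivrMr// mul1r lerDl.
have far := @far_points R _ T P S Pi hPi mS t (t1 - t) t1 _ t1_gt0 _ (b^-1)
  (beta^-1 - 2 * e) (beta^-1 - 1) y eta hb1 _ _ y0 eta0.
near=> r.
have [r0 rt] : 0 < r /\ r * t1 <= t1 - t by near: r.
have Kr : K * r <= e.
  apply: le_trans (_ : (K + 1) * r <= _).
    by rewrite ler_wpM2r ?(ltW r0)// lerDl.
  rewrite -ler_pdivlMl//; apply: ltW; near: r; apply: nbhs_right_lt.
  by rewrite mulr_gt0// invr_gt0.
have [B [mB PB hB]] : exists B, [/\ measurable B, (P B <= eta%:E)%E &
    forall w, ~ B w -> exists rho, [/\ 1 <= rho,
      forall q, Pi w q -> t < q.1 < t + r * t1 -> rho < `|q.2|,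
      (tail_sum Pi b^-1 t (r * t1) rho w <= r%:E)%E &
      (tail_sum Pi (beta^-1 - 2 * e) t (r * t1) rho w <= (y * r `^ (beta^-1 - 1))%:E)%E]].
  near: r; apply: far; [by rewrite subr_gt0| |by lra|by lra].
  move=> q [/= + _]; rewrite in_itv/= => /andP[q1 q2]; split => //=.
  by rewrite in_itv/= (le_lt_trans tt0 q1)/=; apply: lt_le_trans q2 _; lra.
have [N [mN N0 hN]] := ae_good.
pose N' := [set w' | ~ good' (zoom t r @` Pi w' `&` Sc)].
have mN' : measurable N'.
  by rewrite -[X in measurable X]setTI; exact: (mzoom r0 measurableT (measurableC mgood')).
exists (B `|` (N `|` N')); split.
- by apply: measurableU => //; exact: measurableU.
- have NN : P (N `|` N') = 0%E.
    apply/eqP; rewrite eq_le measure_ge0 andbT.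
    apply: (le_trans (measureU2 _ _ _)) => //.
    have Z0 : P N' = 0%E := null_zoom r0 rt.
    by rewrite [X in (X + _)%E]N0 [X in (_ + X)%E]Z0 adde0.
  apply: (le_trans (measureU2 _ _ _)) => //; first exact: measurableU.
  by rewrite [X in (_ + X)%E]NN adde0.
move=> w' /not_orP[/hB[rho [rho1 hfar h1 h2]] /not_orP[Nw' /contrapT gz]].
have gw' : good g (Pi w') by apply: contrapT => h; exact: Nw' (hN _ h).
apply: (Psi_near (e' := dl / 2)).
- by rewrite divr_ge0// ltW.
- by rewrite ltr_pdivrMr// ltr_pMr// ltr1n.
- exact: cadlagP.
- exact: is_cadlag_rescale.
move=> u uI; apply: (le_trans _ Ky).
exact: close_paths r0 rt gw' gz rho1 e0 Kr hfar h1 h2 uI.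
Unshelve. all: by end_near. Qed.

(** Only the law of the path under [kappa] matters, and it is that of the stitched path. *)
Lemma kernel_convergence (kappa : probability (borel (cadlag t0 t1)) R) :
  (forall B, measurable B -> kappa B = P [set w' | B (path (stitch Pi L w w'))]) ->
  cvg_in_distribution kappa P' ((0 : R)^'+)
    (fun r (f : cadlag t0 t1) => Psi (rescale alpha t f r)) Y.
Proof.
move=> kappaE phi cphi phiM.
apply: cvg_trans (fixed_past_convergence cphi phiM); apply: near_eq_cvg.
have [C phiC] := phiM.
apply: filterS near_r => r [r0 rt].
have mh := measurableT_comp (continuous_borel cphi) (measurable_rescale r0 rt).
apply/esym; apply: (@expectation_law R _ _ kappa _ T P _ _ id _ _ C _ mstitch mh).
- exact: measurable_id.
- by move=> f; exact: phiC.
- exact: kappaE.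
Qed.

End fixed_past.

(** * Localization *)

Section test_functionals.
Context {R : realType} (c : R).
Hypothesis c0 : 0 < c.

Lemma to_cadlag_near (f h : R -> R) (e e' : R) : 0 <= e' -> e' < e ->
  is_cadlag 0 c f -> is_cadlag 0 c h ->
  (forall u, 0 <= u < c -> `|f u - h u| <= e') ->
  ball (to_cadlag 0 c f) e (to_cadlag 0 c h).
Proof.
move=> e0 ee cf ch fh; apply: (cadlag_ball ee) => // u uI.
by rewrite !to_cadlagE//; exact: fh.
Qed.

Lemma measurable_to_cadlag : measurable_fun setT
  ((fun f : cadlag 0 c => to_cadlag 0 c f) : borel (cadlag 0 c) -> borel (cadlag 0 c)).
Proof.
rewrite [X in measurable_fun _ X](_ : _ = id); first exact: measurable_id.
by apply/funext => f; exact: to_cadlag_path.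
Qed.

Variables (n : nat) (u : 'I_n -> R).
Hypothesis uI : forall i, 0 <= u i < c.

Lemma row_near (f h : R -> R) (e e' : R) : 0 <= e' -> e' < e ->
  is_cadlag 0 c f -> is_cadlag 0 c h ->
  (forall u, 0 <= u < c -> `|f u - h u| <= e') ->
  ball (\row_i f (u i) : 'rV[R]_n) e (\row_i h (u i)).
Proof.
move=> e0 ee _ _ fh; split; first exact: le_lt_trans ee.
by move=> i j; rewrite !mxE; apply: le_lt_trans ee; exact: fh.
Qed.

Lemma measurable_values : measurable_fun setT
  ((fun f : cadlag 0 c => \row_i f (u i)) : borel (cadlag 0 c) -> borel 'rV[R]_n).
Proof.
apply: measurable_row => i; under eq_fun do rewrite mxE.
exact: measurable_eval.
Qed.

End test_functionals.

Theorem theorem3p5 (R : realType) (t0 t1 a b a0 : R) (alpha : R -> R)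
    (d : measure_display) (Omega : measurableType d) (P : probability Omega R)
    (Pi : Omega -> set (R * R)) (Z : R -> Omega -> R)
    (ht : t0 < t1) (ht1 : 0 < t1) (ha : 0 < a) (hab : a < b) (hb : b < 1)
    (halpha : forall x, a <= alpha x <= b)
    (halpha_derivable : forall x, derivable alpha x 1)
    (halpha_C1 : continuous (derive1 alpha))
    (halpha_bounded : exists M, forall x, `|derive1 alpha x| <= M)
    (hPi : poisson_point_process P (`]t0, t1[ `*` setT)
             (lebesgue_measure \x lebesgue_measure)%E Pi)
    (hZ : forall t, t0 <= t < t1 -> measurable_fun setT (Z t))
    (hZ_path : {ae P, forall w, is_cadlag t0 t1 (Z ^~ w)})
    (hZ_sum : {ae P, forall w, forall t, t0 <= t < t1 ->
       let jump (p : R * R) :=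
         spow p.2 (- (alpha (lim (Z s w @[s --> p.1^'-])))^-1) in
       let S := Pi w `&` (`]t0, t] `*` setT) in
       summable S (EFin \o jump) /\ Z t w = a0 + sum_over S jump})
    (d' : measure_display) (Omega' : measurableType d')
    (P' : probability Omega' R) (Pi' : Omega' -> set (R * R))
    (hPi' : poisson_point_process P' (`]0, +oo[ `*` setT)
              (lebesgue_measure \x lebesgue_measure)%E Pi')
    (t : R) (htt : t0 <= t < t1) :
  let F := point_process_sigma (fun w => Pi w `&` (`]t0, t] `*` setT)) in
  let path w : cadlag t0 t1 := to_cadlag t0 t1 (Z ^~ w) in
  (exists kappa, conditional_law P F path kappa) /\
  forall kappa, conditional_law P F path kappa ->
    {ae P, forall w,
      let beta := alpha (Z t w) in
      cvg_in_distribution (kappa w) P' (0^'+ : set_system R)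
        (fun r (f : cadlag t0 t1) => to_cadlag 0 t1 (rescale alpha t f r))
        (fun w' => to_cadlag 0 t1 (stable_motion beta (Pi' w')))
      /\
      forall (n : nat) (u : 'I_n -> R), (forall i, 0 <= u i < t1) ->
        cvg_in_distribution (kappa w) P' (0^'+ : set_system R)
          (fun r (f : cadlag t0 t1) => \row_i rescale alpha t f r (u i))
          (fun w' => \row_i stable_motion beta (Pi' w') (u i))}.
Proof.
have [M hM] := halpha_bounded.
have M0 : 0 <= M by apply: le_trans (normr_ge0 _) (hM 0).
have lip := derive_bound_lip halpha_derivable hM.
pose S := `]t0, t1[%classic `*` [set: R].
pose L := `]t0, t]%classic `*` [set: R].
have mS : measurable S by apply: measurableX => //; exact: measurable_itv.
have mL : measurable L by apply: measurableX => //; exact: measurable_itv.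
have mphi := @measurable_driven_path R alpha a b M ha hab hb halpha M0 lip a0 t0 t1 ht.
have PiS w q : Pi w q -> t0 < q.1 < t1.
  by case: hPi => /(_ w)[_ sub] _ _ _ /sub[/=]; rewrite in_itv.
have ae_good : {ae P, forall w, good (weight a b M) (Pi w)}.
  have h : 0 <= t1 - t0 by rewrite subr_ge0 ltW.
  have := @poisson_good R a b M ha hab hb M0 _ Omega P S Pi t0 (t1 - t0) hPi mS h.
  rewrite /strip addrC subrK => /(_ (fun q h => h)).
  apply: filterS => w; rewrite -/S; congr (good _ _); apply/setIidl => q /PiS qI.
  by split => //=; rewrite in_itv.
have ae_sol : {ae P, forall w, [/\ good (weight a b M) (Pi w), is_cadlag t0 t1 (Z ^~ w) &
    forall s, t0 <= s < t1 -> Z s w = sol (jump alpha) a0 (Pi w) s]}.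
  apply: filterS3 ae_good hZ_path hZ_sum => w gw cw sw; split => //.
  have sN : summable (Pi w) (EFin \o weight a b M).
    exact: (good_summable (fun q => weight_gt0 ha hab hb M0 q)).
  apply: (@sol_unique R (jump alpha) (weight a b M) _ _ _ a0 (Pi w) sN t0 t1 (Z ^~ w)).
  - by move=> q; apply: ltW; exact: weight_gt0.
  - by move=> x q; exact: jump_weight.
  - by move=> x x' q; exact: jump_lip.
  - by move=> q; exact: PiS.
  move=> s sI; have [_ ->] := sw s sI; congr (_ + _).
  suff -> : upto (Pi w) s = Pi w `&` (`]t0, s] `*` setT) by [].
  apply/seteqP; split => q.
    move=> [Pq /= qs]; split => //; split => //=; rewrite in_itv/= qs andbT.
    by case/andP: (PiS w q Pq).
  by move=> [Pq [/= + _]]; rewrite in_itv/= => /andP[_ qs].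
have hcond : conditional_law P (point_process_sigma (fun w => Pi w `&` L))
    (fun w => to_cadlag t0 t1 (Z ^~ w)) (stitched_law hPi mS mL mphi).
  apply: stitched_conditional_law; apply: filterS ae_sol => w [gw cw sw] B mB.
  apply: indistinguishable_borel => // e e0; apply: (cadlag_ball e0) => // s sI.
  by rewrite to_cadlagE// driven_pathE// sw// subrr normr0.
move=> F path; split; first by exists (stitched_law hPi mS mL mphi).
move=> kappa hkappa.
have uniq := conditional_law_unique hPi mS mL ht hkappa hcond.
apply: filterS2 uniq ae_sol => w kw [gw cw sw].
have E : Z t w = sol (jump alpha) a0 (Pi w) t by exact: sw.
have kB B : measurable B -> kappa w B = P [set w' |
    B (driven_path ha hab hb halpha M0 a0 t0 t1 (stitch Pi L w w'))].
  by move=> mB; rewrite kw// /stitched_law; exact: image_lawE.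
rewrite E; split.
  apply: (@kernel_convergence R alpha a b M ha hab hb halpha M0 lip t0 t1 a0 t ht1 htt
    _ Omega P Pi hPi _ Omega' P' Pi' hPi' w gw (cadlag 0 t1)
    (to_cadlag 0 t1 : (R -> R) -> cadlag 0 t1)).
  - exact: to_cadlag_near.
  - exact: measurable_to_cadlag.
  - exact: kB.
move=> n u uI.
apply: (@kernel_convergence R alpha a b M ha hab hb halpha M0 lip t0 t1 a0 t ht1 htt
  _ Omega P Pi hPi _ Omega' P' Pi' hPi' w gw 'rV[R]_n
  (fun f : R -> R => \row_i f (u i) : 'rV[R]_n)).
- exact: row_near.
- exact: measurable_values.
- exact: kB.
Qed.
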